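(* Let $\beta\in(0,1)$ be the absolute constant (weak Beurling exponent) fixed in the context. Let $G=(V^\bullet\sqcup V^\circ,E)$ be a finite orthodiagonal map with edges of length at most $\varepsilon$, let $h^\bullet:V^\bullet\to\mathbb{R}$ be harmonic, extended to a function on $\widehat G$ by an admissible extension (see context), and let $\varphi$ be a smooth mollifier supported on the unit ball $B(0,1)\subseteq\mathbb{R}^2$. For $\delta>0$ put $\varphi_\delta(z)=\delta^{-2}\varphi(\delta^{-1}z)$. Let $z\in\widehat G$, $d=\mathrm{dist}(z,\partial\widehat G)$, and let $\delta>0$ satisfy $\varepsilon\lesssim\delta\le\frac d2$. Then $$\Delta(\varphi_\delta*h^\bullet)(z)=O\Big(\varepsilon^{\frac12}\delta^{-\frac52}\big(\|D^2\varphi\|+\|D^3\varphi\|\big)\|h^\bullet\|\Big)+O\Big(\varepsilon^{\frac{\beta}{1+\beta}}\delta^{-2}d^{-\frac{\beta}{1+\beta}}\big(\|D^2\varphi\|+\|D^3\varphi\|\big)\|h^\bullet\|\Big).$$ In particular, if $\delta\le\varepsilon^{\frac{1-\beta}{1+\beta}}d^{\frac{2\beta}{1+\beta}}$, then $$\Delta(\varphi_\delta*h^\bullet)(z)=O\Big(\varepsilon^{\frac12}\delta^{-\frac52}\big(\|D^2\varphi\|+\|D^3\varphi\|\big)\|h^\bullet\|\Big),$$ and otherwise $$\Delta(\varphi_\delta*h^\bullet)(z)=O\Big(\varepsilon^{\frac{\beta}{1+\beta}}\delta^{-2}d^{-\frac{\beta}{1+\beta}}\big(\|D^2\varphi\|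+\|D^3\varphi\|\big)\|h^\bullet\|\Big).$$
   Context: Conventions. $\varepsilon\lesssim\delta$ means $\varepsilon\le A\delta$ for a fixed constant $A$; $O(\cdot)$ hides constants depending only on $A$ and on the constant $C_0$ below (not on $G,h^\bullet,\varphi,z,\varepsilon,\delta$). A smooth mollifier supported on $B(0,1)$ is a nonnegative $C^\infty$ function supported in $B(0,1)$ with integral $1$. $\|D^k\varphi\|$ is the supremum over $\mathbb{R}^2$ of the Euclidean norm of the array of $k$-th order partial derivatives of $\varphi$. $\|h^\bullet\|=\max_{V^\bullet}|h^\bullet|$. $\Delta$ on the left is the usual Laplacian on $\mathbb{R}^2$, and $(\varphi_\delta*h^\bullet)(z)=\int\varphi_\delta(z-w)h^\bullet(w)\,dA(w)$. $a\wedge b=\min\{a,b\}$, $a\vee b=\max\{a,b\}$. Admissible extension: a measurable function on $\widehat G$ agreeing with $h^\bullet$ on $V^\bullet\cap\widehat G$ and such that its value at each $x\in\widehat G$ lies between the minimum and maximum of $h^\bullet$ over the vertices of $V^\bullet$ within distance $C_0\varepsilon$ of $x$, for a fixed absolute constant $C_0\geq 1$ (for instance, one obtained by triangulating the faces of $G^\bullet$ and interpolating linearly). Orthodiagonal maps. A finite orthodiagonal map is a finite connected plane graph $G$ all of whose edges are straight line segments, each of whose inner (bounded) faces is a quadrilateral with orthogonal diagonals (non-convex quadrilaterals are allowed), and such that the boundary of the outer face is a simple closed curve. Such a $G$ is bipartite; write its vertex set as $V^\bullet\sqcup V^\circ$ (primal and dual vertices). Each inner face $Q$ has two primal and two dual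 vertices; let $|e_Q^\bullet|$, $|e_Q^\circ|$ be the distances between its two primal, resp. two dual, vertices. The primal network $G^\bullet$ has vertex set $V^\bullet$ and, for every inner face $Q$ of $G$, an edge joining the two primal vertices of $Q$ with conductance $c=|e_Q^\circ|/|e_Q^\bullet|$. The discrete Laplacian of $f:V^\bullet\to\mathbb{R}$ is $\Delta^\bullet f(x)=\sum_{y\sim x}c(x,y)(f(y)-f(x))$. $\partial V^\bullet$ is the set of primal vertices on the boundary of the outer face of $G$ and $\mathrm{Int}(V^\bullet)=V^\bullet\setminus\partial V^\bullet$. A function $V^\bullet\to\mathbb R$ is called harmonic if $\Delta^\bullet$ of it vanishes on $\mathrm{Int}(V^\bullet)$. $\widehat G$ is the open planar domain equal to the interior of the union of the inner faces, edges and vertices of $G$. Simple random walk on $G^\bullet$ is the Markov chain jumping from $x$ to $y\sim x$ with probability $c(x,y)/\sum_{y'\sim x}c(x,y')$. The constant $\beta$. There exist absolute constants $C,C',K>0$ and $\beta\in(0,1)$ such that for every finite orthodiagonal map $G$ with edges of length at most $\varepsilon$: (i) (weak Beurling estimate) for every $u\in\mathrm{Int}(V^\bullet)$ and $r>0$, simple random walk $(S_n)$ on $G^\bullet$ started at $u$, with $\tau$ the hitting time of $\partial V^\bullet$, satisfies $\mathbb{P}^u(|S_\tau-u|\ge r)\le C\big(\frac{d_u\vee K\varepsilon}{r}\big)^\beta$ with $d_u=\mathrm{dist}(u,\partial V^\bullet)$; (ii) for every harmonic $h:V^\bullet\to\mathbb{R}$ and $x,y\in V^\bullet$ with $d'=\mathrm{dist}(x,\partial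 V^\bullet)\wedge\mathrm{dist}(y,\partial V^\bullet)>0$, $|h(y)-h(x)|\le C'\|h\|_\infty\big(\frac{|y-x|\vee K\varepsilon}{d'}\big)^\beta$. Such constants are fixed once and for all, and $\beta$ denotes this exponent. *)

(* Defs.v *)
From HB Require Import structures.
From mathcomp Require Export all_boot all_order all_algebra.
From mathcomp Require Export all_classical all_reals all_analysis.

Set Implicit Arguments.
Unset Strict Implicit.
Unset Printing Implicit Defensive.

Import Order.TTheory GRing.Theory Num.Theory.
Import numFieldNormedType.Exports.

Local Open Scope classical_set_scope.
Local Open Scope ring_scope.

(* The norm, balls and [bounded_set] that the library puts on R * R are those
   of the max norm: they give the usual topology and bornology of the plane,
   but every length below is measured with [enorm]. *)
Section Plane.
Variable R : realType.
Implicit Types (p q : R * R) (A : set (R * R)).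

Definition enorm p : R := Num.sqrt (p.1 ^+ 2 + p.2 ^+ 2).

Definition edist p q : R := enorm (p - q).

Definition edist_to p A : R := inf [set edist p q | q in A].

Definition dotp p q : R := p.1 * q.1 + p.2 * q.2.

Definition seg p q : set (R * R) :=
  [set (1 - t) *: p + t *: q | t in `[0, 1]].

Definition frontier A : set (R * R) := closure A `\` interior A.

Definition simple_closed_curve A : Prop :=
  exists g : R -> R * R,
    [/\ {within `[0, 1], continuous g}, g 0 = g 1,
        {in `[0, 1[ &, injective g} & g @` `[0, 1] = A].

(* Lebesgue measure on the plane, on Borel sets. *)
Definition leb2 : {measure set (measurableTypeR R * measurableTypeR R) -> \bar R} :=
  (@lebesgue_measure R \x @lebesgue_measure R)%E.

(* [false] and [true] stand for the first and second coordinate. *)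
Definition dir (b : bool) : R * R := if b then (0, 1) else (1, 0).

Definition partial (s : seq bool) (f : R * R -> R) : R * R -> R :=
  foldr (fun b g => 'D_(dir b) g) f s.

Definition smooth (f : R * R -> R) : Prop :=
  forall s : seq bool,
    continuous (partial s f) /\
    forall b p, derivable (partial s f) p (dir b).

Definition laplacian (f : R * R -> R) (p : R * R) : R :=
  partial [:: false; false] f p + partial [:: true; true] f p.

(* The array of k-th order partial derivatives is indexed by {1, 2}^k. *)
Definition norm_D (k : nat) (f : R * R -> R) : R :=
  sup (range (fun p => Num.sqrt (\sum_(s : k.-tuple bool) partial s f p ^+ 2))).

Definition mollifier (phi : R * R -> R) : Prop :=
  [/\ smooth phi, forall p, 0 <= phi p,
      forall p, 1 <= enorm p -> phi p = 0 &
      (\int[leb2]_p (phi p)%:E = 1)%E].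

Definition rescale (phi : R * R -> R) (delta : R) (p : R * R) : R :=
  delta ^- 2 * phi (delta^-1 *: p).

(* [g] is only meaningful on [D], and is convolved as a function on [D]. *)
Definition convolution_on (D : set (R * R)) (f g : R * R -> R) (p : R * R) : R :=
  Rintegral leb2 D (fun q => f (p - q) * g q).

End Plane.

(* A bipartite straight-line graph drawn in the plane, given with its
   bipartition into primal and dual vertices. *)
Record bigraph (R : realType) := Bigraph {
  primal : finType;
  dual : finType;
  ppos : primal -> R * R;
  dpos : dual -> R * R;
  edge : primal -> dual -> bool
}.

Section Bigraph.
Variables (R : realType) (G : bigraph R).

Local Notation V := (primal G).
Local Notation W := (dual G).

Definition pos (a : V + W) : R * R :=
  match a with inl x => ppos x | inr w => dpos w end.

Definition adj (a b : V + W) : bool :=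
  match a, b with
  | inl x, inr w => edge x w
  | inr w, inl x => edge x w
  | _, _ => false
  end.

Definition eseg (x : V) (w : W) : set (R * R) := seg (ppos x) (dpos w).

Definition drawing : set (R * R) :=
  range pos `|` [set p | exists (x : V) (w : W), edge x w /\ eseg x w p].

Definition plane_graph : Prop :=
  [/\ injective pos,
      forall (a : V + W) x w, edge x w -> eseg x w (pos a) -> a = inl x \/ a = inr w &
      forall (x : V) (w : W) (x' : V) (w' : W), edge x w -> edge x' w' -> (x, w) <> (x', w') ->
        forall p, eseg x w p -> eseg x' w' p ->
          (x = x' /\ p = ppos x) \/ (w = w' /\ p = dpos w)].

Definition inner_face (F : set (R * R)) : Prop :=
  bounded_set F /\
  exists2 p, (~` drawing) p & F = connected_component (~` drawing) p.

Definition outer_face : set (R * R) :=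
  [set p | (~` drawing) p /\
           ~ bounded_set (connected_component (~` drawing) p)].

(* In a plane graph the four sides below form a Jordan curve; a bounded face
   having this curve as its frontier is the region that the curve encloses. *)
Definition quad_face (F : set (R * R)) (x : V) (w : W) (y : V) (w' : W) : Prop :=
  [/\ x != y, w != w', [&& edge x w, edge y w, edge y w' & edge x w'] &
      frontier F = eseg x w `|` eseg y w `|` eseg y w' `|` eseg x w'].

Definition orthodiagonal_map : Prop :=
  [/\ plane_graph,
      forall a b : V + W, connect adj a b,
      forall F, inner_face F -> exists x w y w',
        quad_face F x w y w' /\ dotp (ppos y - ppos x) (dpos w' - dpos w) = 0 &
      simple_closed_curve (frontier outer_face)].

Definition edges_le (eps : R) : Prop :=
  forall (x : V) (w : W), edge x w -> edist (ppos x) (dpos w) <= eps.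

Definition Ghat : set (R * R) :=
  interior (drawing `|` \bigcup_(F in inner_face) F).

Definition bdryV (x : V) : Prop := frontier outer_face (ppos x).

Definition dist_bdryV (x : V) : R := edist_to (ppos x) (@ppos R G @` bdryV).

(* Several inner faces may share their primal diagonal, and their conductances
   in parallel add up. Each such face is met twice in the sum, as (w, w') and
   as (w', w), whence the factor 1/2. *)
Definition conductance (x y : V) : R :=
  2^-1 * \sum_(w : W) \sum_(w' : W)
    if `[< exists2 F, inner_face F & quad_face F x w y w' >]
    then edist (dpos w) (dpos w') / edist (ppos x) (ppos y) else 0.

Definition dlaplacian (f : V -> R) (x : V) : R :=
  \sum_(y : V) conductance x y * (f y - f x).

Definition harmonic (h : V -> R) : Prop :=
  forall x, ~ bdryV x -> dlaplacian h x = 0.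

Definition max_norm (h : V -> R) : R := \big[Num.max/0]_(x : V) `|h x|.

Definition admissible_extension
    (C0 eps : R) (h : V -> R) (H : R * R -> R) : Prop :=
  [/\ measurable_fun (Ghat : set (measurableTypeR R * measurableTypeR R))
        (H : measurableTypeR R * measurableTypeR R -> measurableTypeR R),
      forall x, Ghat (ppos x) -> H (ppos x) = h x &
      forall p, Ghat p ->
        (exists2 x, edist (ppos x) p <= C0 * eps & h x <= H p) /\
        (exists2 x, edist (ppos x) p <= C0 * eps & H p <= h x)].

Definition srw_prob (x y : V) : R :=
  conductance x y / \sum_(z : V) conductance x z.

(* The condition at rank n + 1 is the Markov property, with the denominator of
   the conditional probability cleared. *)
Definition simple_random_walk (d : measure_display) (T : measurableType d)
    (P : probability T R) (S : nat -> T -> V) (u : V) : Prop :=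
  [/\ forall n x, measurable [set t | S n t = x],
      P [set t | S 0%N t = u] = 1%E &
      forall n (s : nat -> V),
        (P [set t | forall i, (i <= n.+1)%N -> S i t = s i] =
         P [set t | forall i, (i <= n)%N -> S i t = s i] *
         (srw_prob (s n) (s n.+1))%:E)%E].

(* [hits S n t]: the hitting time of the boundary is n on the trajectory t. *)
Definition hits (T : Type) (S : nat -> T -> V) (n : nat) (t : T) : Prop :=
  bdryV (S n t) /\ forall m, (m < n)%N -> ~ bdryV (S m t).

End Bigraph.

Definition weak_beurling (R : realType) (C K beta : R) : Prop :=
  forall (G : bigraph R) (eps : R), orthodiagonal_map G -> edges_le G eps ->
  forall u : primal G, ~ bdryV u -> forall r : R, 0 < r ->
  forall (d : measure_display) (T : measurableType d) (P : probability T R)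
    (S : nat -> T -> primal G), simple_random_walk P S u ->
  (P [set t | exists2 n, hits S n t & (r <= edist (ppos (S n t)) (ppos u))%R] <=
   (C * (Num.max (dist_bdryV u) (K * eps) / r) `^ beta)%:E)%E.

Definition harmonic_holder (R : realType) (C' K beta : R) : Prop :=
  forall (G : bigraph R) (eps : R), orthodiagonal_map G -> edges_le G eps ->
  forall h : primal G -> R, harmonic h ->
  forall x y : primal G,
    let d' := Num.min (dist_bdryV x) (dist_bdryV y) in 0 < d' ->
    `|h y - h x| <= C' * max_norm h *
      (Num.max (edist (ppos y) (ppos x)) (K * eps) / d') `^ beta.

Definition beurling_constants (R : realType) (C C' K beta : R) : Prop :=
  [/\ [/\ 0 < C, 0 < C' & 0 < K], 0 < beta < 1,
      weak_beurling C K beta & harmonic_holder C' K beta].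

(* Main.v *)
(* Put f = phi_delta (z - .), so that Delta (phi_delta * h) (z) is the integral of
   h Delta f, and let omega be a bound of order ||h|| (eps / d)^beta for the
   oscillation of h at scale eps within 7 delta / 4 of z, given by the Hoelder
   estimate (ii). Since f vanishes at boundary vertices, summation by parts gives
   sum_x h(x) Delta^bullet f(x) = 0. Replace h by its inf-convolution k at scale eps:
   |h - k| <= omega and k is (omega / eps)-Lipschitz. Up to a term in ||D^2 f||,
   c(x, y) (f(y) - f(x)) is the flux of grad f, taken at the midpoint, through the
   dual diagonal. Such midpoint fluxes are antisymmetric, and an edge of G has one
   face on each side, so the sum can be regrouped into fluxes around the faces; the
   flux around a face is its area times Delta f, up to a term in ||D^3 f||. All the
   errors are proportional to the areas of the faces, which add up to O(delta^2),
   whence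
     |Delta (phi_delta * h) (z)| <=
       M delta^-2 (||D^2 phi|| + ||D^3 phi||) ||h|| ((eps / d)^beta + eps / delta).
   (If eps / delta is not small, this is the trivial bound.)
   Both eps / d and eps / delta are bounded, which allows the exponents to be
   lowered to beta / (1 + beta) and 1 / 2; the threshold on delta is where the two
   resulting terms are equal. *)
Require Import Defs.
From HB Require Import structures.
From mathcomp Require Import ring lra measurable_realfun.

Set Implicit Arguments.
Unset Strict Implicit.
Unset Printing Implicit Defensive.

Import Order.TTheory GRing.Theory Num.Theory.
Import numFieldNormedType.Exports.
Local Open Scope classical_set_scope.
Local Open Scope ring_scope.

(** The Hoelder estimate bounds the oscillation of [h] by the same quantity for all pairs of
    vertices closer than [eps], however close, while the number of faces meeting the disc is not
    controlled by [eps] and [delta], since faces can be arbitrarily thin. An error of order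
    [omega * eps] times the dual diagonal could not be summed over the faces; each error has to
    carry the product of both diagonals, which is twice the area. The Lipschitz function [k]
    supplies the missing primal length in the terms that are antisymmetric in the two primal
    vertices. The difference [h - k] is merely bounded; against it the increment of [f] is first
    stripped of its linear part, which sums to zero around each vertex near [z]. Faces are given
    only as bounded components with a prescribed frontier, and they may be non-convex. Their areas
    and their sides are obtained without the Jordan curve theorem, by cutting each face along a
    diagonal that lies inside it and identifying it with the union of two triangles. *)

Definition cross (R : realType) (u v : R * R) : R := u.1 * v.2 - u.2 * v.1.

(** Twice the signed area of the triangle, positive when it is counterclockwise. Locking keeps
    coordinate rewriting and simplification from expanding it before [orientE] is invoked. *)
HB.lock Definition orient (R : realType) (p q r : R * R) : R :=
  (q.1 - p.1) * (r.2 - p.2) - (q.2 - p.2) * (r.1 - p.1).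

(** * Plane geometry *)

Section EuclideanPlane.
Variable R : realType.
Implicit Types (p q r u v a b c d : R * R) (k t s : R).

Lemma fstD p q : (p + q).1 = p.1 + q.1. Proof. by []. Qed.
Lemma sndD p q : (p + q).2 = p.2 + q.2. Proof. by []. Qed.
Lemma fstB p q : (p - q).1 = p.1 - q.1. Proof. by []. Qed.
Lemma sndB p q : (p - q).2 = p.2 - q.2. Proof. by []. Qed.
Lemma fstN p : (- p).1 = - p.1. Proof. by []. Qed.
Lemma sndN p : (- p).2 = - p.2. Proof. by []. Qed.
Lemma fstZ k p : (k *: p).1 = k * p.1. Proof. by []. Qed.
Lemma sndZ k p : (k *: p).2 = k * p.2. Proof. by []. Qed.
Definition coordE := (fstB, sndB, fstD, sndD, fstN, sndN, fstZ, sndZ).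

Lemma planeP p q : p.1 = q.1 -> p.2 = q.2 -> p = q.
Proof. by case: p q => [? ?] [? ?] /= -> ->. Qed.

Lemma enorm_ge0 p : 0 <= enorm p. Proof. exact: sqrtr_ge0. Qed.

Lemma sqr_enorm p : enorm p ^+ 2 = p.1 ^+ 2 + p.2 ^+ 2.
Proof. by rewrite sqr_sqrtr// addr_ge0// sqr_ge0. Qed.

Lemma enorm_le k p : 0 <= k -> p.1 ^+ 2 + p.2 ^+ 2 <= k ^+ 2 -> enorm p <= k.
Proof. by move=> k0 h; rewrite -(ler_pXn2r (n := 2))// ?nnegrE ?enorm_ge0// sqr_enorm. Qed.

Lemma enormN p : enorm (- p) = enorm p.
Proof. by rewrite /enorm !coordE !sqrrN. Qed.

Lemma enormZ k p : enorm (k *: p) = `|k| * enorm p.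
Proof. by rewrite /enorm !coordE !exprMn -mulrDr sqrtrM ?sqr_ge0// sqrtr_sqr. Qed.

Lemma norm_fst_le p : `|p.1| <= enorm p.
Proof. by rewrite -sqrtr_sqr ler_sqrt ?addr_ge0 ?sqr_ge0// lerDl sqr_ge0. Qed.

Lemma norm_snd_le p : `|p.2| <= enorm p.
Proof. by rewrite -sqrtr_sqr ler_sqrt ?addr_ge0 ?sqr_ge0// lerDr sqr_ge0. Qed.

Lemma enorm_le_normD p : enorm p <= `|p.1| + `|p.2|.
Proof.
apply: enorm_le; first by rewrite addr_ge0.
rewrite -(real_normK (num_real p.1)) -(real_normK (num_real p.2)).
by have := mulr_ge0 (normr_ge0 p.1) (normr_ge0 p.2); nra.
Qed.

Lemma dotp_le u v : dotp u v <= enorm u * enorm v.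
Proof.
apply: (le_trans (ler_norm _)).
rewrite -(ler_pXn2r (n := 2))// ?nnegrE ?mulr_ge0 ?enorm_ge0//.
rewrite exprMn !sqr_enorm real_normK ?num_real// /dotp -subr_ge0.
have -> : (u.1 ^+ 2 + u.2 ^+ 2) * (v.1 ^+ 2 + v.2 ^+ 2) -
  (u.1 * v.1 + u.2 * v.2) ^+ 2 = (u.1 * v.2 - u.2 * v.1) ^+ 2 by ring.
exact: sqr_ge0.
Qed.

Lemma ler_enormD p q : enorm (p + q) <= enorm p + enorm q.
Proof.
apply: enorm_le; first by rewrite addr_ge0 ?enorm_ge0.
have := dotp_le p q; have := sqr_enorm p; have := sqr_enorm q.
by rewrite /dotp !coordE; nra.
Qed.

Lemma edistC p q : edist p q = edist q p.
Proof. by rewrite /edist -enormN opprB. Qed.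

Lemma edist_ge0 p q : 0 <= edist p q. Proof. exact: enorm_ge0. Qed.

Lemma edistpp p : edist p p = 0.
Proof. by rewrite /edist subrr /enorm /= expr0n/= addr0 sqrtr0. Qed.

Lemma edist_triangle q p r : edist p r <= edist p q + edist q r.
Proof. by rewrite /edist (_ : p - r = (p - q) + (q - r)) ?ler_enormD// addrA subrK. Qed.

Lemma enorm_eq0 p : enorm p = 0 -> p = 0.
Proof.
move=> p0; have := norm_fst_le p; have := norm_snd_le p; rewrite p0 !normr_le0.
by move=> /eqP h2 /eqP h1; apply: planeP.
Qed.

Lemma enorm_gt0 p : p != 0 -> 0 < enorm p.
Proof.
by move=> p0; rewrite lt_neqAle enorm_ge0 andbT eq_sym; apply: contra p0 => /eqP/enorm_eq0->.
Qed.

Lemma orientE p q r :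
  orient p q r = (q.1 - p.1) * (r.2 - p.2) - (q.2 - p.2) * (r.1 - p.1).
Proof. by rewrite unlock. Qed.

Lemma orient_cross p q r : orient p q r = cross (q - p) (r - p).
Proof. by rewrite orientE /cross !coordE. Qed.

Lemma orient_rot p q r : orient q r p = orient p q r.
Proof. by rewrite !orientE; ring. Qed.

Lemma orient_swap p q r : orient p r q = - orient p q r.
Proof. by rewrite !orientE; ring. Qed.

Lemma orient_comb p q r r' t :
  orient p q ((1 - t) *: r + t *: r') = (1 - t) * orient p q r + t * orient p q r'.
Proof. by rewrite !orientE !coordE; ring. Qed.

(** The coefficients, once divided by [orient a b d], are the barycentric coordinates of [q]; with
    the denominator cleared this is a polynomial identity. *)
Lemma barycentric a b d q : orient a b d *: q =
  orient b d q *: a + orient d a q *: b + orient a b q *: d.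
Proof. by apply: planeP; rewrite !orientE !coordE; ring. Qed.

Lemma orient_sum a b d q : orient b d q + orient d a q + orient a b q = orient a b d.
Proof. by rewrite !orientE; ring. Qed.

(** The sign conditions make [q] a convex combination of the vertices, and the distance to [r] is
    convex. *)
Lemma triangle_bound a b d q r k : 0 < orient a b d ->
  0 <= orient a b q -> 0 <= orient b d q -> 0 <= orient d a q ->
  edist a r <= k -> edist b r <= k -> edist d r <= k -> edist q r <= k.
Proof.
move=> D0 h1 h2 h3 ka kb kd.
have e : orient a b d *: (q - r) = orient b d q *: (a - r) +
  orient d a q *: (b - r) + orient a b q *: (d - r).
  by apply: planeP; rewrite !coordE !orientE; ring.
rewrite -(ler_pM2l D0) -[X in X * edist _ _](gtr0_norm D0) -enormZ e.
apply: (le_trans (ler_enormD _ _)); apply: le_trans (lerD (ler_enormD _ _) (lexx _)) _.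
rewrite !enormZ !ger0_norm// -(orient_sum a b d q) !mulrDl.
by apply: lerD; [apply: lerD|]; apply: ler_wpM2l.
Qed.

Lemma segE p q r : seg p q r <-> exists t, [/\ 0 <= t, t <= 1 & r = (1 - t) *: p + t *: q].
Proof.
split; first by case=> t /=; rewrite in_itv/= => /andP[t0 t1] <-; exists t.
by case=> t [t0 t1 ->]; exists t => //=; rewrite in_itv/= t0.
Qed.

Lemma segC p q : seg p q = seg q p.
Proof.
have sub u v : seg u v `<=` seg v u.
  move=> _ /segE[t [t0 t1 ->]]; apply/segE; exists (1 - t); split; rewrite ?subr_ge0 ?gerBl//.
  by rewrite subKr addrC.
by apply/seteqP; split; apply: sub.
Qed.

Lemma seg_left p q : seg p q p.
Proof. by apply/segE; exists 0; rewrite subr0 scale1r scale0r addr0; split. Qed.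

Lemma seg_right p q : seg p q q.
Proof. by rewrite segC; exact: seg_left. Qed.

Lemma seg_edist p q r : seg p q r -> edist p r <= edist p q.
Proof.
move=> /segE[t [t0 t1 ->]].
have -> : edist p ((1 - t) *: p + t *: q) = t * edist p q.
  by rewrite /edist -[X in X * _](ger0_norm t0) -enormZ; congr enorm; apply: planeP; rewrite !coordE; ring.
by rewrite ler_piMl ?edist_ge0.
Qed.

Definition midpoint p q : R * R := 2^-1 *: (p + q).

Lemma midpointC p q : midpoint p q = midpoint q p.
Proof. by rewrite /midpoint addrC. Qed.

Lemma seg_midpoint p q : seg p q (midpoint p q).
Proof.
by apply/segE; exists (2^-1); split; [lra|lra|apply: planeP; rewrite !coordE; field].
Qed.

Lemma midpoint_neql p q : p <> q -> midpoint p q <> p.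
Proof.
move=> pq e; apply: pq; move: (congr1 fst e) (congr1 snd e); rewrite !coordE => e1 e2.
by apply: planeP; lra.
Qed.

(** On the line through [a] and [b] the barycentric weight of [d] vanishes, and the other two
    weights are the parameter of the segment and its complement. *)
Lemma seg_orient a b d q : 0 < orient a b d -> orient a b q = 0 ->
  0 <= orient d a q -> 0 <= orient b d q -> seg a b q.
Proof.
move=> D0 e h1 h2; have D1 : orient a b d != 0 by rewrite gt_eqF.
have E := orient_sum a b d q; rewrite e addr0 in E.
apply/segE; exists (orient d a q / orient a b d); split.
- by rewrite divr_ge0// ltW.
- by rewrite ler_pdivrMr// mul1r -E lerDr.
apply: (scalerI D1); rewrite barycentric e scale0r addr0 scalerDr !scalerA.
congr (_ *: _ + _ *: _); last by rewrite mulrC divfK.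
by rewrite mulrBr mulr1 mulrC divfK// -E addrK.
Qed.

End EuclideanPlane.

(** * Topology of the plane in terms of the Euclidean distance *)

Section PlaneTopology.
Variable R : realType.
Implicit Types (p q r u v a b c d : R * R) (A B C F : set (R * R)).

Lemma nbhs_edistP p A :
  nbhs p A <-> exists2 e : R, 0 < e & forall q, edist p q < e -> A q.
Proof.
split.
  move=> /nbhs_ballP[e /= e0 h]; exists e => // q pq; apply: h.
  split => /=; rewrite /ball/=; apply: le_lt_trans pq.
    exact: (norm_fst_le (p - q)).
  exact: (norm_snd_le (p - q)).
move=> [e e0 h]; apply/nbhs_ballP; exists (e / 2) => /=; first by rewrite divr_gt0.
move=> q [/= q1 q2]; apply: h; apply: (le_lt_trans (enorm_le_normD _)).
by rewrite (splitr e); apply: ltrD.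
Qed.

Lemma interior_edistP A p :
  interior A p <-> exists2 e : R, 0 < e & forall q, edist p q < e -> A q.
Proof. exact: nbhs_edistP. Qed.

Lemma closure_edistP A p :
  closure A p <-> forall e : R, 0 < e -> exists2 q, A q & edist p q < e.
Proof.
split=> [cA e e0|h B /nbhs_edistP[e e0 eB]].
  have [|q [Aq pq]] := cA [set q | edist p q < e]; last by exists q.
  by apply/nbhs_edistP; exists e.
by have [q Aq pq] := h e e0; exists q; split => //; exact: eB.
Qed.

Lemma open_edistP A :
  open A <-> forall p, A p -> exists2 e : R, 0 < e & forall q, edist p q < e -> A q.
Proof.
rewrite openE; split=> h p Ap; first exact/interior_edistP/h.
exact/interior_edistP/h.
Qed.

Lemma continuous_edist p : continuous (edist p : R * R -> R^o).
Proof.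
move=> q; apply/cvgrPdist_lt => e e0; apply/nbhs_edistP; exists e => // r qr.
apply: le_lt_trans qr; rewrite ler_norml.
have := edist_triangle q p r; have := edist_triangle r p q.
by rewrite (edistC r q) => h1 h2; apply/andP; split; lra.
Qed.

(** Off the frontier of [A], lying in its closure and lying in its interior are the same, so [A]
    cuts out of [C] a set that is open and closed in [C]. This stands in for the Jordan curve
    theorem in [face_kite]. *)
Lemma connected_avoid_frontier C A p :
  connected C -> C p -> A p -> C `&` frontier A = set0 -> C `<=` A.
Proof.
move=> cC Cp Ap CA.
have CE q : C q -> closure A q -> interior A q.
  move=> Cq clq; apply: contrapT => nq.
  by have : (C `&` frontier A) q by []; rewrite CA.
have : C `&` interior A = C.
  apply: cC.
  - by exists p; split => //; apply: CE => //; exact: subset_closure.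
  - by exists (interior A) => //; exact: open_interior.
  - exists (closure A); first exact: closed_closure.
    apply/seteqP; split=> q [Cq Aq]; split=> //.
      by apply: subset_closure; exact: interior_subset.
    exact: CE.
by move=> CI q; rewrite -CI => -[_ /interior_subset].
Qed.

Lemma continuous_segment p q : continuous (fun t : R^o => (1 - t) *: p + t *: q : R * R).
Proof.
move=> t; apply: cvgD.
  by apply: cvgZr_tmp; apply: cvgB; [exact: cvg_cst|exact: cvg_id].
by apply: cvgZr_tmp; exact: cvg_id.
Qed.

Lemma connected_seg p q : connected (seg p q).
Proof.
apply: connected_continuous_connected; first exact/connected_intervalP/interval_is_interval.
by apply: continuous_subspaceT => t; exact: continuous_segment.
Qed.

Lemma connected_ray p q : connected [set p + s *: q | s in `[(0:R), +oo[ ].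
Proof.
apply: connected_continuous_connected; first exact/connected_intervalP/interval_is_interval.
apply: continuous_subspaceT => t; apply: cvgD; first exact: cvg_cst.
by apply: cvgZr_tmp; exact: cvg_id.
Qed.

Lemma star_connected A o : A o -> (forall q, A q -> seg o q `<=` A) -> connected A.
Proof.
move=> Ao h; rewrite (_ : A = \bigcup_(q in A) seg o q).
  apply: bigcup_connected => [|q _]; last exact: connected_seg.
  by exists o => q _; exact: seg_left.
apply/seteqP; split=> [q Aq|q [r Ar]]; first by exists q => //; exact: seg_right.
exact: h.
Qed.

Lemma open_connected_component A p : open A -> open (connected_component A p).
Proof.
move=> /open_edistP oA; apply/open_edistP => q Cq.
have [e e0 eA] := oA _ (connected_component_sub Cq); exists e => // r qr.
apply: (connected_component_trans Cq); exists (seg q r) => //; last exact: seg_right.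
split; first exact: seg_left; last exact: connected_seg.
by move=> s /seg_edist qs; apply: eA; apply: le_lt_trans qr.
Qed.

Lemma bounded_setP A : bounded_set A -> exists M : R, forall p, A p -> enorm p <= M.
Proof.
move=> /pinfty_ex_gt0[M M0 h]; exists (M + M) => p /h /=; rewrite prod_normE ge_max => /andP[h1 h2].
by apply: le_trans (enorm_le_normD _) _; rewrite lerD.
Qed.

End PlaneTopology.

Lemma small_pos (R : realType) (x y : R) : 0 < x ->
  exists2 e : R, 0 < e & forall s : R, 0 < s -> s < e -> 0 < x + s * y /\ 0 < x - s * y.
Proof.
move=> x0; have y1 : 0 < 1 + `|y| by rewrite ltr_pwDl.
exists (x / (1 + `|y|)); first by rewrite divr_gt0.
move=> s s0; rewrite ltr_pdivlMr// => h.
have h1 : s * y <= s * `|y| by rewrite ler_pM2l// ler_norm.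
have h2 : - (s * `|y|) <= s * y by rewrite -mulrN ler_pM2l// lerNnormlW.
by split; nra.
Qed.

Definition rot90 (R : realType) (u : R * R) : R * R := (- u.2, u.1).

(** * Quadrilaterals with orthogonal diagonals *)

Section Quadrilateral.
Variable R : realType.
Implicit Types (p q r u v a b c d o : R * R) (A B C F : set (R * R)).

Definition tri a b d : set (R * R) :=
  [set q | [/\ 0 <= orient a b q, 0 <= orient d a q & 0 <= orient b d q]].

(** Open along the sides [a b] and [d a] but closed along [b d]: two such triangles glued along
    [b d] give the open quadrilateral, with the interior of the diagonal included. *)
Definition tri_part a b d : set (R * R) :=
  [set q | [/\ 0 < orient a b q, 0 < orient d a q & 0 <= orient b d q]].

(** Meant for [0 < orient a b d] and [0 < orient c d b], that is, for a quadrilateral containing its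
    diagonal [b d]. Nothing is assumed on the side lengths, and a reflex angle may occur at [b] or
    [d]. *)
Definition kite a b c d : set (R * R) := tri_part a b d `|` tri_part c d b.

Definition quad_curve a b c d : set (R * R) :=
  seg a b `|` seg b c `|` seg c d `|` seg d a.

Lemma orient_seg_ge0 p q r r' : 0 <= orient p q r -> 0 <= orient p q r' ->
  forall s, seg r r' s -> 0 <= orient p q s.
Proof.
move=> h h' _ /segE[t [t0 t1 ->]]; rewrite orient_comb addr_ge0// mulr_ge0//.
by rewrite subr_ge0.
Qed.

Lemma orient_seg_gt0 p q r r' : 0 < orient p q r -> 0 < orient p q r' ->
  forall s, seg r r' s -> 0 < orient p q s.
Proof.
move=> h h' _ /segE[t [t0 t1 ->]]; rewrite orient_comb.
have [->|tn0] := eqVneq t 0; first by rewrite mul0r addr0 subr0 mul1r.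
by rewrite ltr_wpDl ?mulr_ge0 ?subr_ge0// 1?ltW// mulr_gt0// lt_neqAle eq_sym tn0.
Qed.

Lemma orientxx p q : orient p p q = 0. Proof. by rewrite orientE; ring. Qed.
Lemma orientxr p q : orient p q q = 0. Proof. by rewrite orientE; ring. Qed.
Lemma orientxl p q : orient p q p = 0. Proof. by rewrite orientE; ring. Qed.

Lemma tri_convex a b d p q : tri a b d p -> tri a b d q -> seg p q `<=` tri a b d.
Proof.
move=> [p1 p2 p3] [q1 q2 q3] s ps.
by split; [apply: orient_seg_ge0 ps|apply: orient_seg_ge0 ps|apply: orient_seg_ge0 ps].
Qed.

Lemma tri_part_convex a b d p q :
  tri_part a b d p -> tri_part a b d q -> seg p q `<=` tri_part a b d.
Proof.
move=> [p1 p2 p3] [q1 q2 q3] s ps.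
by split; [apply: orient_seg_gt0 ps|apply: orient_seg_gt0 ps|apply: orient_seg_ge0 ps].
Qed.

Lemma orient_midpoint p q r r' :
  orient p q (midpoint r r') = 2^-1 * (orient p q r + orient p q r').
Proof. by rewrite !orientE /midpoint !coordE; field. Qed.

Section Kite.
Variables a b c d : R * R.
Hypotheses (abd : 0 < orient a b d) (cdb : 0 < orient c d b).
Let o := midpoint b d.

Lemma dab : 0 < orient d a b. Proof. by rewrite orient_rot orient_rot. Qed.
Lemma bda : 0 < orient b d a. Proof. by rewrite orient_rot. Qed.
Lemma bcd : 0 < orient b c d. Proof. by rewrite orient_rot orient_rot. Qed.
Lemma dbc : 0 < orient d b c. Proof. by rewrite orient_rot. Qed.

Lemma kite_midpoint : tri_part a b d o /\ tri_part c d b o.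
Proof.
have := (dab, bda, bcd, dbc) => -[[[h1 h2] h3] h4].
split; split; rewrite orient_midpoint ?orientxx ?orientxr ?orientxl.
- by rewrite add0r mulr_gt0.
- by rewrite addr0 mulr_gt0.
- by rewrite addr0 mulr0.
- by rewrite addr0 mulr_gt0.
- by rewrite add0r mulr_gt0.
- by rewrite addr0 mulr0.
Qed.

Lemma tri_part_sub p q r : tri_part p q r `<=` tri p q r.
Proof. by move=> s [h1 h2 h3]; split; rewrite // ltW. Qed.

Lemma kite_connected : connected (kite a b c d).
Proof.
have [k1 k2] := kite_midpoint.
apply: (star_connected (o := o)); first by left.
by move=> q [] qk; [move=> s /(tri_part_convex k1 qk); left|move=> s /(tri_part_convex k2 qk); right].
Qed.

Let T := tri a b d `|` tri c d b.

Lemma curve_sub_tri : quad_curve a b c d `<=` T.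
Proof.
have := (dab, bda, bcd, dbc) => -[[[h1 h2] h3] h4].
have H p q r : 0 < orient p q r -> tri p q r p /\ tri p q r q /\ tri p q r r.
  move=> D; split; [|split]; split; rewrite ?orientxx ?orientxr ?orientxl//.
  - by rewrite orient_rot ltW.
  - by rewrite orient_rot orient_rot ltW.
  - exact: ltW.
have [ta [tb td]] := H _ _ _ abd; have [tc [td' tb']] := H _ _ _ cdb.
move=> p [[[]|]|] ps.
- by left; apply: tri_convex ps.
- by right; apply: tri_convex ps.
- by right; apply: tri_convex ps.
- by left; apply: tri_convex ps.
Qed.

Lemma tri_off_curve p : T p -> ~ quad_curve a b c d p -> kite a b c d p.
Proof.
have := (dab, bda, bcd, dbc) => -[[[h1 h2] h3] h4].
move=> [] [p1 p2 p3] np; [left|right]; split => //; rewrite lt_neqAle ?p1 ?p2 andbT eq_sym;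
  apply/eqP => e; apply: np.
- by left; left; left; apply: (seg_orient abd).
- by right; apply: (seg_orient h1).
- by left; right; apply: (seg_orient cdb).
- by left; left; right; apply: (seg_orient h3).
Qed.

(** The vertex [s] lies across the line [q r], so a side ending at [s] meets the half-plane of the
    triangle only at [q] or [r], and both points are excluded by a strict inequality of
    [tri_part]. *)
Lemma tri_part_off_curve p q r s u : orient p q r > 0 -> orient q r s < 0 ->
  tri_part p q r u -> ~ quad_curve p q s r u.
Proof.
move=> D D' [u1 u2 u3] [[[]|]|] /segE[t [t0 t1 uE]]; move: u1 u2 u3;
  rewrite uE !orient_comb ?(orientxx, orientxr, orientxl).
- by rewrite !mulr0 addr0 ltxx.
- rewrite !mulr0 !add0r => u1 _; rewrite nmulr_lge0// => t0'.
  by move: u1; have -> : t = 0 by [apply/le_anti; rewrite t0' t0]; rewrite mul0r ltxx.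
- rewrite !mulr0 !addr0 => _ u2; rewrite nmulr_lge0// => t0'.
  by move: u2; have -> : 1 - t = 0 by [apply/le_anti; rewrite t0' subr_ge0 t1]; rewrite mul0r ltxx.
- by rewrite !mulr0 !add0r => _; rewrite ltxx.
Qed.

Lemma kite_off_curve p : kite a b c d p -> ~ quad_curve a b c d p.
Proof.
have := (dab, bda, bcd, dbc) => -[[[h1 h2] h3] h4].
move=> [] pk.
  by apply: tri_part_off_curve pk => //; rewrite orient_swap -orient_rot oppr_lt0.
have: ~ quad_curve c d a b p by apply: tri_part_off_curve pk => //; rewrite orient_swap -orient_rot oppr_lt0.
by rewrite /quad_curve => h; apply: contra_not h; rewrite /setU/=; tauto.
Qed.

(** Both triangles are convex and contain [o], and [p] lies between [o] and the point further
    out. *)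
Lemma ray_off_tri p s : ~ T p -> 0 <= s -> ~ T (p + s *: (p - o)).
Proof.
move=> np s0 h; apply: np; have s1 : 1 + s != 0 by rewrite gt_eqF// ltr_pwDl.
have [/tri_part_sub k1 /tri_part_sub k2] := kite_midpoint.
have ps : seg o (p + s *: (p - o)) p.
  apply/segE; exists (1 + s)^-1; split; first by rewrite invr_ge0 addr_ge0.
    by rewrite invf_le1 ?lerDl// ltr_pwDl.
  by apply: planeP; rewrite !coordE; field.
by case: h => h; [left|right]; apply: tri_convex ps.
Qed.

(** A point of [F] outside the closed triangles could escape to infinity along a ray from [o]
    without meeting the frontier, contrary to boundedness. Conversely the kite is connected and
    misses the frontier, so it cannot leave [F]. *)
Lemma face_kite F : F !=set0 -> open F -> connected F -> bounded_set F ->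
  frontier F = quad_curve a b c d -> F = kite a b c d.
Proof.
move=> [p0 Fp0] oF cF /bounded_setP[M FM] fF.
have FT : F `<=` T.
  move=> p Fp; apply: contrapT => np.
  have po : p - o != 0.
    rewrite subr_eq0; apply/eqP => e; apply: np; rewrite e; left.
    by have [/tri_part_sub] := kite_midpoint.
  have rF : [set p + s *: (p - o) | s in `[(0:R), +oo[ ] `<=` F.
    apply: (connected_avoid_frontier (@connected_ray _ _ _) _ Fp).
      by exists 0 => /=; rewrite ?in_itv/= ?lexx// scale0r addr0.
    rewrite fF -subset0 => _ [[s /= + <-] /curve_sub_tri].
    by rewrite in_itv/= andbT => s0 /(ray_off_tri np s0).
  (* With this choice the displacement along the ray has length [|M| + 1 + enorm p], which carries
     the point beyond the bound [M]. *)
  pose s := (`|M| + 1 + enorm p) / enorm (p - o).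
  have e0 := enorm_gt0 po.
  have s0 : 0 <= s by rewrite divr_ge0 ?enorm_ge0// !addr_ge0 ?enorm_ge0.
  have /rF/FM : [set p + s *: (p - o) | s in `[(0:R), +oo[ ] (p + s *: (p - o)).
    by exists s => //=; rewrite in_itv/= s0.
  have := ler_enormD (p + s *: (p - o)) (- p).
  rewrite addrAC subrr add0r enormN enormZ (ger0_norm s0) divfK ?gt_eqF//.
  have := ler_norm M; lra.
have FG p : F p -> ~ quad_curve a b c d p.
  by move=> Fp; rewrite -fF => -[_]; apply; apply/interior_edistP; move/open_edistP: oF; apply.
have Fk : F `<=` kite a b c d by move=> p Fp; apply: tri_off_curve (FT _ Fp) (FG _ Fp).
apply/seteqP; split => //.
apply: (connected_avoid_frontier kite_connected (Fk _ Fp0) Fp0).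
by rewrite fF -subset0 => p [/kite_off_curve].
Qed.

End Kite.

Lemma orient_shift p q r v (s : R) :
  orient p q (r + s *: v) = orient p q r + s * cross (q - p) v.
Proof. by rewrite !orientE /cross !coordE; ring. Qed.

Lemma cross_rot90 u : cross u (rot90 u) = enorm u ^+ 2.
Proof. by rewrite sqr_enorm /cross /rot90/=; ring. Qed.

Lemma orient_neq p q r : orient p q r != 0 -> 0 < enorm (q - p) ^+ 2.
Proof.
move=> h; rewrite exprn_gt0// enorm_gt0//; apply: contra h => /eqP h.
by rewrite orient_cross h /cross !mul0r subrr.
Qed.

(** Both forms of [tri_part] are provided because it is not invariant under rotation of the
    vertices, and a directed side can occupy either open place. The last two inequalities keep the
    point on the right out of a triangle glued across one of the other sides. *)
Lemma tri_left p q r : 0 < orient p q r ->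
  exists2 e : R, 0 < e & forall s : R, 0 < s -> s < e ->
    [/\ tri_part p q r (midpoint p q + s *: rot90 (q - p)),
      tri_part q r p (midpoint p q + s *: rot90 (q - p)),
      orient p q (midpoint p q - s *: rot90 (q - p)) < 0,
      orient r q (midpoint p q - s *: rot90 (q - p)) < 0 &
      orient p r (midpoint p q - s *: rot90 (q - p)) < 0].
Proof.
move=> D; set v := rot90 _.
have m1 : orient p q (midpoint p q) = 0 by rewrite orient_midpoint orientxl orientxr addr0 mulr0.
have m2 : 0 < orient q r (midpoint p q) by rewrite orient_midpoint orientxl addr0 orient_rot mulr_gt0.
have m3 : 0 < orient r p (midpoint p q) by rewrite orient_midpoint orientxr add0r 2!orient_rot mulr_gt0.
have [e1 e10 h1] := small_pos (cross (r - q) v) m2.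
have [e2 e20 h2] := small_pos (cross (p - r) v) m3.
exists (Num.min e1 e2); first by rewrite lt_min e10.
move=> s s0; rewrite lt_min => /andP[se1 se2].
have [p1 n1] := h1 s s0 se1; have [p2 n2] := h2 s s0 se2.
have n0 := orient_neq (lt0r_neq0 D).
have sw (x y w : R * R) : orient y x w = - orient x y w by rewrite !orientE; ring.
have P0 : 0 < orient p q (midpoint p q + s *: v).
  by rewrite orient_shift m1 add0r cross_rot90 mulr_gt0.
have P1 : 0 < orient q r (midpoint p q + s *: v) by rewrite orient_shift.
have P2 : 0 < orient r p (midpoint p q + s *: v) by rewrite orient_shift.
split; first by split => //; exact: ltW.
- by split => //; exact: ltW.
- by rewrite -scaleNr orient_shift m1 add0r cross_rot90 mulNr oppr_lt0 mulr_gt0.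
- by rewrite sw oppr_lt0 -scaleNr orient_shift mulNr.
- by rewrite sw oppr_lt0 -scaleNr orient_shift mulNr.
Qed.

End Quadrilateral.

(** Sidedness is tested only along the normal through the midpoint. This suffices: two faces on the
    same side of an edge then share a point and hence coincide. *)
Definition on_left (R : realType) (F : set (R * R)) (p q : R * R) :=
  exists2 e : R, 0 < e & forall s : R, 0 < s -> s < e ->
    F (midpoint p q + s *: rot90 (q - p)) /\
    ~ F (midpoint p q - s *: rot90 (q - p)).

Section KiteSides.
Variable R : realType.
Implicit Types (p q r u v a b c d o : R * R).

Lemma kiteC a b c d : kite a b c d = kite c d a b.
Proof. exact: setUC. Qed.

Lemma kite_left_ab a b c d : 0 < orient a b d -> on_left (kite a b c d) a b.
Proof.
move=> abd; have [e e0 h] := tri_left abd; exists e => // s s0 /h -/(_ s0)[h1 h3 h4 h5 h6].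
split; first by left.
by move=> [[/ltW]|[_ _]]; rewrite leNgt ?h4// -leNgt leNgt h5.
Qed.

Lemma kite_left_da a b c d : 0 < orient a b d -> on_left (kite a b c d) d a.
Proof.
rewrite -orient_rot -orient_rot => dab; have [e e0 h] := tri_left dab.
exists e => // s s0 /h -/(_ s0)[h1 h3 h4 h5 h6].
split; first by left.
by move=> [[_ /ltW]|[_ _]]; rewrite leNgt ?h4// -leNgt leNgt h6.
Qed.

Lemma kite_left a b c d : 0 < orient a b d -> 0 < orient c d b ->
  [/\ on_left (kite a b c d) a b, on_left (kite a b c d) b c,
      on_left (kite a b c d) c d & on_left (kite a b c d) d a].
Proof.
move=> abd cdb; split; [exact: kite_left_ab|rewrite kiteC; exact: kite_left_da|
  rewrite kiteC; exact: kite_left_ab|exact: kite_left_da].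
Qed.

(** By [s1] and [s2], [b] and [c] lie on opposite sides of the line [d a], and [a] and [d] on
    opposite sides of the line [b c]. The common point is given by Cramer's rule, with determinant
    [K]. *)
Lemma crossing a b c d : 0 < cross (c - a) (d - b) ->
  orient a b d <= 0 -> orient b c a <= 0 -> seg b c `&` seg d a !=set0.
Proof.
move=> D h1 h2.
have E : orient d a c - orient d a b = orient b c d - orient b c a.
  by rewrite !orientE; ring.
have s1 : cross (c - a) (d - b) = orient d a c + orient b c a.
  by rewrite !orientE /cross !coordE; ring.
have s2 : cross (c - a) (d - b) = orient b c d + orient a b d.
  by rewrite !orientE /cross !coordE; ring.
have e1 : orient d a b = orient a b d by rewrite !orientE; ring.
pose K := orient d a c - orient d a b.
have K0 : 0 < K by rewrite /K e1; lra.
have K1 : K != 0 by rewrite gt_eqF.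
exists ((1 - (- orient d a b / K)) *: b + (- orient d a b / K) *: c); split; apply/segE.
  exists (- orient d a b / K); split => //.
    by rewrite divr_ge0 ?oppr_ge0 ?e1// ltW.
  by rewrite ler_pdivrMr// mul1r /K; lra.
exists (orient b c d / K); split.
- by rewrite divr_ge0// ?ltW//; lra.
- by rewrite ler_pdivrMr// mul1r /K E; lra.
have dK : forall v w, K *: v = K *: w -> v = w by move=> v w; apply: scalerI.
apply: dK; rewrite !scalerDr !scalerA !mulrBr !mulr1 !(mulrC K) !divfK//.
rewrite {1}/K /K E; apply: planeP; rewrite !coordE !orientE; ring.
Qed.

(** Each orientation in the conclusion belongs to one corner. By [crossing], two consecutive corners
    cannot both be nonpositive, so one of the two opposite pairs is positive, and a diagonal lies
    inside. *)
Lemma quad_split a b c d : 0 < cross (c - a) (d - b) ->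
  seg a b `&` seg c d = set0 -> seg b c `&` seg d a = set0 ->
  (0 < orient a b d /\ 0 < orient c d b) \/ (0 < orient b c a /\ 0 < orient d a c).
Proof.
move=> D n1 n2.
have Dr : 0 < cross (d - b) (a - c) by move: D; rewrite /cross !coordE; lra.
have Drr : 0 < cross (a - c) (b - d) by move: D; rewrite /cross !coordE; lra.
have Drrr : 0 < cross (b - d) (c - a) by move: D; rewrite /cross !coordE; lra.
have X1 : orient a b d <= 0 -> orient b c a <= 0 -> False.
  by move=> h /(crossing D h)/set0P/eqP; apply.
have X2 : orient b c a <= 0 -> orient c d b <= 0 -> False.
  by move=> h /(crossing Dr h)/set0P/eqP; rewrite setIC; apply.
have X3 : orient c d b <= 0 -> orient d a c <= 0 -> False.
  by move=> h /(crossing Drr h)/set0P/eqP; rewrite setIC; apply.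
have X4 : orient d a c <= 0 -> orient a b d <= 0 -> False.
  by move=> h /(crossing Drrr h)/set0P/eqP; apply.
have [h1|h1] := ltP 0 (orient a b d); last first.
  by right; split; rewrite ltNge; apply/negP => h; [exact: X1 h1 h|exact: X4 h h1].
have [h2|h2] := ltP 0 (orient c d b); first by left.
by right; split; rewrite ltNge; apply/negP => h; [exact: X2 h h2|exact: X3 h2 h].
Qed.

End KiteSides.

(** * Areas *)

Notation plane R := (measurableTypeR R * measurableTypeR R)%type.

Section PlaneMeasure.
Variable R : realType.
Local Notation mu := (@leb2 R).
Local Notation lam := (@lebesgue_measure R).
Implicit Types (p q r u v a b c d : R * R) (A B N : set (plane R)).

(** The sigma-algebra is that of the product, so an open set is exhausted by the countably many
    rational squares that it contains. *)
Lemma open_measurable_plane (U : set (R * R)) : open U -> measurable (U : set (plane R)).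
Proof.
move=> /open_edistP oU.
pose box (i : rat * rat * rat) : set (plane R) :=
  `]ratr i.1.1 - ratr i.2, ratr i.1.1 + ratr i.2[%classic `*`
  `]ratr i.1.2 - ratr i.2, ratr i.1.2 + ratr i.2[%classic.
pose F i := if `[< box i `<=` U >] then box i else set0.
have -> : U = \bigcup_i F i.
  apply/seteqP; split=> [p Up|p [i _]]; last first.
    by rewrite /F; case: asboolP => // h; exact: h.
  have [e e0 eU] := oU p Up.
  have e8 : 0 < e / 8 by rewrite divr_gt0.
  have [r /itvP rI] := rat_in_itvoo e8.
  have r0 : (0 : R) < ratr r by rewrite rI.
  have rat_near (t : R) : exists2 x : rat, t - ratr r < ratr x & ratr x < t + ratr r.
    have [|x] := @rat_in_itvoo R (t - ratr r) (t + ratr r); first by lra.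
    by rewrite in_itv/= => /andP[h1 h2]; exists x.
  have [x x1 x2] := rat_near p.1; have [y y1 y2] := rat_near p.2.
  have re : ratr r < e / 8 by rewrite rI.
  exists (x, y, r) => //; rewrite /F; case: asboolP => [_|].
    by split => /=; rewrite in_itv/=; apply/andP; split; lra.
  case=> q [/=]; rewrite !in_itv/= => /andP[h1 h2] /andP[h3 h4].
  apply: eU; apply: (le_lt_trans (enorm_le_normD _)); rewrite !coordE.
  have n1 : `|p.1 - q.1| < e / 4 by rewrite ltr_norml; apply/andP; split; lra.
  have n2 : `|p.2 - q.2| < e / 4 by rewrite ltr_norml; apply/andP; split; lra.
  lra.
apply: countable_bigcupT_measurable => // i; rewrite /F; case: ifP => // _.
by apply: measurableX; exact: measurable_itv.
Qed.

Lemma continuous_measurable_plane (f : R * R -> R) : continuous f ->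
  measurable_fun setT (f : plane R -> measurableTypeR R).
Proof.
move=> /continuousP cf; apply: (measurability _ (measurable_realfun.RGenOpens.measurableE R)).
move=> _ [_ [a [b ->] <-]]; rewrite setTI; apply: open_measurable_plane.
exact/cf/interval_open.
Qed.

Lemma lebesgue_measure_affine (s k : R) (B : set (measurableTypeR R)) :
  s = 1 \/ s = -1 -> measurable B -> lam ((fun t => s * t + k) @^-1` B) = lam B.
Proof.
move=> s1 mB.
have mf : measurable_fun setT (fun t : measurableTypeR R => s * t + k : measurableTypeR R).
  apply: measurable_realfun.continuous_measurable_fun => t.
  by apply: cvgD; [apply: cvgM; [exact: cvg_cst|exact: cvg_id]|exact: cvg_cst].
rewrite -[LHS]/(pushforward lam (fun t : measurableTypeR R => s * t + k : measurableTypeR R) B).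
apply/esym/lebesgue_measure_unique => // X /ocitvP[->|[[x y] /= xy ->]].
  by rewrite !measure0.
rewrite /pushforward/=; case: s1 => s1.
  have -> : (fun t => s * t + k) @^-1` `]x, y]%classic = `]x - k, y - k]%classic.
    by apply/seteqP; split => t /=; rewrite !in_itv/= s1 mul1r ltrBlDr lerBrDr.
  rewrite !lebesgue_measure_itv/= !lte_fin ltrD2r xy -!EFinD; congr EFin; ring.
have -> : (fun t => s * t + k) @^-1` `]x, y]%classic = `[k - y, k - x[%classic.
  apply/seteqP; split => t /=; rewrite !in_itv/= s1 mulN1r => /andP[h1 h2]; apply/andP; split; lra.
rewrite !lebesgue_measure_itv/= !lte_fin ltrD2l ltrN2 xy -!EFinD; congr EFin; ring.
Qed.

(** For [s] equal to [1] or [-1] each vertical section is only translated or reflected, so Fubini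
    preserves areas. Together with [swap], these maps provide all the normalisations of triangles
    below. *)
Definition shear (s k l : R) (q : R * R) : R * R := (q.1, s * q.2 + (k * q.1 + l)).

Lemma measurable_shear s k l :
  measurable_fun setT (shear s k l : plane R -> plane R).
Proof.
apply: measurable_fun_pair.
  by apply: continuous_measurable_plane => q; exact: cvg_fst.
apply: continuous_measurable_plane => q.
apply: cvgD; first by apply: cvgM; [exact: cvg_cst|exact: cvg_snd].
by apply: cvgD; [apply: cvgM; [exact: cvg_cst|exact: cvg_fst]|exact: cvg_cst].
Qed.

Lemma preimage_measurable (f : plane R -> plane R) A :
  measurable_fun setT f -> measurable A -> measurable (f @^-1` A).
Proof. by move=> mf mA; rewrite -[X in measurable X]setTI; exact: mf. Qed.

Lemma leb2_shear s k l A : s = 1 \/ s = -1 -> measurable A ->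
  mu (shear s k l @^-1` A) = mu A.
Proof.
move=> s1 mA; apply: eq_integral => x _ /=.
rewrite -(lebesgue_measure_affine (k * x + l) s1 (measurable_xsection x mA)).
by congr (lam _); apply/seteqP; split => t; rewrite /xsection/= !inE.
Qed.

Definition swap (q : R * R) : R * R := (q.2, q.1).

Lemma measurable_swap : measurable_fun setT (swap : plane R -> plane R).
Proof. exact: measurable_swap. Qed.

Lemma leb2_swap A : measurable A -> mu (swap @^-1` A) = mu A.
Proof.
move=> mA.
rewrite -[LHS]/(pushforward mu (swap : plane R -> plane R) A).
apply/esym; apply: product_measure_unique => //; first exact: measurable_swap.
move=> mf X Y mX mY.
transitivity (mu (swap @^-1` (X `*` Y))); first by [].
have -> : swap @^-1` (X `*` Y) = Y `*` X by apply/seteqP; split => -[x y] [].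
by rewrite [LHS]product_measure1E// muleC.
Qed.

Lemma continuous_orient p q : continuous (orient p q : R * R -> R).
Proof.
rewrite (_ : orient p q = fun r => (q.1 - p.1) * (r.2 - p.2) - (q.2 - p.2) * (r.1 - p.1)); last by apply/funext => r; rewrite orientE.
move=> r; apply: cvgB; apply: cvgM; (try exact: cvg_cst);
  by apply: cvgB; [first [exact: cvg_snd|exact: cvg_fst]|exact: cvg_cst].
Qed.

(** A non-vertical line meets each vertical in a single point, and [swap] makes a vertical line
    horizontal. *)
Lemma leb2_line p q : p <> q -> mu [set r | orient p q r = 0] = 0%E.
Proof.
have ml x y : measurable ([set r | orient x y r = 0] : set (plane R)).
  rewrite (_ : [set r | _] = ~` [set r | orient x y r != 0]).
    apply: measurableC; apply: open_measurable_plane.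
    rewrite (_ : [set r | _] = orient x y @^-1` [set t | t != 0]) //.
    by apply: open_comp => [r _|]; [exact: continuous_orient|exact: open_neq].
  by apply/seteqP; split => r /=; [move=> ->; rewrite eqxx|move/negP; rewrite negbK => /eqP].
have H x y : x.1 <> y.1 -> mu [set r | orient x y r = 0] = 0%E.
  move=> xy; have D : y.1 - x.1 != 0 by rewrite subr_eq0; apply/eqP => h; exact: xy.
  apply: integral0_eq => t _ /=.
  set X := xsection _ _.
  have -> : X = [set x.2 + (y.2 - x.2) * (t - x.1) / (y.1 - x.1)].
    apply/seteqP; split => s; rewrite /X /xsection /= inE/= orientE/= => e.
      apply: (mulfI D); apply/eqP; rewrite -subr_eq0 -[X in _ == X]e; apply/eqP; field.
      exact: D.
    by rewrite e; field.
  exact: lebesgue_measure_set1.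
move=> pq; have [e1|/eqP e1] := eqVneq p.1 q.1; last exact: H.
rewrite -leb2_swap// (_ : _ @^-1` _ = [set r | orient (swap p) (swap q) r = 0]).
  by apply: H => /= e2; apply: pq; exact: planeP.
apply/seteqP; split => r /=; rewrite !orientE/= => e; lra.
Qed.

Definition open_tri a b d : set (R * R) :=
  [set q | [/\ 0 < orient a b q, 0 < orient d a q & 0 < orient b d q]].

Lemma open_half_plane p q : open [set r | 0 < orient p q r].
Proof.
rewrite (_ : [set r | _] = orient p q @^-1` [set t | 0 < t])//.
by apply: open_comp => [r _|]; [exact: continuous_orient|exact: open_gt].
Qed.

Lemma measurable_half_plane p q : measurable ([set r | 0 <= orient p q r] : set (plane R)).
Proof.
rewrite (_ : [set r | _] = ~` [set r | 0 < orient q p r]).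
  by apply: measurableC; apply: open_measurable_plane; exact: open_half_plane.
apply/seteqP; split => r /=; rewrite (_ : orient q p r = - orient p q r) ?oppr_gt0 ?leNgt;
  by [move/negP|move/negP|rewrite !orientE; ring].
Qed.

Lemma measurable_open_tri a b d : measurable (open_tri a b d : set (plane R)).
Proof.
apply: open_measurable_plane.
rewrite (_ : open_tri a b d = [set r | 0 < orient a b r] `&` [set r | 0 < orient d a r] `&`
  [set r | 0 < orient b d r]).
  by apply: openI; [apply: openI|]; exact: open_half_plane.
by apply/seteqP; split => q; [case|case=> -[]].
Qed.

Lemma measurable_line p q : measurable ([set r | orient p q r = 0] : set (plane R)).
Proof.
rewrite (_ : [set r | _] = [set r | 0 <= orient p q r] `&` [set r | 0 <= orient q p r]).
  by apply: measurableI; exact: measurable_half_plane.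
have sw r : orient q p r = - orient p q r by rewrite !orientE; ring.
apply/seteqP; split => r /=; rewrite sw; first by move=> ->; rewrite oppr0 lexx.
move=> [h1 h2].
by apply/le_anti; rewrite h1 andbT -oppr_ge0.
Qed.

Lemma measurable_tri_part a b d : measurable (tri_part a b d : set (plane R)).
Proof.
rewrite (_ : tri_part a b d = [set r | 0 < orient a b r] `&` [set r | 0 < orient d a r] `&`
  [set r | 0 <= orient b d r]).
  apply: measurableI; last exact: measurable_half_plane.
  by apply: measurableI; apply: open_measurable_plane; exact: open_half_plane.
by apply/seteqP; split => q; [case|case=> -[]].
Qed.

(** Orientations are kept along with areas, so that both sides of [tri_area] are invariant. As
    [swap] alone reverses orientation, such maps contain it in pairs. *)
Definition area_preserving (f : R * R -> R * R) : Prop :=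
  (forall A, measurable A -> measurable (f @^-1` A : set (plane R)) /\ mu (f @^-1` A) = mu A) /\
  (forall p q r, orient (f p) (f q) (f r) = orient p q r).

Lemma area_preserving_vshear k l : area_preserving (shear 1 k l).
Proof.
split=> [A mA|p q r]; last by rewrite !orientE /shear/=; ring.
split; first by apply: preimage_measurable => //; exact: measurable_shear.
by apply: leb2_shear => //; left.
Qed.

Lemma measurable_swap_preimage A : measurable A -> measurable (swap @^-1` A : set (plane R)).
Proof. by apply: preimage_measurable; exact: measurable_swap. Qed.

Lemma measurable_shear_preimage s k l A :
  measurable A -> measurable (shear s k l @^-1` A : set (plane R)).
Proof. by apply: preimage_measurable; exact: measurable_shear. Qed.

Lemma area_preserving_hshear k l : area_preserving (swap \o shear 1 k l \o swap).
Proof.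
split=> [A mA|p q r]; last by rewrite !orientE /shear/swap/=; ring.
rewrite !comp_preimage; have m1 := measurable_swap_preimage mA.
have m2 := measurable_shear_preimage 1 k l m1.
split; first exact: measurable_swap_preimage.
by rewrite leb2_swap// leb2_shear ?leb2_swap//; left.
Qed.

Lemma area_preserving_opp : area_preserving (shear (-1) 0 0 \o (swap \o shear (-1) 0 0 \o swap)).
Proof.
split=> [A mA|p q r]; last by rewrite !orientE /shear/swap/=; ring.
rewrite !comp_preimage; have m0 := measurable_shear_preimage (-1) 0 0 mA.
have m1 := measurable_swap_preimage m0.
have m2 := measurable_shear_preimage (-1) 0 0 m1.
split; first exact: measurable_swap_preimage.
by rewrite leb2_swap// leb2_shear ?leb2_swap ?leb2_shear//; right.
Qed.

Lemma leb2_eq_null A B N : measurable A -> measurable B -> measurable N ->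
  mu N = 0%E -> A `<=` B -> B `<=` A `|` N -> mu B = mu A.
Proof.
move=> mA mB mN N0 AB BA; apply/le_anti/andP; split.
  have E : mu (A `|` N) = mu A by exact: measureU0.
  by rewrite -E; apply: le_measure => //; rewrite inE//; exact: measurableU.
by apply: le_measure => //; rewrite inE.
Qed.

Definition tri_area a b d := mu (open_tri a b d) = (2^-1 * orient a b d)%:E.

Lemma tri_area_preserving f a b d :
  area_preserving f -> tri_area (f a) (f b) (f d) -> tri_area a b d.
Proof.
move=> [fm fo]; rewrite /tri_area -(fm _ (measurable_open_tri _ _ _)).2 fo => <-.
by congr (mu _); apply/seteqP; split => q /=; rewrite /open_tri/= !fo.
Qed.

(** The triangle, its image under the central symmetry of the rectangle with sides [x] and [y], and
    the null diagonal make up that open rectangle. *)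
Lemma tri_area_right (x y : R) : 0 < x -> 0 < y -> tri_area (0, 0) (x, 0) (0, y).
Proof.
move=> x0 y0; rewrite /tri_area.
set T := open_tri _ _ _.
have TE q : T q <-> [/\ 0 < q.1, 0 < q.2 & 0 < x * y - y * q.1 - x * q.2].
  rewrite /T /open_tri/= !orientE/=; split=> -[h1 h2 h3].
    by split; [rewrite -(pmulr_rgt0 _ y0); lra|rewrite -(pmulr_rgt0 _ x0); lra|lra].
  have := mulr_gt0 y0 h1; have := mulr_gt0 x0 h2.
  by split; lra.
pose f : R * R -> R * R := shear 1 0 y \o (swap \o shear 1 0 x \o swap) \o
  (shear (-1) 0 0 \o (swap \o shear (-1) 0 0 \o swap)).
have fE q : f q = (x - q.1, y - q.2).
  by rewrite /f /shear /swap/=; congr pair; ring.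
have mT : measurable (T : set (plane R)) by exact: measurable_open_tri.
have [mfT fT] : measurable (f @^-1` T : set (plane R)) /\ mu (f @^-1` T) = mu T.
  have [m1 e1] := (area_preserving_vshear 0 y).1 _ mT.
  have [m2 e2] := (area_preserving_hshear 0 x).1 _ m1.
  have [m3 e3] := area_preserving_opp.1 _ m2.
  by split; [exact: m3|exact: etrans e3 (etrans e2 e1)].
clearbody f.
pose D : set (plane R) := [set r | orient (x, 0) (0, y) r = 0].
pose Q : set (plane R) := `]0, x[%classic `*` `]0, y[%classic.
have mQ : measurable Q by apply: measurableX; exact: measurable_itv.
have muQ : mu Q = (x * y)%:E.
  rewrite [LHS]product_measure1E; [|exact: measurable_itv|exact: measurable_itv].
  by rewrite [X in (X * _)%E]lebesgue_measure_itv [X in (_ * X)%E]lebesgue_measure_itv/= !lte_fin x0 y0 -!EFinD !subr0 -EFinM.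
have : mu Q = mu (T `|` f @^-1` T).
  apply: (leb2_eq_null (N := D)) => //.
  - exact: measurableU.
  - exact: measurable_line.
  - by apply: leb2_line => -[e _]; move: x0; rewrite e ltxx.
  - move=> q [/TE[h1 h2 h3]|/= /TE]; rewrite /Q/=.
      have := mulr_gt0 y0 h1; have := mulr_gt0 x0 h2.
      rewrite !in_itv/= h1 h2/= => ? ?; split; [rewrite -(ltr_pM2l y0)|rewrite -(ltr_pM2l x0)]; lra.
    rewrite fE/= => -[h1 h2 h3].
    have := mulr_gt0 y0 h1; have := mulr_gt0 x0 h2.
    rewrite !in_itv/= => ? ?; split; apply/andP; split; [rewrite -(pmulr_rgt0 _ y0)| |rewrite -(pmulr_rgt0 _ x0)|]; lra.
  - move=> q [/=]; rewrite !in_itv/= => /andP[q1 q1x] /andP[q2 q2y].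
    have [h|h|h] := ltgtP 0 (x * y - y * q.1 - x * q.2).
    + by left; left; apply/TE.
    + left; right; apply/TE; rewrite fE/= !subr_gt0; split => //; lra.
    + by right; rewrite /D/= orientE/=; lra.
rewrite measureU//.
  rewrite muQ [X in (_ = _ + X)%E]fT orientE/= => h.
  have Tfin : mu T \is a fin_num.
    rewrite ge0_fin_numE// (@le_lt_trans _ _ (mu Q))// ?muQ ?ltry// -muQ.
    by rewrite muQ h leeDl.
  move: h; rewrite -(fineK Tfin) -EFinD => -[h]; congr EFin; lra.
by rewrite -subset0 => q [/TE[h1 h2 h3] /TE]; rewrite fE/= => -[h4 h5 h6]; lra.
Qed.

(** Area-preserving maps normalise one vertex at a time: [a] to the origin, [b] to the horizontal
    axis, [d] to the vertical axis; a half-turn then makes the coordinates positive. *)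
Lemma leb2_open_tri a b d : 0 < orient a b d -> mu (open_tri a b d) = (2^-1 * orient a b d)%:E.
Proof.
rewrite -/(tri_area a b d).
wlog -> : a b d / a = (0, 0).
  move=> h D; apply: (tri_area_preserving (area_preserving_vshear 0 (- a.2))).
  apply: (tri_area_preserving (area_preserving_hshear 0 (- a.1))).
  apply: h; last by rewrite (area_preserving_hshear _ _).2 (area_preserving_vshear _ _).2.
  by rewrite /shear /swap/=; congr pair; ring.
(* A vertical [b] is tilted beforehand, since the next shear has slope [- (b.2 / b.1)]. *)
wlog b1 : b d / b.1 != 0.
  move=> h D; have [b0|] := eqVneq b.1 0; last by move=> b0; exact: h.
  apply: (tri_area_preserving (area_preserving_hshear 1 0)).
  have -> : (swap \o shear 1 1 0 \o swap) (0, 0) = (0, 0).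
    by rewrite /shear /swap/=; congr pair; ring.
  have e0 : (swap \o shear 1 1 0 \o swap) (0, 0) = (0, 0) :> R * R.
    by rewrite /shear /swap/=; congr pair; ring.
  apply: h; last by rewrite -e0 (area_preserving_hshear _ _).2.
  rewrite /shear /swap/= b0 mul1r !addr0 add0r mul1r; apply/eqP => b2.
  by move: D; rewrite orientE/= b0 b2 !subr0 !mul0r subr0 ltxx.
wlog b2 : b d b1 / b.2 = 0.
  move=> h D; apply: (tri_area_preserving (area_preserving_vshear (- (b.2 / b.1)) 0)).
  have e0 : shear 1 (- (b.2 / b.1)) 0 (0, 0) = (0, 0) :> R * R.
    by rewrite /shear /=; congr pair; ring.
  rewrite {1}e0; apply: h => //; last by rewrite -e0 (area_preserving_vshear _ _).2.
  by rewrite /shear/=; field.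
wlog d1 : d / d.1 = 0.
  move=> h D; have d2 : d.2 != 0.
    by apply: contraTneq D => e; rewrite orientE/= e b2 !subr0 mulr0 mul0r subr0 ltxx.
  pose f := swap \o shear 1 (- (d.1 / d.2)) 0 \o swap.
  apply: (tri_area_preserving (area_preserving_hshear (- (d.1 / d.2)) 0)).
  have e0 : f (0, 0) = (0, 0) by rewrite /f /shear /swap/=; congr pair; ring.
  have eb : f b = b by apply: planeP; rewrite /f /shear /swap/= ?b2; ring.
  rewrite -/f e0 eb; apply: h; last by rewrite -e0 -eb (area_preserving_hshear _ _).2.
  by rewrite /f /shear /swap/=; field.
case: b d b1 b2 d1 => [x z] [w y] /= x0 -> ->; rewrite orientE/= => D.
have xy : 0 < x * y by lra.
have [x1|x1] := ltP 0 x; first by apply: tri_area_right => //; rewrite -(pmulr_rgt0 _ x1).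
have {}x1 : x < 0 by rewrite lt_neqAle x0.
apply: (tri_area_preserving area_preserving_opp).
rewrite /shear /swap/= !(mulN1r, mul0r, addr0, oppr0).
by apply: tri_area_right; rewrite oppr_gt0// -(nmulr_rgt0 _ x1).
Qed.

Lemma leb2_kite a b c d : 0 < orient a b d -> 0 < orient c d b ->
  mu (kite a b c d) = (2^-1 * cross (c - a) (d - b))%:E.
Proof.
move=> abd cdb; pose D : set (plane R) := [set r | orient b d r = 0].
have sw r : orient d b r = - orient b d r by rewrite !orientE; ring.
have -> : mu (kite a b c d) = mu (open_tri a b d `|` open_tri c d b).
  apply: (leb2_eq_null (N := D)) => //.
  - by apply: measurableU; exact: measurable_open_tri.
  - by apply: measurableU; exact: measurable_tri_part.
  - exact: measurable_line.
  - by apply: leb2_line => e; move: abd; rewrite e orientxr ltxx.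
  - by move=> q [] [h1 h2 h3]; [left|right]; split => //; exact: ltW.
  - move=> q [] [h1 h2]; rewrite le_eqVlt => /predU1P[h3|h3].
    + by right; rewrite /D/= -h3.
    + by left; left.
    + by right; rewrite /D/=; move: h3; rewrite sw; lra.
    + by left; right.
rewrite measureU; [|exact: measurable_open_tri|exact: measurable_open_tri|].
  rewrite -[open_tri a b d]/(open_tri a b d) [X in (X + _)%E]leb2_open_tri// [X in (_ + X)%E]leb2_open_tri//.
  by rewrite -EFinD; congr EFin; rewrite !orientE /cross !coordE; field.
by rewrite -subset0 => q [[_ _ h1] [_ _]]; rewrite sw; lra.
Qed.

Lemma measurable_kite a b c d : measurable (kite a b c d : set (plane R)).
Proof. by apply: measurableU; exact: measurable_tri_part. Qed.

End PlaneMeasure.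

(** * Faces of an orthodiagonal map *)

Section Segments.
Variable R : realType.
Implicit Types (p q r s u : R * R).

Lemma closed_seg p q : closed (seg p q).
Proof.
apply: compact_closed; first exact: norm_hausdorff.
apply: continuous_compact; last exact: segment_compact.
by apply: continuous_subspaceT => t; exact: continuous_segment.
Qed.

Lemma seg_ball p q q' s (e : R) :
  edist p q < e -> edist p q' < e -> seg q q' s -> edist p s < e.
Proof.
move=> h h' /segE[t [t0 t1 ->]].
have -> : edist p ((1 - t) *: q + t *: q') = enorm ((1 - t) *: (p - q) + t *: (p - q')).
  by rewrite /edist; congr enorm; apply: planeP; rewrite !coordE; ring.
apply: (le_lt_trans (ler_enormD _ _)); rewrite !enormZ !ger0_norm ?subr_ge0//.
rewrite -/(edist p q) -/(edist p q').
have : (1 - t) * edist p q <= (1 - t) * Num.max (edist p q) (edist p q').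
  by rewrite ler_wpM2l ?subr_ge0// le_max lexx.
have : t * edist p q' <= t * Num.max (edist p q) (edist p q').
  by rewrite ler_wpM2l// le_max lexx orbT.
have : Num.max (edist p q) (edist p q') < e by rewrite gt_max h.
by move: (Num.max _ _) => m; nra.
Qed.

Lemma seg_on_line p q r : seg p q r -> orient p q r = 0.
Proof. by move=> /segE[t [_ _ ->]]; rewrite orient_comb orientxl orientxr !mulr0 addr0. Qed.

Lemma line_near_seg p q r : seg p q r -> r <> p -> r <> q ->
  exists2 e : R, 0 < e & forall s, edist r s < e -> orient p q s = 0 -> seg p q s.
Proof.
move=> /segE[t [t0 t1 rE]] rp rq.
have pq : p <> q.
  by move=> e; apply: rp; rewrite rE e; apply: planeP; rewrite !coordE; ring.
have n0 : 0 < enorm (q - p) by rewrite enorm_gt0// subr_eq0 eq_sym; apply/eqP.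
have {}t0 : 0 < t.
  rewrite lt_neqAle t0 andbT; apply/eqP => e; apply: rp.
  by rewrite rE -e; apply: planeP; rewrite !coordE; ring.
have {}t1 : t < 1.
  rewrite lt_neqAle t1 andbT; apply/eqP => e; apply: rq.
  by rewrite rE e; apply: planeP; rewrite !coordE; ring.
exists (Num.min t (1 - t) * enorm (q - p)).
  by rewrite mulr_gt0// lt_min t0 subr_gt0.
move=> s rs os.
pose k := dotp (s - p) (q - p) / enorm (q - p) ^+ 2.
have n2 : enorm (q - p) ^+ 2 != 0 by rewrite gt_eqF// exprn_gt0.
have sE : s = (1 - k) *: p + k *: q.
  have h : enorm (q - p) ^+ 2 *: (s - p) = dotp (s - p) (q - p) *: (q - p).
    move: os; rewrite sqr_enorm orientE /dotp => os.
    apply: planeP; rewrite !coordE; apply/eqP; rewrite -subr_eq0; apply/eqP.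
      transitivity (- (q.2 - p.2) * ((q.1 - p.1) * (s.2 - p.2) - (q.2 - p.2) * (s.1 - p.1))); first by ring.
      by rewrite os mulr0.
    transitivity ((q.1 - p.1) * ((q.1 - p.1) * (s.2 - p.2) - (q.2 - p.2) * (s.1 - p.1))); first by ring.
    by rewrite os mulr0.
  have {}h : s - p = k *: (q - p).
    by apply: (scalerI n2); rewrite h scalerA mulrC divfK.
  by rewrite -(subrK p s) h; apply: planeP; rewrite !coordE; ring.
have : edist r s = `|t - k| * enorm (q - p).
  by rewrite -enormZ /edist rE sE; congr enorm; apply: planeP; rewrite !coordE; ring.
move=> e; move: rs; rewrite e ltr_pM2r// lt_min !ltr_norml => /andP[/andP[h1 h2] /andP[h3 h4]].
by apply/segE; exists k; split => //; lra.
Qed.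

End Segments.

Section Faces.
Variables (R : realType) (G : bigraph R).
Hypothesis oG : orthodiagonal_map G.
Notation V := (primal G).
Notation W := (dual G).
Implicit Types (x y : V) (w v : W) (p q r : R * R) (F : set (R * R)).

Let pG : plane_graph G. Proof. by case: oG. Qed.

Lemma pos_neq x w : ppos x <> dpos w.
Proof. by case: pG => inj _ _ e; have := inj (inl x) (inr w) e. Qed.

Lemma ppos_inj : injective (@ppos R G).
Proof. by case: pG => inj _ _ x y e; have [] := inj (inl x) (inl y) e. Qed.

Lemma dpos_inj : injective (@dpos R G).
Proof. by case: pG => inj _ _ x y e; have [] := inj (inr x) (inr y) e. Qed.

(** The edge loses its interior and keeps its endpoints. What remains is closed, so a small disc
    about an interior point of the edge meets no other part of the drawing. *)
Definition skeleton_without (e : V * W) : set (R * R) :=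
  range (@pos R G) `|` [set p | exists x w, [/\ edge x w, (x, w) <> e & eseg x w p]].

Lemma closed_skeleton_without e : closed (skeleton_without e).
Proof.
rewrite /skeleton_without (_ : range (@pos R G) = \bigcup_(a in [set: V + W]) [set pos a]).
  rewrite (_ : [set p | _] = \bigcup_(f in [set f : V * W | edge f.1 f.2 /\ f <> e]) eseg f.1 f.2).
    apply: closedU; apply: closed_bigcup; try exact: finite_finset.
      move=> a _; rewrite (_ : [set _] = seg (pos a) (pos a)); first exact: closed_seg.
      apply/seteqP; split => [_ ->|_ /segE[t [_ _ ->]]]; first exact: seg_left.
      by rewrite -scalerDl subrK scale1r.
    by move=> f _; exact: closed_seg.
  apply/seteqP; split => [p [x [w [h1 h2 h3]]]|p [[x w] [/= h1 h2] h3]].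
    by exists (x, w).
  by exists x, w.
by apply/seteqP; split => [_ [a _ <-]|_ [a _ ->]]; exists a.
Qed.

Lemma drawing_skeleton x w p : drawing G p -> skeleton_without (x, w) p \/ eseg x w p.
Proof.
move=> [pa|[x' [w' [e h]]]]; first by left; left.
have [[<- <-]|n] := pselect ((x', w') = (x, w)); first by right.
by left; right; exists x', w'.
Qed.

Lemma closed_drawing : closed (drawing G).
Proof.
have [[[x w] /= e]|n] := pselect (exists f : V * W, edge f.1 f.2).
  rewrite (_ : drawing G = skeleton_without (x, w) `|` eseg x w).
    by apply: closedU; [exact: closed_skeleton_without|exact: closed_seg].
  apply/seteqP; split => [p /(drawing_skeleton x w)//|p [[pa|[x' [w' [h _ h']]]]|h]].
  - by left.
  - by right; exists x', w'.
  - by right; exists x, w.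
rewrite (_ : drawing G = range (@pos R G)).
  apply: compact_closed; first exact: norm_hausdorff.
  by apply: finite_compact; apply: finite_image; exact: finite_finset.
apply/seteqP; split => [p [//|[x [w [e _]]]]|p]; last by left.
by exfalso; apply: n; exists (x, w).
Qed.

Lemma open_codrawing : open (~` drawing G).
Proof. exact/closed_openC/closed_drawing. Qed.

Lemma edge_nbhd x w p : edge x w -> eseg x w p -> p <> ppos x -> p <> dpos w ->
  exists2 e : R, 0 < e & forall q, edist p q < e ->
    (drawing G q -> eseg x w q) /\ (orient (ppos x) (dpos w) q = 0 -> eseg x w q).
Proof.
move=> exw pxw px pw.
have np : (~` skeleton_without (x, w)) p.
  case: pG => inj vert edg; move=> [[a _ ap]|[x' [w' [e ne h]]]].
    have pa : eseg x w (pos a) by rewrite ap.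
    have [e|e] := vert a x w exw pa.
      by apply: px; rewrite -ap e.
    by apply: pw; rewrite -ap e.
  have [[]|[]] := edg x' w' x w e exw ne p h pxw.
    by move=> e1 pE; apply: px; rewrite pE e1.
  by move=> e1 pE; apply: pw; rewrite pE e1.
have /open_edistP/(_ _ np)[e1 e10 h1] : open (~` skeleton_without (x, w)).
  exact/closed_openC/closed_skeleton_without.
have [e2 e20 h2] := line_near_seg pxw px pw.
exists (Num.min e1 e2); first by rewrite lt_min e10.
move=> q; rewrite lt_min => /andP[q1 q2]; split; last exact: h2.
by move=> /(drawing_skeleton x w)[/(h1 _ q1)|].
Qed.

Definition comp p := connected_component (~` drawing G) p.

Lemma comp_seg p q : seg p q `<=` ~` drawing G -> comp p = comp q.
Proof.
move=> h; apply: same_connected_component; exists (seg p q); last exact: seg_right.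
by split => //; [exact: seg_left|exact: connected_seg].
Qed.

Lemma inner_faceE F p : inner_face G F -> F p -> F = comp p /\ ~ drawing G p.
Proof.
move=> [_ [q nq ->]] h; split; last exact: (connected_component_sub h).
exact: same_connected_component.
Qed.

Lemma inner_face_open F : inner_face G F -> open F.
Proof. by move=> [_ [p np ->]]; apply: open_connected_component; exact: open_codrawing. Qed.

Lemma inner_face_connected F : inner_face G F -> connected F.
Proof. by move=> [_ [p np ->]]; exact: component_connected. Qed.

Lemma inner_face_nonempty F : inner_face G F -> F !=set0.
Proof. by move=> [_ [p np ->]]; exists p; exact: connected_component_refl. Qed.

Lemma inner_face_Ghat F : inner_face G F -> F `<=` Ghat G.
Proof.
move=> iF; rewrite /Ghat -open_subsetE; last exact: inner_face_open.
by move=> p Fp; right; exists F.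
Qed.

Lemma Ghat_comp p : Ghat G p -> ~ drawing G p -> inner_face G (comp p).
Proof.
move=> /interior_subset[//|[F iF Fp]] _.
by rewrite -(inner_faceE iF Fp).1.
Qed.

Lemma open_outer : open (outer_face G).
Proof.
apply/open_edistP => p [np nb].
have /open_edistP/(_ _ np)[e e0 h] := open_codrawing; exists e => // q pq.
have cE : comp p = comp q.
  by apply: comp_seg => s /seg_edist ps; apply: h; exact: le_lt_trans pq.
by split; [exact: h|rewrite -/(comp q) -cE].
Qed.

Lemma outer_Ghat p : outer_face G p -> ~ Ghat G p.
Proof. by move=> [np nb] /Ghat_comp /(_ np)[]. Qed.

Lemma outer_frontier_Ghat p : frontier (outer_face G) p -> ~ Ghat G p.
Proof.
move=> [/closure_edistP clp _] /interior_edistP.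
have /open_edistP oGh : open (Ghat G) by exact: open_interior.
move=> Gp; have [e e0 h] : exists2 e : R, 0 < e & forall q, edist p q < e -> Ghat G q.
  by apply: oGh; apply/interior_edistP.
by have [q oq pq] := clp e e0; exact: outer_Ghat oq (h q pq).
Qed.

Lemma outer_frontierE p :
  frontier (outer_face G) p <-> closure (outer_face G) p /\ ~ outer_face G p.
Proof. by rewrite /frontier (interior_id (outer_face G)).1 //; exact: open_outer. Qed.

Lemma outer_frontier_drawing p : frontier (outer_face G) p -> drawing G p.
Proof.
move=> /outer_frontierE[/closure_edistP clp no]; apply: contrapT => np.
have /open_edistP/(_ _ np)[e e0 h] := open_codrawing.
have [q [nq nb] pq] := clp e e0; apply: no; split => //.
have <- : comp q = connected_component (~` drawing G) p; last by [].
apply/esym/comp_seg => s /seg_edist ps; apply: h; exact: le_lt_trans pq.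
Qed.

(** Some point [q0] of the outer face near [p] lies strictly on one side of the edge. A nearby point
    of the edge, pushed slightly to that side, is joined to [q0] inside a disc where the drawing is
    this edge alone. *)
Lemma outer_frontier_local x w p : edge x w -> eseg x w p -> p <> ppos x -> p <> dpos w ->
  frontier (outer_face G) p -> exists2 e : R, 0 < e & forall q, edist p q < e ->
    eseg x w q -> frontier (outer_face G) q.
Proof.
move=> exw pxw px pw /outer_frontierE[/closure_edistP clp _].
have [e e0 h] := edge_nbhd exw pxw px pw; exists e => // q pq qxw.
have [q0 [nq0 nb0] pq0] := clp e e0.
pose o0 := orient (ppos x) (dpos w) q0.
have on0 : o0 != 0.
  by apply/eqP => /(h _ pq0).2 q0e; apply: nq0; right; exists x, w.
have qd : drawing G q by right; exists x, w.
apply/outer_frontierE; split; last by move=> [].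
apply/closure_edistP => e' e'0.
(* The factor [o0] turns the normal towards the side of [q0], whichever it is. *)
pose n := o0 *: rot90 (dpos w - ppos x).
have n1 : 0 < 1 + enorm n by rewrite ltr_pwDl// enorm_ge0.
pose m := Num.min (e - edist p q) e'.
have m0 : 0 < m by rewrite lt_min subr_gt0 pq.
pose s := m / (1 + enorm n).
have s0 : 0 < s by rewrite divr_gt0.
have sn : s * enorm n < m.
  by rewrite /s mulrAC ltr_pdivrMr// ltr_pM2l// ltrDr.
have dq : edist q (q + s *: n) = s * enorm n.
  by rewrite /edist opprD addrA subrr add0r enormN enormZ gtr0_norm.
have pqn : edist p (q + s *: n) < e.
  apply: le_lt_trans (edist_triangle q _ _) _; rewrite dq addrC -ltrBrDr.
  by apply: lt_le_trans sn _; rewrite ge_min lexx.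
have onn : 0 < o0 * orient (ppos x) (dpos w) (q + s *: n).
  rewrite orient_shift (seg_on_line qxw) add0r /n.
  have -> : cross (dpos w - ppos x) (o0 *: rot90 (dpos w - ppos x)) =
      o0 * enorm (dpos w - ppos x) ^+ 2.
    by rewrite -cross_rot90 /cross !coordE; ring.
  rewrite mulrCA mulr_gt0// mulrA -expr2 mulr_gt0//.
    by rewrite exprn_even_gt0.
  rewrite exprn_gt0// enorm_gt0// subr_eq0 eq_sym.
  by apply/eqP; exact: pos_neq.
have sg : seg q0 (q + s *: n) `<=` ~` drawing G.
  move=> r rs dr; have pr := seg_ball pq0 pqn rs.
  have /seg_on_line := (h _ pr).1 dr; move/segE: rs => [t [t0 t1 ->]].
  rewrite orient_comb => /(congr1 ( *%R o0)); rewrite mulr0 mulrDr !(mulrCA o0).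
  have : 0 < o0 * orient (ppos x) (dpos w) q0 by rewrite -expr2 exprn_even_gt0.
  move: onn; move: (_ * _) => k1 k10; move: (_ * _) => k2 k20 e2.
  have [t00|t00] := eqVneq t 0.
    by move: e2; rewrite t00 subr0 mul1r mul0r addr0 => e2; rewrite e2 ltxx in k20.
  have : 0 < t * k1 by rewrite mulr_gt0// lt_neqAle eq_sym t00.
  have : 0 <= (1 - t) * k2 by rewrite mulr_ge0 ?subr_ge0// ltW.
  lra.
exists (q + s *: n); last by rewrite dq; apply: lt_le_trans sn _; rewrite ge_min lexx orbT.
split; first exact: sg (@seg_right _ _ _).
by rewrite -/(comp _) -(comp_seg sg).
Qed.

(** The frontier points on the open edge form a subset that is open by [outer_frontier_local] and
    also closed, hence the whole open edge; its endpoint [x] then lies on the frontier as well. *)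
Lemma outer_frontier_edge x w p : edge x w -> eseg x w p -> p <> ppos x -> p <> dpos w ->
  frontier (outer_face G) p -> bdryV x.
Proof.
move=> exw pxw px pw fp.
pose I := [set (1 - t) *: ppos x + t *: dpos w | t in `](0:R), 1[ ].
have Iseg q : I q -> eseg x w q.
  move=> [t /=]; rewrite in_itv/= => /andP[/ltW t0 /ltW t1] <-.
  by apply/segE; exists t.
have xw := @pos_neq x w.
have Ineq q : I q -> q <> ppos x /\ q <> dpos w.
  move=> [t /=]; rewrite in_itv/= => /andP[t0 t1] <-; split=> e; apply: xw.
    apply: (@scalerI _ _ t); first by rewrite gt_eqF.
    by move: e => /(congr1 (fun u => u + (t - 1) *: ppos x)) e; apply: planeP; move: (congr1 fst e) (congr1 snd e); rewrite !coordE; lra.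
  apply: (@scalerI _ _ (1 - t)); first by rewrite gt_eqF// subr_gt0.
  by apply: planeP; move: (congr1 fst e) (congr1 snd e); rewrite !coordE; lra.
have Ip : I p.
  move: pxw px pw => /segE[t [t0 t1 ->]] px pw; exists t => //=.
  rewrite in_itv/= !lt_neqAle t0 t1 !andbT; apply/andP; split.
    by apply/eqP => e; apply: px; rewrite -e subr0 scale1r scale0r addr0.
  by apply/eqP => e; apply: pw; rewrite e subrr scale1r scale0r add0r.
have cI : connected I.
  apply: connected_continuous_connected; first exact/connected_intervalP/interval_is_interval.
  by apply: continuous_subspaceT => t; exact: continuous_segment.
have cF : closed (frontier (outer_face G)).
  by apply: closedI; [exact: closed_closure|apply: open_closedC; exact: open_interior].
have FI : I `&` frontier (outer_face G) = I.
  apply: cI.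
  - by exists p.
  - exists (\bigcup_(A in [set A | open A /\ I `&` A `<=` frontier (outer_face G)]) A).
      by apply: bigcup_open => A [].
    apply/seteqP; split => q [Iq fq]; split => //; last by case: fq => A [_ h Aq]; exact: h.
    have [q1 q2] := Ineq _ Iq.
    have [e e0 h] := outer_frontier_local exw (Iseg _ Iq) q1 q2 fq.
    exists [set r | edist q r < e] => /=; last by rewrite edistpp.
    split; last by move=> r [/Iseg Ir qr]; exact: h.
    rewrite (_ : [set r | _] = edist q @^-1` [set t | t < e])//.
    by apply: open_comp => [r _|]; [exact: continuous_edist|exact: open_lt].
  - by exists (frontier (outer_face G)).
rewrite /bdryV; move/closure_id : cF => ->; apply/closure_edistP => e e0.
have n1 : 0 < enorm (dpos w - ppos x).
  by rewrite enorm_gt0// subr_eq0 eq_sym; apply/eqP.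
pose t := Num.min 2^-1 (e / 2 / enorm (dpos w - ppos x)).
have t0 : 0 < t by rewrite lt_min !divr_gt0// andbT invr_gt0.
have It : I ((1 - t) *: ppos x + t *: dpos w).
  exists t => //=; rewrite in_itv/= t0/=; have : t <= 2^-1 by rewrite ge_min lexx.
  lra.
exists ((1 - t) *: ppos x + t *: dpos w); first by move: It; rewrite -FI => -[].
have -> : edist (ppos x) ((1 - t) *: ppos x + t *: dpos w) = t * enorm (dpos w - ppos x).
  by rewrite -[X in X * _](gtr0_norm t0) -enormZ -enormN /edist; congr enorm; apply: planeP; rewrite !coordE; ring.
have : t <= e / 2 / enorm (dpos w - ppos x) by rewrite ge_min lexx orbT.
rewrite ler_pdivlMr//; lra.
Qed.

(** Otherwise the frontier of the outer face would consist of vertices and be finite, whereas a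
    simple closed curve contains an injective image of [[0, 1[]. Without a boundary vertex
    [dist_bdryV], being an [inf], would have the default value [0]. *)
Lemma bdryV_nonempty : exists x : V, bdryV x.
Proof.
apply: contrapT => nb; have [_ _ _ [g [gc g01 ginj gF]]] := oG.
have sub : frontier (outer_face G) `<=` range (@pos R G).
  move=> p fp; have [//|[x [w [e h]]]] := outer_frontier_drawing fp.
  have [->|px] := pselect (p = ppos x); first by exists (inl x).
  have [->|pw] := pselect (p = dpos w); first by exists (inr w).
  by exfalso; apply: nb; exists x; exact: outer_frontier_edge e h px pw fp.
have : finite_set (g @` `[(0:R), 1[ ).
  apply: (@sub_finite_set _ _ (range (@pos R G))); last first.
    by apply: finite_image; exact: finite_finset.
  apply: subset_trans sub; rewrite -gF; apply: image_subset => t /=.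
  by rewrite !in_itv/= => /andP[-> /ltW->].
rewrite (eq_finite_set (inj_card_eq _)); last first.
  by move=> t u; rewrite !inE => ? ?; apply: ginj.
move=> /finite_set_countable/countable_lebesgue_measure0.
by rewrite lebesgue_measure_itv/= lte01 => /eqP; rewrite sube0 eqe oner_eq0.
Qed.

End Faces.

Section Orthogonal.
Variable R : realType.
Implicit Types u v : R * R.

Lemma orthogonal_cross u v : dotp u v = 0 -> 0 <= cross u v -> cross u v = enorm u * enorm v.
Proof.
move=> d c; apply/eqP; rewrite -(eqrXn2 (n := 2))// ?mulr_ge0 ?enorm_ge0//.
rewrite exprMn !sqr_enorm -subr_eq0; apply/eqP.
transitivity (- dotp u v ^+ 2); first by rewrite /cross /dotp; ring.
by rewrite d expr0n oppr0.
Qed.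

Lemma orthogonal_rot90 u v : dotp u v = 0 -> 0 < cross u v ->
  v = (enorm v / enorm u) *: rot90 u.
Proof.
move=> d c; have u0 : enorm u != 0.
  apply/eqP => /enorm_eq0 e; move: c; rewrite e /cross/= !mul0r subrr ltxx //.
have u2 : enorm u ^+ 2 != 0 by rewrite expf_neq0.
have e : enorm u ^+ 2 *: v = cross u v *: rot90 u.
  apply: planeP; rewrite sqr_enorm !coordE /cross /rot90/=; apply/eqP; rewrite -subr_eq0; apply/eqP.
    by transitivity (u.1 * dotp u v); [rewrite /dotp; ring|rewrite d mulr0].
  by transitivity (u.2 * dotp u v); [rewrite /dotp; ring|rewrite d mulr0].
apply: (scalerI u2); rewrite e (orthogonal_cross d (ltW c)) scalerA; congr (_ *: _).
by field.
Qed.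

End Orthogonal.

(** * Counterclockwise listings of the faces *)

Section Tuples.
Variables (R : realType) (G : bigraph R).
Hypothesis oG : orthodiagonal_map G.
Notation V := (primal G).
Notation W := (dual G).
Notation T4 := ((V * W) * (V * W))%type.
Implicit Types (x y : V) (w v : W) (p q r : R * R) (F : set (R * R)) (t : T4).

Let pG : plane_graph G. Proof. by case: oG. Qed.

Lemma quad_face_swapW F x w y v : quad_face F x w y v -> quad_face F x v y w.
Proof.
move=> [xy wv /and4P[e1 e2 e3 e4] fF]; split => //; first by rewrite eq_sym.
  by apply/and4P.
by rewrite fF; apply/seteqP; split => p; rewrite /setU/=; tauto.
Qed.

Lemma quad_face_swapV F x w y v : quad_face F x w y v -> quad_face F y w x v.
Proof.
move=> [xy wv /and4P[e1 e2 e3 e4] fF]; split => //; first by rewrite eq_sym.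
  by apply/and4P.
by rewrite fF; apply/seteqP; split => p; rewrite /setU/=; tauto.
Qed.

Lemma quad_face_curve F x w y v : quad_face F x w y v ->
  frontier F = quad_curve (ppos x) (dpos w) (ppos y) (dpos v).
Proof.
by case=> _ _ _ ->; rewrite /quad_curve /eseg (segC (dpos w)) (segC (dpos v) (ppos x)).
Qed.

Lemma quad_face_disjoint F x w y v : quad_face F x w y v ->
  eseg x w `&` eseg y v = set0.
Proof.
move=> [xy wv /and4P[e1 e2 e3 e4] _]; rewrite -subset0 => p [p1 p2].
case: pG => _ _ /(_ x w y v e1 e3) h.
have [|[e _]|[e _]] := h _ p p1 p2; first by move=> [e]; rewrite e eqxx in xy.
  by rewrite e eqxx in xy.
by rewrite e eqxx in wv.
Qed.

Definition quad_cross t : R :=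
  cross (ppos t.2.1 - ppos t.1.1) (dpos t.2.2 - dpos t.1.2).

Definition is_quad t : Prop :=
  exists2 F, inner_face G F & quad_face F t.1.1 t.1.2 t.2.1 t.2.2.

(* Quadrilaterals listed counterclockwise from a primal vertex: every inner face
   is listed exactly twice, once from each of its primal vertices. *)
Definition ccw_quad t : bool := `[< is_quad t >] && (0 < quad_cross t).

(** The explicit form of the face: it is cut along its dual diagonal when that lies inside, and
    along its primal diagonal otherwise. *)
Definition region t : set (R * R) :=
  let: (a, b, c, d) := (ppos t.1.1, dpos t.1.2, ppos t.2.1, dpos t.2.2) in
  if (0 < orient a b d) && (0 < orient c d b) then kite a b c d else kite b c d a.

Lemma region_cases t F : inner_face G F -> quad_face F t.1.1 t.1.2 t.2.1 t.2.2 ->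
  0 < quad_cross t ->
  let: (a, b, c, d) := (ppos t.1.1, dpos t.1.2, ppos t.2.1, dpos t.2.2) in
  F = region t /\
  ([/\ 0 < orient a b d, 0 < orient c d b & region t = kite a b c d] \/
   [/\ 0 < orient b c a, 0 < orient d a c & region t = kite b c d a]).
Proof.
case: t => [[x w] [y v]] /= iF qF D.
have n1 := quad_face_disjoint qF.
have n2 := quad_face_disjoint (quad_face_swapV qF).
have := quad_split D n1; rewrite (segC (dpos w)) (segC (dpos v)) => /(_ n2) sp.
have F0 := inner_face_nonempty iF; have oF := inner_face_open iF.
have cF := inner_face_connected iF; have bF : bounded_set F by case: iF.
have fF := quad_face_curve qF.
rewrite /region/=; case: ifPn => [/andP[h1 h2]|n].
  by split; [exact: face_kite|left].
case: sp => [[h1 h2]|[h1 h2]]; first by rewrite h1 h2 in n.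
split; last by right.
apply: face_kite => //; rewrite fF /quad_curve.
by apply/seteqP; split => p; rewrite /setU/=; tauto.
Qed.

Lemma ccw_quadP t : ccw_quad t -> [/\ inner_face G (region t),
  quad_face (region t) t.1.1 t.1.2 t.2.1 t.2.2 & 0 < quad_cross t].
Proof.
move=> /andP[/asboolP[F iF qF] D].
by have [<- _] := region_cases iF qF D.
Qed.

Lemma face_region t F : inner_face G F -> quad_face F t.1.1 t.1.2 t.2.1 t.2.2 ->
  ccw_quad t -> F = region t.
Proof. by move=> iF qF /ccw_quadP[_ _ D]; have [] := region_cases iF qF D. Qed.

Lemma ccw_quad_cases t : ccw_quad t ->
  let: (a, b, c, d) := (ppos t.1.1, dpos t.1.2, ppos t.2.1, dpos t.2.2) in
  [/\ 0 < orient a b d, 0 < orient c d b & region t = kite a b c d] \/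
  [/\ 0 < orient b c a, 0 < orient d a c & region t = kite b c d a].
Proof.
by move=> tq; have [iF qF D] := ccw_quadP tq; have [_] := region_cases iF qF D.
Qed.

Lemma measurable_region t : measurable (region t : set (plane R)).
Proof. by rewrite /region; case: ifP => _; exact: measurable_kite. Qed.

Lemma leb2_region t : ccw_quad t -> leb2 R (region t) = (2^-1 * quad_cross t)%:E.
Proof.
move=> /ccw_quad_cases[[h1 h2 ->]|[h1 h2 ->]]; rewrite leb2_kite//.
by rewrite /quad_cross /cross !coordE; congr EFin; ring.
Qed.

Lemma region_left t : ccw_quad t ->
  on_left (region t) (ppos t.1.1) (dpos t.1.2) /\ on_left (region t) (dpos t.2.2) (ppos t.1.1).
Proof.
by move=> /ccw_quad_cases[[h1 h2 ->]|[h1 h2 ->]]; have [? ? ? ?] := kite_left h1 h2; split.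
Qed.

Lemma region_edist t q r (k : R) : ccw_quad t -> region t q ->
  edist (ppos t.1.1) r <= k -> edist (dpos t.1.2) r <= k ->
  edist (ppos t.2.1) r <= k -> edist (dpos t.2.2) r <= k -> edist q r <= k.
Proof.
move=> /ccw_quad_cases[[h1 h2 ->]|[h1 h2 ->]] [] /tri_part_sub[q1 q2 q3] k1 k2 k3 k4.
- exact: (triangle_bound h1).
- exact: (triangle_bound h2).
- exact: (triangle_bound h1).
- exact: (triangle_bound h2).
Qed.

Definition opposite t : T4 := (t.2, t.1).

Lemma oppositeK : involutive opposite. Proof. by case. Qed.

Lemma ccw_quad_opposite t : ccw_quad (opposite t) = ccw_quad t.
Proof.
have H t' : ccw_quad t' -> ccw_quad (opposite t').
  case: t' => [[x w] [y v]] /ccw_quadP[/= iF qF D]; apply/andP; split => /=.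
    by apply/asboolP; exists (region ((x, w), (y, v))) => //=; exact/quad_face_swapV/quad_face_swapW.
  by move: D; rewrite /quad_cross /cross !coordE; lra.
by apply/idP/idP => /H //; rewrite oppositeK.
Qed.

Lemma region_opposite t : ccw_quad t -> region (opposite t) = region t.
Proof.
move=> tq; have [iF qF _] := ccw_quadP tq.
apply/esym/face_region => //=; last by rewrite ccw_quad_opposite.
exact/quad_face_swapV/quad_face_swapW.
Qed.

(** Distinct edges meet only at endpoints, and a midpoint is not one, so the midpoint of an edge
    singles it out among the sides of a face. *)
Lemma midpoint_frontier F x w y v x' w' : quad_face F x w y v -> edge x' w' ->
  frontier F (midpoint (ppos x') (dpos w')) -> (x' = x \/ x' = y) /\ (w' = w \/ w' = v).
Proof.
move=> [xy wv /and4P[e1 e2 e3 e4] ->] e' pF.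
have pe : eseg x' w' (midpoint (ppos x') (dpos w')) by exact: seg_midpoint.
have np : ppos x' <> dpos w' by exact: pos_neq.
have H x1 w1 : edge x1 w1 -> eseg x1 w1 (midpoint (ppos x') (dpos w')) -> x' = x1 /\ w' = w1.
  move=> e pe1; apply: contrapT => ne.
  have ne' : (x', w') <> (x1, w1) by move=> [? ?]; exact: ne.
  case: pG => _ _ /(_ _ _ _ _ e' e ne' _ pe pe1) [] [_].
    exact: midpoint_neql.
  by rewrite midpointC; apply: midpoint_neql => /esym.
by case: pF => [[[|]|]|] /H [] // -> ->; split; tauto.
Qed.

Lemma midpoint_frontier_edge F x w y v x' w' : quad_face F x w y v ->
  (x' = x \/ x' = y) -> (w' = w \/ w' = v) ->
  edge x' w' /\ frontier F (midpoint (ppos x') (dpos w')).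
Proof.
move=> [xy wv /and4P[e1 e2 e3 e4] ->] [->|->] [->|->]; split => //.
- by left; left; left; exact: seg_midpoint.
- by right; exact: seg_midpoint.
- by left; left; right; exact: seg_midpoint.
- by left; right; exact: seg_midpoint.
Qed.

(** Two opposite sides, recognised by their midpoints, determine all four vertices. The
    orthogonality granted for one listing of a face thus passes to every listing. *)
Lemma quad_face_vertices F x w y v x' w' y' v' :
  quad_face F x w y v -> quad_face F x' w' y' v' ->
  ((x' = x /\ y' = y) \/ (x' = y /\ y' = x)) /\ ((w' = w /\ v' = v) \/ (w' = v /\ v' = w)).
Proof.
move=> qF qF'; have [xy' wv' _ _] := qF'.
have [e1 f1] := midpoint_frontier_edge qF' (or_introl erefl) (or_introl erefl).
have [e2 f2] := midpoint_frontier_edge qF' (or_intror erefl) (or_intror erefl).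
have [h1 h2] := midpoint_frontier qF e1 f1; have [h3 h4] := midpoint_frontier qF e2 f2.
by move: xy' wv'; case: h1 => ->; case: h3 => ->; case: h2 => ->; case: h4 => ->;
  rewrite ?eqxx// => _ _; tauto.
Qed.

Lemma ccw_quad_orthogonal t : ccw_quad t ->
  dotp (ppos t.2.1 - ppos t.1.1) (dpos t.2.2 - dpos t.1.2) = 0.
Proof.
move=> /ccw_quadP[iF qF D]; have [_ _ /(_ _ iF)[x [w [y [v [qF' d0]]]]] _] := oG.
have [[[-> ->]|[-> ->]] [[-> ->]|[-> ->]]] := quad_face_vertices qF' qF => //;
  move: d0; rewrite /dotp !coordE; lra.
Qed.

Lemma quad_cross_neq0 t : is_quad t -> quad_cross t != 0.
Proof.
move=> [F iF qF]; have [_ _ /(_ _ iF)[x [w [y [v [qF' d0]]]]] _] := oG.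
have d1 : dotp (ppos t.2.1 - ppos t.1.1) (dpos t.2.2 - dpos t.1.2) = 0.
  have [[[-> ->]|[-> ->]] [[-> ->]|[-> ->]]] := quad_face_vertices qF' qF => //;
    move: d0; rewrite /dotp !coordE; lra.
have [xy wv _ _] := qF.
set u := ppos _ - _ in d1 *; set s := dpos _ - _ in d1 *.
have u0 : 0 < enorm u by rewrite enorm_gt0// subr_eq0; apply: contra xy => /eqP/(ppos_inj oG)->.
have s0 : 0 < enorm s by rewrite enorm_gt0// subr_eq0; apply: contra wv => /eqP/(dpos_inj oG)->.
apply/eqP => c0; have c0' : cross u s = 0 := c0.
have := orthogonal_cross d1; rewrite c0' lexx => /(_ isT)/esym/eqP.
by rewrite mulf_eq0 !gt_eqF.
Qed.

Definition swap_dual t : T4 := ((t.1.1, t.2.2), (t.2.1, t.1.2)).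

Lemma swap_dualK : involutive swap_dual. Proof. by case=> [[? ?] [? ?]]. Qed.

Lemma is_quad_swap_dual t : is_quad t -> is_quad (swap_dual t).
Proof. by move=> [F iF qF]; exists F => //=; exact: quad_face_swapW. Qed.

Lemma quad_cross_swap_dual t : quad_cross (swap_dual t) = - quad_cross t.
Proof. by rewrite /quad_cross /cross !coordE/=; ring. Qed.

Lemma is_quad_ccw t : is_quad t -> ccw_quad t || ccw_quad (swap_dual t).
Proof.
move=> tq; rewrite /ccw_quad (asboolT tq) (asboolT (is_quad_swap_dual tq)) quad_cross_swap_dual/=.
by have := quad_cross_neq0 tq; rewrite oppr_gt0 neq_lt orbC.
Qed.

Lemma edge_sides x w : edge x w -> exists2 e : R, 0 < e &
  let: (m, n) := (midpoint (ppos x) (dpos w), rot90 (dpos w - ppos x)) in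
  (forall s, 0 < s -> s < e -> ~ drawing G (m + s *: n) /\ ~ drawing G (m - s *: n)) /\
  (forall s s', 0 < s -> s < e -> 0 < s' -> s' < e ->
    comp G (m + s *: n) = comp G (m + s' *: n) /\ comp G (m - s *: n) = comp G (m - s' *: n)).
Proof.
move=> e; set m := midpoint _ _; set n := rot90 _.
have me : eseg x w m by exact: seg_midpoint.
have np : ppos x <> dpos w by exact: pos_neq.
have m1 : m <> ppos x by exact: midpoint_neql.
have m2 : m <> dpos w by rewrite /m midpointC; apply: midpoint_neql => /esym.
have [r r0 h] := edge_nbhd oG e me m1 m2.
have n1 : 0 < 1 + enorm n by rewrite ltr_pwDl// enorm_ge0.
have nn : 0 < enorm (dpos w - ppos x) ^+ 2.
  by rewrite exprn_gt0// enorm_gt0// subr_eq0 eq_sym; apply/eqP.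
have D (s : R) : `|s| < r / (1 + enorm n) -> s != 0 -> ~ drawing G (m + s *: n).
  rewrite ltr_pdivlMr// => sr s0.
  have mr : edist m (m + s *: n) < r.
    rewrite /edist opprD addrA subrr add0r enormN enormZ.
    by apply: le_lt_trans sr; rewrite ler_wpM2l// lerDr.
  move=> /(h _ mr).1 /seg_on_line/eqP.
  by rewrite orient_shift (seg_on_line me) add0r cross_rot90 mulf_eq0 (negbTE s0) gt_eqF.
exists (r / (1 + enorm n)); first by rewrite divr_gt0.
split=> [s s0 sr|s s' s0 sr s'0 s'r].
  split; first by apply: D; rewrite ?gt_eqF// gtr0_norm.
  by rewrite -scaleNr; apply: D; rewrite ?oppr_eq0 ?gt_eqF// normrN gtr0_norm.
have C (k k' l : R) : 0 <= l -> l <= 1 -> (1 - l) *: (m + k *: n) + l *: (m + k' *: n) =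
    m + ((1 - l) * k + l * k') *: n.
  by move=> _ _; apply: planeP; rewrite !coordE; ring.
have B (l : R) : 0 <= l -> l <= 1 -> 0 < (1 - l) * s + l * s' < r / (1 + enorm n).
  move=> l0 l1; move: (r / _) sr s'r => k sr s'r.
  have [ss|/ltW ss] := leP s s'.
    have : 0 <= l * (s' - s) by rewrite mulr_ge0 ?subr_ge0.
    have : l * (s' - s) <= s' - s by rewrite ler_piMl ?subr_ge0.
    by move=> ? ?; apply/andP; split; lra.
  have : 0 <= l * (s - s') by rewrite mulr_ge0 ?subr_ge0.
  have : l * (s - s') <= s - s' by rewrite ler_piMl ?subr_ge0.
  by move=> ? ?; apply/andP; split; lra.
split; apply: comp_seg => _ /segE[l [l0 l1 ->]]; have /andP[b0 b1] := B l l0 l1.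
  by rewrite C//; apply: D; rewrite ?gt_eqF// gtr0_norm.
rewrite -!scaleNr C// (_ : _ + _ = - ((1 - l) * s + l * s')); last by ring.
by apply: D; rewrite ?oppr_eq0 ?gt_eqF// normrN gtr0_norm.
Qed.

Lemma rot90_opp p q : rot90 (p - q) = - rot90 (q - p).
Proof. by apply: planeP; rewrite /rot90 !coordE/=; ring. Qed.

Lemma inner_face_frontier F p : inner_face G F -> ~ F p ->
  (forall e : R, 0 < e -> exists2 q, F q & edist p q < e) -> frontier F p.
Proof.
move=> iF nFp h; split; first exact/closure_edistP.
by move=> /interior_subset.
Qed.

Lemma edge_faces x w : edge x w -> Ghat G (midpoint (ppos x) (dpos w)) ->
  let: (m, n) := (midpoint (ppos x) (dpos w), rot90 (dpos w - ppos x)) in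
  exists F F', [/\ inner_face G F, inner_face G F', frontier F m, frontier F' m &
    exists2 e : R, 0 < e & forall s, 0 < s -> s < e -> F (m + s *: n) /\ F' (m - s *: n)].
Proof.
move=> e Gm; have [r r0 [h1 h2]] := edge_sides e.
set m := midpoint _ _ in Gm h1 h2 *; set n := rot90 _ in h1 h2 *.
have [r' r'0 h3] : exists2 r' : R, 0 < r' & forall q, edist m q < r' -> Ghat G q.
  have /open_edistP : open (Ghat G) by exact: open_interior.
  exact.
have n1 : 0 < 1 + enorm n by rewrite ltr_pwDl// enorm_ge0.
have dE (k : R) : 0 < k -> edist m (m + k *: n) = k * enorm n /\ edist m (m - k *: n) = k * enorm n.
  move=> k0; rewrite /edist !opprD !addrA !subrr !add0r opprK enormN enormZ gtr0_norm//.
pose s0 := Num.min r (r' / (1 + enorm n)) / 2.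
have mn : 0 < Num.min r (r' / (1 + enorm n)) by rewrite lt_min r0 divr_gt0.
have s00 : 0 < s0 by rewrite divr_gt0.
have s0m : s0 < Num.min r (r' / (1 + enorm n)) by rewrite /s0; lra.
have s0r : s0 < r by move: s0m; rewrite lt_min => /andP[].
have s0n : s0 * enorm n < r'.
  have : s0 < r' / (1 + enorm n) by move: s0m; rewrite lt_min => /andP[].
  by rewrite ltr_pdivlMr//; apply: le_lt_trans; rewrite ler_pM2l// lerDr.
have [d1 d2] := h1 _ s00 s0r.
have [g1 g2] : Ghat G (m + s0 *: n) /\ Ghat G (m - s0 *: n).
  by have [e1 e2] := dE _ s00; split; apply: h3; rewrite ?e1 ?e2.
have i1 := Ghat_comp g1 d1; have i2 := Ghat_comp g2 d2.
have inF s : 0 < s -> s < r -> comp G (m + s0 *: n) (m + s *: n) /\ comp G (m - s0 *: n) (m - s *: n).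
  move=> sp sr; have [-> ->] := h2 _ _ s00 s0r sp sr; have [? ?] := h1 _ sp sr.
  by split; exact: connected_component_refl.
have dm : drawing G m by right; exists x, w; split => //; exact: seg_midpoint.
have small (k : R) : 0 < k -> exists s, [/\ 0 < s, s < r & s * enorm n < k].
  move=> k0; exists (Num.min r (k / (1 + enorm n)) / 2).
  have mk : 0 < Num.min r (k / (1 + enorm n)) by rewrite lt_min r0 divr_gt0.
  have h : Num.min r (k / (1 + enorm n)) / 2 < Num.min r (k / (1 + enorm n)) by lra.
  split; first by rewrite divr_gt0.
    by apply: lt_le_trans h _; rewrite ge_min lexx.
  have : Num.min r (k / (1 + enorm n)) / 2 < k / (1 + enorm n).
    by apply: lt_le_trans h _; rewrite ge_min lexx orbT.
  by rewrite ltr_pdivlMr//; apply: le_lt_trans; rewrite ler_pM2l ?divr_gt0// lerDr.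
exists (comp G (m + s0 *: n)), (comp G (m - s0 *: n)); split => //; last by exists r.
- apply: inner_face_frontier => // [/(@connected_component_sub _ _ _ _)//|k /small[s [sp sr sk]]].
  by exists (m + s *: n); [have [] := inF _ sp sr|have [-> _] := dE _ sp].
- apply: inner_face_frontier => // [/(@connected_component_sub _ _ _ _)//|k /small[s [sp sr sk]]].
  by exists (m - s *: n); [have [] := inF _ sp sr|have [_ ->] := dE _ sp].
Qed.

Lemma face_quad_at F x w : inner_face G F -> edge x w ->
  frontier F (midpoint (ppos x) (dpos w)) -> exists y v, quad_face F x w y v.
Proof.
move=> iF e fm; have [_ _ /(_ _ iF)[x' [w' [y' [v' [qF _]]]]] _] := oG.
have [[->|->] [->|->]] := midpoint_frontier qF e fm.
- by exists y', v'.
- by exists y', w'; exact: quad_face_swapW.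
- by exists x', v'; exact: quad_face_swapV.
- by exists x', w'; exact/quad_face_swapW/quad_face_swapV.
Qed.

Lemma common_small (e e' : R) : 0 < e -> 0 < e' -> exists s, [/\ 0 < s, s < e & s < e'].
Proof.
move=> e0 e'0; have m0 : 0 < Num.min e e' by rewrite lt_min e0.
exists (Num.min e e' / 2); have : Num.min e e' / 2 < Num.min e e' by lra.
by rewrite lt_min divr_gt0// => /andP[].
Qed.

(** Two listings that begin with the edge from [x] to [w] both have their face on its left, hence
    the same face, and then [quad_face_vertices] leaves no freedom for the other two vertices. *)
Lemma ccw_left x w : edge x w -> Ghat G (midpoint (ppos x) (dpos w)) ->
  exists t0 : V * W, forall t1 : V * W, ccw_quad ((x, w), t1) = (t1 == t0).
Proof.
move=> e Gm; have [F [F2 [iF _ fF _ [r r0 h]]]] := edge_faces e Gm.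
have [y [v qF]] := face_quad_at iF e fF.
(* If instead the swapped listing were counterclockwise, the face would lie to the right of the
   edge, contrary to [h]. *)
have tq : ccw_quad ((x, w), (y, v)).
  have /is_quad_ccw/orP[//|tq] : is_quad ((x, w), (y, v)) by exists F.
  have FE : F = region (swap_dual ((x, w), (y, v))).
    by apply: face_region => //=; exact: quad_face_swapW.
  have [_ [r' r'0 h']] := region_left tq.
  have [s [s0 sr sr']] := common_small r0 r'0.
  have [Fs _] := h _ s0 sr; have /= [_] := h' _ s0 sr'.
  by rewrite -FE midpointC rot90_opp scalerN opprK.
exists (y, v) => -[y' v']; apply/idP/eqP => [tq'|[-> ->]//].
have FE : F = region ((x, w), (y', v')).
  have [[r' r'0 h'] _] := region_left tq'.
  have [s [s0 sr sr']] := common_small r0 r'0.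
  have [Fs _] := h _ s0 sr; have /= [Fs' _] := h' _ s0 sr'.
  by have [iF' _ _] := ccw_quadP tq'; rewrite (inner_faceE iF Fs).1 (inner_faceE iF' Fs').1.
have [_ /= qF' _] := ccw_quadP tq'; rewrite -FE in qF'.
have [xy wv _ _] := qF.
have [[[_ ->]|[e1 _]] [[_ ->]|[e2 _]]] := quad_face_vertices qF qF' => //.
- by rewrite e2 eqxx in wv.
- by rewrite e1 eqxx in xy.
- by rewrite e1 eqxx in xy.
Qed.

(** In [swap_dual ((x, w), t1)] the edge is the last side, run through from [w] to [x], so the face
    listed is the one to the right of [x w]. *)
Lemma ccw_right x w : edge x w -> Ghat G (midpoint (ppos x) (dpos w)) ->
  exists t0 : V * W, forall t1 : V * W, ccw_quad (swap_dual ((x, w), t1)) = (t1 == t0).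
Proof.
move=> e Gm; have [F2 [F [_ iF _ fF [r r0 h]]]] := edge_faces e Gm.
have [y [v qF]] := face_quad_at iF e fF.
have tq : ccw_quad (swap_dual ((x, w), (y, v))).
  have /is_quad_ccw/orP[tq|//] : is_quad ((x, w), (y, v)) by exists F.
  have FE : F = region ((x, w), (y, v)) by apply: face_region.
  have [[r' r'0 h'] _] := region_left tq.
  have [s [s0 sr sr']] := common_small r0 r'0.
  have [_ Fs] := h _ s0 sr; have /= [_] := h' _ s0 sr'.
  by rewrite -FE.
exists (y, v) => -[y' v']; apply/idP/eqP => [tq'|[-> ->]//].
have FE : F = region (swap_dual ((x, w), (y', v'))).
  have [_ [r' r'0 h']] := region_left tq'.
  have [s [s0 sr sr']] := common_small r0 r'0.
  have [_ Fs] := h _ s0 sr; have /= [Fs' _] := h' _ s0 sr'.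
  rewrite midpointC rot90_opp scalerN in Fs'.
  by have [iF' _ _] := ccw_quadP tq'; rewrite (inner_faceE iF Fs).1 (inner_faceE iF' Fs').1.
have [_ /= qF' _] := ccw_quadP tq'; rewrite -FE in qF'.
have [xy wv _ _] := qF.
have [[[_ ->]|[e1 _]] [[_ ->]|[e2 _]]] := quad_face_vertices qF (quad_face_swapW qF') => //.
- by rewrite e2 eqxx in wv.
- by rewrite e1 eqxx in xy.
- by rewrite e1 eqxx in xy.
Qed.

Lemma ccw_quad_edge t : ccw_quad t ->
  [/\ edge t.1.1 t.1.2, edge t.2.1 t.1.2, edge t.2.1 t.2.2 & edge t.1.1 t.2.2].
Proof. by move=> /ccw_quadP[_ [_ _ /and4P[]]]. Qed.

(* Each edge inside [Ghat] has one face on its left and one on its right. *)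
Lemma sum_edge_cancel (N : V -> W -> R) :
  (forall x w, edge x w -> N x w != 0 -> Ghat G (midpoint (ppos x) (dpos w))) ->
  \sum_(t | ccw_quad t) N t.1.1 t.1.2 = \sum_(t | ccw_quad t) N t.1.1 t.2.2.
Proof.
move=> hN; rewrite [RHS](reindex_inj (inv_inj swap_dualK))/=.
rewrite (eq_bigl (fun t => true && ccw_quad t))// [RHS](eq_bigl (fun t => true && ccw_quad (swap_dual t)))//.
rewrite -!(pair_big_dep xpredT (fun (e t1 : V * W) => ccw_quad (e, t1)) (fun (e t1 : V * W) => N e.1 e.2)).
rewrite -(pair_big_dep xpredT (fun (e t1 : V * W) => ccw_quad (swap_dual (e, t1))) (fun (e t1 : V * W) => N e.1 e.2)) /=.
apply: eq_bigr => -[x w] _ /=.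
have [exw|nexw] := boolP (edge x w); last first.
  rewrite !big1// => t1 /ccw_quad_edge[]/=; rewrite ?(negbTE nexw)//.
have [->|nz] := eqVneq (N x w) 0; first by rewrite !big1.
have [t0 h0] := ccw_left exw (hN _ _ exw nz).
have [t1 h1] := ccw_right exw (hN _ _ exw nz).
by rewrite (eq_bigl _ _ h0) (eq_bigl _ _ h1) !big_pred1_eq.
Qed.

Lemma face_ccw F : inner_face G F -> exists2 t, ccw_quad t & F = region t.
Proof.
move=> iF; have [_ _ /(_ _ iF)[x [w [y [v [qF _]]]]] _] := oG.
have /is_quad_ccw/orP[tq|tq] : is_quad ((x, w), (y, v)) by exists F.
  by exists ((x, w), (y, v)) => //; exact: face_region.
exists (swap_dual ((x, w), (y, v))) => //; apply: face_region => //=.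
exact: quad_face_swapW.
Qed.

(** The value is [2] because a face is listed by some [t] and by [opposite t], and by no other
    tuple; the factors [2^-1] in later sums compensate for it. *)
Lemma region_cover p : Ghat G p -> ~ drawing G p ->
  \sum_(t | ccw_quad t) (\1_(region t) p : R) = 2.
Proof.
move=> Gp np; have iF := Ghat_comp Gp np; set F := comp G p in iF.
have Fp : F p by exact: connected_component_refl.
have [t tq FE] := face_ccw iF.
have top : opposite t != t.
  by apply/eqP => e; have [_ [xy _ _ _] _] := ccw_quadP tq; move: xy; rewrite -{1}e eqxx.
rewrite (bigD1 t)//= (bigD1 (opposite t))/=; last by rewrite ccw_quad_opposite tq.
rewrite !indicE region_opposite// -FE mem_set//= big1 ?addr0 -?natrD// => t' /andP[/andP[tq' n1] n2].
rewrite indicE memNset// => rp; have [iF' qF' D'] := ccw_quadP tq'.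
have FE' : region t' = F by rewrite (inner_faceE iF' rp).1.
have [_ qF D] := ccw_quadP tq; rewrite -FE in qF; rewrite FE' in qF'.
clear top tq tq' FE FE' rp iF'; case: t t' qF qF' D D' n1 n2 => [[x w] [y v]] [[x' w'] [y' v']] /=.
move=> qF qF'; have [[[-> ->]|[-> ->]] [[-> ->]|[-> ->]]] := quad_face_vertices qF qF'.
- by rewrite eqxx.
- by move=> D D'; move: D D'; rewrite /quad_cross /cross !coordE/=; lra.
- by move=> D D'; move: D D'; rewrite /quad_cross /cross !coordE/=; lra.
- by rewrite eqxx.
Qed.

(** Of the two orders in which the definition meets a face exactly one is counterclockwise, and
    keeping only that one absorbs the factor [2^-1]. *)
Lemma conductanceE x y : conductance x y =
  \sum_(w : W) \sum_(v : W)
    if ccw_quad ((x, w), (y, v)) then edist (dpos w) (dpos v) / edist (ppos x) (ppos y) else 0.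
Proof.
rewrite /conductance.
pose c w v := edist (dpos w) (dpos v) / edist (ppos x) (ppos y).
pose P w v := ccw_quad ((x, w), (y, v)).
have E w v : (if `[< exists2 F, inner_face G F & quad_face F x w y v >] then c w v else 0) =
    (if P w v then c w v else 0) + (if P v w then c v w else 0).
  have Q v' w' : P w' v' -> is_quad ((x, w'), (y, v')) by move=> /andP[/asboolP].
  case: asboolP => [q|nq].
    have q' : is_quad ((x, w), (y, v)) by [].
    have : ~~ (P w v && P v w).
      apply/negP => /andP[/andP[_ d1] /andP[_ d2]].
      by move: d1 d2; rewrite /quad_cross /cross !coordE/=; lra.
    have := is_quad_ccw q'; rewrite -/(P w v) /swap_dual/= -/(P v w).
    case: (P w v); case: (P v w) => //= _ _; first by rewrite addr0.
    by rewrite add0r /c edistC.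
  have -> : P w v = false by apply/negP => /Q.
  have -> : P v w = false.
    by apply/negP => /Q/is_quad_swap_dual.
  by rewrite addr0.
under eq_bigr => w _ do (under eq_bigr => v _ do rewrite E; rewrite big_split/=).
rewrite big_split/=; set A := \sum_w _; have -> : \sum_w \sum_i (if P i w then c i w else 0) = A.
  by rewrite exchange_big.
by have -> : 2^-1 * (A + A) = A by field.
Qed.

End Tuples.

(** * Calculus in the plane *)

Section Calculus.
Variable R : realType.
Implicit Types (f g : R * R -> R) (p q u v m : R * R) (b : bool) (B k t : R).

(** [smooth] speaks only of derivatives along the axes, so increments are taken along paths parallel
    to the axes, and this norm is their length. *)
Definition norm1 u : R := `|u.1| + `|u.2|.

Lemma norm1_ge0 u : 0 <= norm1 u. Proof. by rewrite addr_ge0. Qed.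

Lemma norm1D u v : norm1 (u + v) <= norm1 u + norm1 v.
Proof. by rewrite /norm1 !coordE addrACA lerD// ler_normD. Qed.

Lemma norm1Z k u : norm1 (k *: u) = `|k| * norm1 u.
Proof. by rewrite /norm1 !coordE !normrM mulrDr. Qed.

Lemma norm1N u : norm1 (- u) = norm1 u.
Proof. by rewrite /norm1 !coordE !normrN. Qed.

Lemma norm1_enorm u : norm1 u <= 2 * enorm u.
Proof. by have := norm_fst_le u; have := norm_snd_le u; rewrite /norm1; lra. Qed.

Lemma norm1_dir b : norm1 (dir R b) = 1.
Proof. by case: b; rewrite /norm1/= normr0 normr1 ?addr0 ?add0r. Qed.

Lemma is_derive_line f v p t : derivable f (p + t *: v) v ->
  is_derive t (1:R) (fun s : R => f (p + s *: v)) ('D_v f (p + t *: v)).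
Proof.
move=> df.
have E : (fun h : R => h^-1 *: (f (p + (h *: (1:R) + t) *: v) - f (p + t *: v))) =
    (fun h => h^-1 *: (f (h *: v + (p + t *: v)) - f (p + t *: v))).
  apply/funext => h; congr (_ *: (f _ - _)); apply: planeP; rewrite !coordE /GRing.scale/=; ring.
apply: DeriveDef; first by rewrite /derivable E.
by rewrite /derive E.
Qed.

Lemma mvt_axis f b p t : (forall q, derivable f q (dir R b)) ->
  exists2 s, `|s| <= `|t| & f (p + t *: dir R b) - f p = t * 'D_(dir R b) f (p + s *: dir R b).
Proof.
move=> df; pose g (s : R) := f (p + s *: dir R b).
have dg (s : R) : is_derive s (1:R) g ('D_(dir R b) f (p + s *: dir R b)) by exact: is_derive_line.
have cg : continuous g.
  by move=> s; apply: differentiable_continuous; apply/derivable1_diffP; exact: ex_derive.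
have g0 : g 0 = f p by rewrite /g scale0r addr0.
have [t0|t0] := leP 0 t.
  have [|s] := @MVT_segment _ g _ _ _ t0 (fun s _ => dg s); first exact: continuous_subspaceT.
  rewrite in_itv/= g0 => /andP[s0 st] ->; exists s; first by rewrite !ger0_norm.
  by rewrite subr0 mulrC.
have [|s] := @MVT_segment _ g _ _ _ (ltW t0) (fun s _ => dg s); first exact: continuous_subspaceT.
rewrite in_itv/= g0 => /andP[ts s0] e; exists s.
  by rewrite !ler0_norm// ?lerN2// ltW.
by rewrite -[LHS]opprB e; ring.
Qed.

Definition axis_derivable f := forall b q, derivable f q (dir R b).

Lemma increment_axes f p v : axis_derivable f -> exists q1 q2,
  [/\ norm1 (q1 - p) <= norm1 v, norm1 (q2 - p) <= norm1 v &
    f (p + v) - f p = 'D_(dir R false) f q1 * v.1 + 'D_(dir R true) f q2 * v.2].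
Proof.
move=> df; have [s1 s1v e1] := mvt_axis p v.1 (df false).
have [s2 s2v e2] := mvt_axis (p + v.1 *: dir R false) v.2 (df true).
exists (p + s1 *: dir R false), (p + v.1 *: dir R false + s2 *: dir R true); split.
- rewrite addrAC subrr add0r norm1Z norm1_dir mulr1; apply: le_trans s1v _.
  by rewrite /norm1 lerDl.
- have -> : p + v.1 *: dir R false + s2 *: dir R true - p = v.1 *: dir R false + s2 *: dir R true.
    by apply: planeP; rewrite !coordE; ring.
  apply: (le_trans (norm1D _ _)).
  by rewrite !norm1Z !norm1_dir !mulr1 lerD.
- have <- : p + v.1 *: dir R false + v.2 *: dir R true = p + v.
    by apply: planeP; rewrite !coordE/=; ring.
  move: e1 e2; lra.
Qed.

Lemma lipschitz_axes f B p v : axis_derivable f ->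
  (forall b q, `|'D_(dir R b) f q| <= B) -> `|f (p + v) - f p| <= B * norm1 v.
Proof.
move=> df hB; have [q1 [q2 [_ _ ->]]] := increment_axes p v df.
apply: (le_trans (ler_normD _ _)); rewrite !normrM mulrDr.
by rewrite lerD// ler_wpM2r.
Qed.

Lemma lipschitz_sub f B p q : axis_derivable f ->
  (forall b q, `|'D_(dir R b) f q| <= B) -> `|f p - f q| <= B * norm1 (p - q).
Proof.
by move=> df hB; have := lipschitz_axes q (p - q) df hB; rewrite (addrC q) subrK.
Qed.

Definition grad_dot f m v : R := 'D_(dir R false) f m * v.1 + 'D_(dir R true) f m * v.2.

(** The gradient is taken at a free point [m], such as the midpoint of a dual diagonal; the distance
    from [p] to [m] then enters the error. *)
Lemma taylor_axes f B m p v : axis_derivable f ->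
  (forall b, axis_derivable ('D_(dir R b) f)) ->
  (forall b c q, `|'D_(dir R c) ('D_(dir R b) f) q| <= B) ->
  `|f (p + v) - f p - grad_dot f m v| <= B * (norm1 (p - m) + norm1 v) * norm1 v.
Proof.
move=> df ddf hB; have [q1 [q2 [h1 h2 ->]]] := increment_axes p v df.
have near b q : norm1 (q - p) <= norm1 v ->
    `|'D_(dir R b) f q - 'D_(dir R b) f m| <= B * (norm1 (p - m) + norm1 v).
  move=> h; apply: (le_trans (lipschitz_sub _ _ (ddf b) (hB b))).
  apply: ler_wpM2l; first by apply: le_trans (hB b b p); rewrite normr_ge0.
  have -> : q - m = (q - p) + (p - m) by rewrite addrA subrK.
  by have := norm1D (q - p) (p - m); lra.
rewrite /grad_dot (_ : _ - _ = ('D_(dir R false) f q1 - 'D_(dir R false) f m) * v.1 +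
  ('D_(dir R true) f q2 - 'D_(dir R true) f m) * v.2); last by ring.
apply: (le_trans (ler_normD _ _)); rewrite !normrM [norm1 v in leRHS]/norm1 mulrDr -/(norm1 v).
by rewrite lerD// ler_wpM2r//; exact: near.
Qed.

Lemma difference_quotient_shift f u q v :
  (fun h : R => h^-1 *: (f (h *: v + q + u) - f (q + u))) =
  (fun h : R => h^-1 *: (f (h *: v + (q + u)) - f (q + u))).
Proof. by apply/funext => h; rewrite addrA. Qed.

Lemma derivable_shift f u q v : derivable f (q + u) v -> derivable (fun r => f (r + u)) q v.
Proof. by rewrite /derivable difference_quotient_shift. Qed.

Lemma derive_shift f u q v : 'D_v (fun r => f (r + u)) q = 'D_v f (q + u).
Proof. by rewrite /derive difference_quotient_shift. Qed.

(** The increment in [v] is applied to the function [f (r + u) - f r], whose derivatives are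
    increments of derivatives of [f]. *)
Lemma second_difference f B p u v : axis_derivable f ->
  (forall b, axis_derivable ('D_(dir R b) f)) ->
  (forall b c q, `|'D_(dir R c) ('D_(dir R b) f) q| <= B) ->
  `|f (p + u + v) - f (p + u) - f (p + v) + f p| <= B * norm1 u * norm1 v.
Proof.
move=> df ddf hB; pose g r := f (r + u) - f r.
have dfs b q : derivable (fun r => f (r + u)) q (dir R b) by apply: derivable_shift; exact: df.
have dg : axis_derivable g by move=> b q; apply: derivableB; [exact: dfs|exact: df].
rewrite (_ : _ + f p = g (p + v) - g p); last by rewrite /g (addrAC p v u); ring.
apply: lipschitz_axes => // b q.
rewrite (_ : 'D_(dir R b) g q = 'D_(dir R b) f (q + u) - 'D_(dir R b) f q).
  exact: (lipschitz_axes _ _ (ddf b) (hB b)).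
by rewrite (deriveB (dfs b q) (df b q)) derive_shift.
Qed.

(* Midpoint approximation of the flux of [grad f] through the segment [p q],
   towards its right. *)
Definition flux f p q : R :=
  'D_(dir R false) f (midpoint p q) * (q.2 - p.2) -
  'D_(dir R true) f (midpoint p q) * (q.1 - p.1).

Lemma fluxC f p q : flux f q p = - flux f p q.
Proof. by rewrite /flux midpointC; ring. Qed.

Section Flux.
Variables (f : R * R -> R) (B2 B3 : R).
Hypothesis d1 : axis_derivable f.
Hypothesis d2 : forall b, axis_derivable ('D_(dir R b) f).
Hypothesis d3 : forall b c, axis_derivable ('D_(dir R c) ('D_(dir R b) f)).
Hypothesis hB2 : forall b c q, `|'D_(dir R c) ('D_(dir R b) f) q| <= B2.
Hypothesis hB3 : forall a b c q, `|'D_(dir R c) ('D_(dir R b) ('D_(dir R a) f)) q| <= B3.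

Let B20 : 0 <= B2. Proof. by apply: le_trans (hB2 true true 0); rewrite normr_ge0. Qed.
Let B30 : 0 <= B3. Proof. by apply: le_trans (hB3 true true true 0); rewrite normr_ge0. Qed.

Lemma flux_increment (x y w v : R * R) (c : R) : 0 <= c -> v - w = c *: rot90 (y - x) ->
  `|c * (f y - f x) - flux f w v| <=
    c * (B2 * (norm1 (x - midpoint w v) + norm1 (y - x)) * norm1 (y - x)).
Proof.
move=> c0 e.
have -> : flux f w v = c * grad_dot f (midpoint w v) (y - x).
  have e1 : v.1 - w.1 = - (c * (y.2 - x.2)).
    by move: (congr1 fst e); rewrite !coordE /rot90/= ?coordE; lra.
  have e2 : v.2 - w.2 = c * (y.1 - x.1).
    by move: (congr1 snd e); rewrite !coordE /rot90/= ?coordE; lra.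
  by rewrite /flux /grad_dot e1 e2 !coordE; ring.
rewrite -mulrBr normrM (ger0_norm c0) ler_wpM2l//.
by have := taylor_axes (midpoint w v) x (y - x) d1 d2 hB2; rewrite (addrC x) subrK.
Qed.

(** A constant field has no flux through a closed triangle, so the gradient at the midpoint of [x v]
    can be subtracted from the gradients at the other two midpoints. *)
Lemma flux_triangle (x w v : R * R) :
  `|flux f x w + flux f w v + flux f v x| <= B2 * norm1 (w - x) * norm1 (v - w).
Proof.
pose G (b : bool) (m0 : R * R) : R := 'D_(dir R b) f m0.
have L b p q : `|G b p - G b q| <= B2 * norm1 (p - q).
  exact: (lipschitz_sub p q (@d2 b) (@hB2 b)).
have m13 : norm1 (midpoint x w - midpoint x v) = 2^-1 * norm1 (v - w).
  rewrite -(norm1N (v - w)) -[X in X * _](ger0_norm (_ : 0 <= 2^-1 :> R)) ?invr_ge0//.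
  by rewrite -norm1Z; congr norm1; apply: planeP; rewrite /midpoint !coordE; field.
have m23 : norm1 (midpoint w v - midpoint x v) = 2^-1 * norm1 (w - x).
  rewrite -[X in X * _](ger0_norm (_ : 0 <= 2^-1 :> R)) ?invr_ge0//.
  by rewrite -norm1Z; congr norm1; apply: planeP; rewrite /midpoint !coordE; field.
have -> : flux f x w + flux f w v + flux f v x =
  ((G false (midpoint x w) - G false (midpoint x v)) * (w.2 - x.2) +
   (G true (midpoint x v) - G true (midpoint x w)) * (w.1 - x.1)) +
  ((G false (midpoint w v) - G false (midpoint x v)) * (v.2 - w.2) +
   (G true (midpoint x v) - G true (midpoint w v)) * (v.1 - w.1)).
  by rewrite /flux (midpointC v x) /G; ring.
have P b b' p q u : `|(G b p - G b q) * u.2 + (G b' q - G b' p) * u.1| <=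
    B2 * norm1 (p - q) * norm1 u.
  apply: (le_trans (ler_normD _ _)); rewrite !normrM {2}/norm1 mulrDr addrC.
  apply: lerD.
    by apply: ler_wpM2r => //; rewrite distrC; exact: L.
  by apply: ler_wpM2r => //; exact: L.
apply: (le_trans (ler_normD _ _)).
apply: le_trans (lerD (P false true _ _ (w - x)) (P false true _ _ (v - w))) _.
rewrite m13 m23; have := norm1_ge0 (w - x); have := norm1_ge0 (v - w); nra.
Qed.

(* Summation around a quadrilateral: [e] and [e'] are its diagonals, [G] stands
   for the gradient and [S] for the Hessian at the base point. *)
Lemma flux_quad_identity (G : bool -> R * R -> R) (S : bool -> bool -> R)
    (x w y v m u u' : R * R) : let e := y - x in let e' := v - w in let s := w - x in
  u = 2^-1 *: e -> u' = 2^-1 *: e' ->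
  let D b z := S b false * z.1 + S b true * z.2 in
  let E1 b := G b (m + u + u') - G b (m + u) - G b (m + u') + G b m in
  let E2 b := G b (m + u + u') - G b (m + u') - D b u in
  let E3 b := G b (m + u + u') - G b (m + u) - D b u' in
  G false m * (w.2 - x.2) - G true m * (w.1 - x.1) -
  (G false (m + u') * (v.2 - x.2) - G true (m + u') * (v.1 - x.1)) -
  (G false (m + u) * (w.2 - y.2) - G true (m + u) * (w.1 - y.1)) +
  (G false (m + u + u') * (v.2 - y.2) - G true (m + u + u') * (v.1 - y.1)) -
  2^-1 * cross e e' * (S false false + S true true) =
  (E1 false * s.2 - E1 true * s.1) + (E2 false * e'.2 - E2 true * e'.1) -
  (E3 false * e.2 - E3 true * e.1).
Proof.
move=> e e' s uE uE' D E1 E2 E3; rewrite /E1 /E2 /E3 /D.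
move: (G false (m + u + u')) (G true (m + u + u')) (G false (m + u)) (G true (m + u)) => g1 g2 g3 g4.
move: (G false (m + u')) (G true (m + u')) (G false m) (G true m) => g5 g6 g7 g8.
by rewrite uE uE' /e /e' /s /cross !coordE; field.
Qed.

(** The midpoints of the sides form the parallelogram [m], [m + u], [m + u + u'], [m + u']. The
    error therefore consists of one second difference [E1] of the gradient and two Taylor remainders
    [E2] and [E3], all controlled by third derivatives of [f]. *)
Lemma flux_quad (x w y v : R * R) (K : R) :
  norm1 (w - x) <= K -> norm1 (y - x) <= K -> norm1 (v - w) <= K ->
  `|flux f x w - flux f x v - flux f y w + flux f y v -
    2^-1 * cross (y - x) (v - w) *
      ('D_(dir R false) ('D_(dir R false) f) x + 'D_(dir R true) ('D_(dir R true) f) x)| <=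
  4 * B3 * K * norm1 (y - x) * norm1 (v - w).
Proof.
move=> sK eK e'K; pose G (b : bool) (m0 : R * R) : R := 'D_(dir R b) f m0.
pose u := 2^-1 *: (y - x); pose u' := 2^-1 *: (v - w); pose m := midpoint x w.
have K0 : 0 <= K by apply: le_trans sK; exact: norm1_ge0.
have mxv : midpoint x v = m + u' by apply: planeP; rewrite /m /u' /midpoint !coordE; field.
have myw : midpoint y w = m + u by apply: planeP; rewrite /m /u /midpoint !coordE; field.
have myv : midpoint y v = m + u + u'.
  by apply: planeP; rewrite /m /u /u' /midpoint !coordE; field.
have h1 b := second_difference m u u' (@d2 b) (@d3 b) (@hB3 b).
have h2 b := taylor_axes x (m + u') u (@d2 b) (@d3 b) (@hB3 b).
have h3 b := taylor_axes x (m + u) u' (@d2 b) (@d3 b) (@hB3 b).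
have muu : m + u' + u = m + u + u' by rewrite addrAC.
have nu : norm1 u = 2^-1 * norm1 (y - x) by rewrite /u norm1Z ger0_norm ?invr_ge0.
have nu' : norm1 u' = 2^-1 * norm1 (v - w) by rewrite /u' norm1Z ger0_norm ?invr_ge0.
have nm : norm1 (m - x) = 2^-1 * norm1 (w - x).
  rewrite -[X in X * _](ger0_norm (_ : 0 <= 2^-1 :> R)) ?invr_ge0// -norm1Z.
  by congr norm1; apply: planeP; rewrite /m /midpoint !coordE; field.
have nmu : norm1 (m + u - x) <= K.
  by have := norm1D (m - x) u; rewrite (_ : m - x + u = m + u - x); [lra|rewrite addrAC].
have nmu' : norm1 (m + u' - x) <= K.
  by have := norm1D (m - x) u'; rewrite (_ : m - x + u' = m + u' - x); [lra|rewrite addrAC].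
pose E1 b := G b (m + u + u') - G b (m + u) - G b (m + u') + G b m.
pose E2 b := G b (m + u + u') - G b (m + u') - grad_dot ('D_(dir R b) f) x u.
pose E3 b := G b (m + u + u') - G b (m + u) - grad_dot ('D_(dir R b) f) x u'.
have -> : flux f x w - flux f x v - flux f y w + flux f y v -
    2^-1 * cross (y - x) (v - w) *
      ('D_(dir R false) ('D_(dir R false) f) x + 'D_(dir R true) ('D_(dir R true) f) x) =
    (E1 false * (w - x).2 - E1 true * (w - x).1) +
    (E2 false * (v - w).2 - E2 true * (v - w).1) -
    (E3 false * (y - x).2 - E3 true * (y - x).1).
  rewrite /flux mxv myw myv.
  exact: (@flux_quad_identity G (fun b c => 'D_(dir R c) ('D_(dir R b) f) x)).
have P (E : bool -> R) k (z : R * R) : (forall b, `|E b| <= k) ->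
    `|E false * z.2 - E true * z.1| <= k * norm1 z.
  move=> h; apply: (le_trans (ler_normB _ _)); rewrite !normrM /norm1 mulrDr addrC.
  by rewrite lerD// ler_wpM2r.
set A := norm1 (y - x) in nu eK *; set A' := norm1 (v - w) in nu' e'K *.
have A0 : 0 <= A by exact: norm1_ge0.
have A'0 : 0 <= A' by exact: norm1_ge0.
have AA : 0 <= B3 * (A * A') by rewrite !mulr_ge0.
have p1 b : `|E1 b| <= B3 * (A * A').
  apply: (le_trans (h1 b)); rewrite nu nu'.
  have -> : B3 * (2^-1 * A) * (2^-1 * A') = 4^-1 * (B3 * (A * A')) by field.
  lra.
have p2 b : `|E2 b| <= B3 * K * A.
  have := h2 b; rewrite muu => /le_trans; apply.
  rewrite nu; have KA : norm1 (m + u' - x) + 2^-1 * A <= 2 * K by lra.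
  have : B3 * A * (norm1 (m + u' - x) + 2^-1 * A) <= B3 * A * (2 * K).
    by rewrite ler_wpM2l// mulr_ge0.
  move: (norm1 (m + u' - x)) => nn.
  have -> : B3 * (nn + 2^-1 * A) * (2^-1 * A) = 2^-1 * (B3 * A * (nn + 2^-1 * A)) by field.
  have -> : B3 * K * A = 2^-1 * (B3 * A * (2 * K)) by field.
  lra.
have p3 b : `|E3 b| <= B3 * K * A'.
  apply: (le_trans (h3 b)).
  rewrite nu'; have KA : norm1 (m + u - x) + 2^-1 * A' <= 2 * K by lra.
  have : B3 * A' * (norm1 (m + u - x) + 2^-1 * A') <= B3 * A' * (2 * K).
    by rewrite ler_wpM2l// mulr_ge0.
  move: (norm1 (m + u - x)) => nn.
  have -> : B3 * (nn + 2^-1 * A') * (2^-1 * A') = 2^-1 * (B3 * A' * (nn + 2^-1 * A')) by field.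
  have -> : B3 * K * A' = 2^-1 * (B3 * A' * (2 * K)) by field.
  lra.
apply: (le_trans (ler_normB _ _)).
apply: le_trans (lerD (ler_normD _ _) (lexx _)) _.
have q1 := P _ _ (w - x) p1; have q2 := P _ _ (v - w) p2; have q3 := P _ _ (y - x) p3.
have q4 : B3 * (A * A') * norm1 (w - x) <= B3 * (A * A') * K by rewrite ler_wpM2l.
have q5 : 0 <= B3 * (A * A') * K by rewrite mulr_ge0.
rewrite -/A -/A' in q2 q3.
have -> : 4 * B3 * K * A * A' = 4 * (B3 * (A * A') * K) by ring.
have q6 : B3 * K * A * A' = B3 * (A * A') * K by ring.
have q7 : B3 * K * A' * A = B3 * (A * A') * K by ring.
rewrite q6 in q2; rewrite q7 in q3.
lra.
Qed.

End Flux.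

Lemma difference_quotient_affine f (a k : R) (c p v : R * R) (h : R) : a != 0 -> h != 0 ->
  h^-1 *: (k * f (a *: (h *: v + p) + c) - k * f (a *: p + c)) =
  k * a * ((a * h)^-1 *: (f ((a * h) *: v + (a *: p + c)) - f (a *: p + c))).
Proof.
move=> a0 h0; have -> : a *: (h *: v + p) + c = (a * h) *: v + (a *: p + c).
  by apply: planeP; rewrite !coordE; ring.
by rewrite /GRing.scale/=; field; rewrite ?a0 ?h0.
Qed.

Lemma dnbhs_mul (a : R) : a != 0 -> (fun h : R => a * h) @ 0^' --> 0^'.
Proof.
move=> a0 A /nbhs_ballP[e /= e0 eA]; apply/nbhs_ballP.
exists (e / `|a|) => /=; first by rewrite divr_gt0// normr_gt0.
move=> h; rewrite /ball/= sub0r normrN ltr_pdivlMr ?normr_gt0// => hb h0; apply: eA.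
  by rewrite /ball/= sub0r normrN normrM mulrC.
by rewrite mulf_neq0.
Qed.

Lemma is_derive_affine f (a k : R) (c p v : R * R) : a != 0 -> derivable f (a *: p + c) v ->
  is_derive p v (fun q => k * f (a *: q + c)) (k * a * 'D_v f (a *: p + c)).
Proof.
move=> a0 df; pose q := a *: p + c.
have L : (fun h : R => h^-1 *: (k * f (a *: (h *: v + p) + c) - k * f (a *: p + c))) @ 0^' -->
    k * a * 'D_v f q.
  have : (fun h : R => k * a * ((a * h)^-1 *: (f ((a * h) *: v + q) - f q))) @ 0^' -->
      k * a * 'D_v f q.
    apply: cvgM; first exact: cvg_cst.
    have df' : (fun h : R => h^-1 *: (f (h *: v + q) - f q)) @ 0^' --> 'D_v f q by exact: df.
    exact: (@cvg_comp _ _ _ (fun h : R => a * h) (fun h : R => h^-1 *: (f (h *: v + q) - f q)) _ _ _ (dnbhs_mul a0) df').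
  apply: cvg_trans; apply: near_eq_cvg; near=> h.
  by rewrite difference_quotient_affine//; near: h; exact: nbhs_dnbhs_neq.
apply: DeriveDef; first by apply/cvg_ex; exists (k * a * 'D_v f q).
by apply: cvg_lim.
Unshelve. all: by end_near.
Qed.

Lemma partial_affine f (a k : R) (c : R * R) (s : seq bool) : a != 0 -> smooth f ->
  partial s (fun q => k * f (a *: q + c)) =
  (fun q => k * a ^+ size s * partial s f (a *: q + c)).
Proof.
move=> a0 sf; elim: s => [|b s IH]; first by apply/funext => q; rewrite mulr1.
rewrite [LHS]/= -/(partial s _) IH; apply/funext => q.
have := @is_derive_affine (partial s f) a (k * a ^+ size s) c q (dir R b) a0 ((sf s).2 b _).
by move=> /(@derive_val _ _ _ _ _ _ _) ->; rewrite /= exprSr mulrA.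
Qed.

Lemma smooth_affine f (a k : R) (c : R * R) : a != 0 -> smooth f ->
  smooth (fun q => k * f (a *: q + c)).
Proof.
move=> a0 sf s; rewrite partial_affine//; split=> [q|b p].
  apply: cvgM; first exact: cvg_cst.
  apply: (@cvg_comp _ _ _ (fun q : R * R => a *: q + c) (partial s f) _ (nbhs (a *: q + c))); last exact: (sf s).1.
  by apply: cvgD; [apply: cvgZl_tmp; exact: cvg_id|exact: cvg_cst].
have := @is_derive_affine (partial s f) a (k * a ^+ size s) c p (dir R b) a0 ((sf s).2 b _).
by move=> [].
Qed.

Lemma smooth_axis_derivable f s : smooth f -> axis_derivable (partial s f).
Proof. by move=> sf b p; exact: (sf s).2. Qed.

(** The inequality is strict so that lower derivatives vanish in a neighbourhood of [p], which makes
    the difference quotients vanish for small steps. *)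
Lemma partial_off_ball (phi : R * R -> R) s p : mollifier phi -> 1 < enorm p -> partial s phi p = 0.
Proof.
move=> [_ _ h _]; elim: s p => [|b s IH] p p1; first by apply: h; exact: ltW.
rewrite /= -/(partial s phi) /derive.
have e0 : (fun t : R => t^-1 *: (partial s phi (t *: dir R b + p) - partial s phi p)) @ 0^' --> (0 : R).
  apply: (@cvg_trans _ ((fun=> 0 : R) @ 0^')); last exact: cvg_cst.
  apply: near_eq_cvg; near=> t.
  rewrite !IH// ?subrr ?scaler0//.
  have : `|t| < enorm p - 1.
    near: t; apply: (@dnbhs0_lt _ _ (enorm p - 1)); by rewrite subr_gt0.
  have := ler_enormD (t *: dir R b + p) (- (t *: dir R b)).
  rewrite addrAC subrr add0r enormN enormZ (_ : enorm (dir R b) = 1) ?mulr1; first by lra.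
  by rewrite /enorm; case: b => /=; rewrite ?expr0n/= ?expr1n ?addr0 ?add0r sqrtr1.
exact: (cvg_lim _ e0).
Unshelve. all: by end_near.
Qed.

End Calculus.

(** * Integrals and convolutions *)

Section MollifierBounds.
Variable R : realType.
Variable phi : R * R -> R.
Hypothesis mphi : mollifier phi.

Lemma partial_bounded s : exists M : R, forall p, `|partial s phi p| <= M.
Proof.
have sphi : smooth phi by case: mphi.
pose K : set (R * R) := `[-1, 1]%classic `*` `[-1, 1]%classic.
have cK : compact (partial s phi @` K).
  apply: continuous_compact; last by apply: compact_setX; exact: segment_compact.
  by apply: continuous_subspaceT; exact: (sphi s).1.
have /pinfty_ex_gt0[M M0 h] := compact_bounded cK; exists M => p.
have [p1|p1] := leP (enorm p) 1; last by rewrite partial_off_ball// normr0 ltW.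
apply: h; exists p => //; have := norm_fst_le p; have := norm_snd_le p.
rewrite /K/= !in_itv/= => h1 h2; rewrite -!ler_norml; split; exact: le_trans p1.
Qed.

(** [norm_D] is a [sup], which dominates its entries only once the array of derivatives is known to
    be bounded; compactness of the support provides this. *)
Lemma partial_le_norm_D (k : nat) (s : seq bool) p :
  size s = k -> `|partial s phi p| <= norm_D k phi.
Proof.
move=> sk; pose S (q : R * R) : R := Num.sqrt (\sum_(s : k.-tuple bool) partial s phi q ^+ 2).
have pS (t : k.-tuple bool) q : `|partial t phi q| <= S q.
  rewrite -sqrtr_sqr ler_sqrt ?sumr_ge0// => [|i _]; last exact: sqr_ge0.
  by rewrite (bigD1 t)//= lerDl sumr_ge0// => i _; exact: sqr_ge0.
have [M hM] : exists M : k.-tuple bool -> R, forall (t : k.-tuple bool) q, `|partial t phi q| <= M t.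
  have /choice[M hM] := fun t : k.-tuple bool => partial_bounded t.
  by exists M.
have ub : has_ubound (range S).
  exists (Num.sqrt (\sum_(s : k.-tuple bool) M s ^+ 2)) => _ [q _ <-].
  rewrite ler_sqrt ?sumr_ge0// => [|i _]; last exact: sqr_ge0.
  apply: ler_sum => t _; rewrite -real_normK ?num_real//.
  by rewrite ler_pXn2r ?nnegrE// (le_trans _ (hM t q)).
have sk' : size s == k by apply/eqP.
apply: le_trans (pS (Tuple sk') p) _; apply: ub_le_sup => //; by exists p.
Qed.

End MollifierBounds.

Section Integrals.
Variable R : realType.
Local Notation mu := (@leb2 R).
Implicit Types (D B N : set (plane R)) (f g : plane R -> measurableTypeR R).

Lemma integrable_bounded D f (M : R) : measurable D -> (mu D < +oo)%E ->
  measurable_fun D f -> (forall q, D q -> `|f q| <= M) -> mu.-integrable D (EFin \o f).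
Proof.
move=> mD Doo mf fM; apply: measurable_bounded_integrable => //.
exists M; split; first exact: num_real.
by move=> y My q Dq; exact: le_trans (fM q Dq) (ltW My).
Qed.

(** [B] stands for a square that carries the integrand, and [N] for the drawing, whose points belong
    to no face. *)
Lemma Rintegral_bound D B N f (E : R) : measurable D -> (mu D < +oo)%E ->
  measurable B -> (mu B < +oo)%E -> measurable N -> mu N = 0%E ->
  mu.-integrable D (EFin \o f) -> 0 <= E ->
  (forall q, D q -> ~ N q -> `|f q| <= E * \1_B q) ->
  `|Rintegral mu D f| <= E * fine (mu B).
Proof.
move=> mD Doo mB Boo mN N0 fi E0 fE.
have mDN : measurable (D `\` N) by exact: measurableD.
have DNoo : (mu (D `\` N) < +oo)%E.
  by apply: le_lt_trans Doo; apply: le_measure; rewrite ?inE// => q [].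
have -> : Rintegral mu D f = Rintegral mu (D `\` N) f.
  by rewrite /Rintegral (negligible_integral mN mD fi N0).
have fi' : mu.-integrable (D `\` N) (EFin \o f) by apply: integrableS fi => // q [].
apply: le_trans (le_normr_Rintegral mDN fi') _.
have bi : mu.-integrable (D `\` N) (EFin \o (fun q => E * \1_B q)).
  apply: (@integrable_bounded _ _ E) => //.
    by apply: measurable_funM => //; exact: measurable_indic.
  move=> q _; rewrite normrM (ger0_norm E0) indicE; case: (q \in B) => /=.
    by rewrite normr1 mulr1.
  by rewrite normr0 mulr0.
apply: le_trans (le_Rintegral mDN _ bi _) _.
- exact: integrable_norm fi'.
- by move=> q [Dq Nq]; exact: fE.
rewrite /Rintegral.
have -> : (\int[mu]_(x in D `\` N) (E * \1_B x)%:E = E%:E * mu (B `&` (D `\` N)))%E.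
  under eq_integral do rewrite EFinM.
  rewrite ge0_integralZl//; first by rewrite integral_indic.
  by apply/measurable_EFinP; exact: measurable_indic.
have Bi : (mu (B `&` (D `\` N)) <= mu B)%E.
  by apply: le_measure; rewrite ?inE//; exact: measurableI.
have Bf : mu (B `&` (D `\` N)) \is a fin_num.
  by rewrite ge0_fin_numE//; exact: le_lt_trans Bi Boo.
rewrite fineM// ler_wpM2l// fine_le// ge0_fin_numE//.
Qed.

Lemma Rintegral_sum_indic D (I : Type) (r : seq I) (P : pred I) (c : I -> R)
    (F : I -> set (plane R)) : measurable D -> (mu D < +oo)%E ->
  (forall i, P i -> measurable (F i)) -> (forall i, P i -> F i `<=` D) ->
  mu.-integrable D (EFin \o (fun q => \sum_(i <- r | P i) c i * \1_(F i) q)) /\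
  Rintegral mu D (fun q => \sum_(i <- r | P i) c i * \1_(F i) q) =
    \sum_(i <- r | P i) c i * fine (mu (F i)).
Proof.
move=> mD Doo mF FD.
have Fi i : P i -> mu.-integrable D (EFin \o (\1_(F i) : plane R -> R)).
  move=> Pi; apply: (@integrable_bounded _ _ 1) => //; first by apply: measurable_indic; exact: mF.
  by move=> q _; rewrite indicE; case: (q \in _); rewrite ?normr1 ?normr0.
elim: r => [|i r [IH1 IH2]].
  under [X in Rintegral _ _ X]eq_fun do rewrite big_nil.
  under [X in _ \o X]eq_fun do rewrite big_nil.
  rewrite big_nil Rintegral_cst// mul0r; split => //; exact: integrable0.
rewrite big_cons; case: ifPn => Pi; last first.
  under [X in Rintegral _ _ X]eq_fun do rewrite big_cons (negbTE Pi).
  by under [X in _ \o X]eq_fun do rewrite big_cons (negbTE Pi).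
under [X in Rintegral _ _ X]eq_fun do rewrite big_cons Pi.
under [X in _ \o X]eq_fun do rewrite big_cons Pi.
have ci : mu.-integrable D (EFin \o (fun q => c i * \1_(F i) q)).
  exact: (integrableZl mD (c i) (Fi i Pi)).
split; first exact: (integrableD mD ci IH1).
rewrite RintegralD// IH2 RintegralZl//; last exact: Fi.
congr (_ * _ + _); rewrite /Rintegral integral_indic//; last exact: mF.
by rewrite (setIidl (FD i Pi)).
Qed.

End Integrals.

Section DerivativeUnderIntegral.
Variable R : realType.
Local Notation mu := (@leb2 R).
Variables (D : set (plane R)) (H : R * R -> R) (K : R).
Hypothesis mD : measurable D.
Hypothesis Doo : (mu D < +oo)%E.
Hypothesis mH : measurable_fun D (H : plane R -> measurableTypeR R).
Hypothesis HK : forall q, D q -> `|H q| <= K.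

Lemma measurable_kernel (g : R * R -> R) (p : R * R) : continuous g ->
  measurable_fun D (fun q : plane R => g (p - q) * H q : measurableTypeR R).
Proof.
move=> cg; apply: measurable_funM => //.
apply: (@measurable_funS _ _ _ _ setT) => //.
apply: (@continuous_measurable_plane _ (fun q => g (p - q))) => q.
apply: (@cvg_comp _ _ _ (fun q : R * R => p - q) g _ (nbhs (p - q))); last exact: cg.
by apply: cvgB; [exact: cvg_cst|exact: cvg_id].
Qed.

Lemma integrable_kernel (g : R * R -> R) (B : R) (p : R * R) : continuous g ->
  (forall q, `|g q| <= B) -> mu.-integrable D (EFin \o (fun q : plane R => g (p - q) * H q)).
Proof.
move=> cg gB; apply: (@integrable_bounded _ _ _ (B * K)) => //; first exact: measurable_kernel.
by move=> q Dq; rewrite normrM ler_pM//; exact: HK.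
Qed.

(** The bound on second derivatives makes the difference quotients of [g] converge uniformly, with
    error of order [|h|]; as [D] has finite measure, the integrals converge at the same rate. *)
Lemma is_derive_convolution (g : R * R -> R) (b : bool) (B0 B1 B2 : R) (p : R * R) :
  smooth g -> (forall q, `|g q| <= B0) -> (forall q, `|'D_(dir R b) g q| <= B1) ->
  (forall c q, `|'D_(dir R c) ('D_(dir R b) g) q| <= B2) ->
  is_derive p (dir R b) (convolution_on D g H) (convolution_on D ('D_(dir R b) g) H p).
Proof.
move=> sg gB0 gB1 gB2; set v := dir R b; set g' := 'D_v g.
have cg : continuous g := (sg [::]).1.
have cg' : continuous g' := (sg [:: b]).1.
have dg : axis_derivable g := smooth_axis_derivable (s := [::]) sg.
have dg' : axis_derivable g' := smooth_axis_derivable (s := [:: b]) sg.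
have B20 : 0 <= B2 by apply: le_trans (gB2 true 0); rewrite normr_ge0.
pose C := B2 * `|K| * fine (mu D).
have C0 : 0 <= C by rewrite !mulr_ge0// fine_ge0.
have est (h : R) : h != 0 -> `|convolution_on D g' H p -
    h^-1 *: (convolution_on D g H (h *: v + p) - convolution_on D g H p)| <= C * `|h|.
  move=> h0; rewrite /convolution_on.
  have i1 := integrable_kernel (h *: v + p) cg gB0.
  have i2 := integrable_kernel p cg gB0.
  have i3 := integrable_kernel p cg' gB1.
  have -> : h^-1 *: (Rintegral mu D (fun q => g (h *: v + p - q) * H q) -
      Rintegral mu D (fun q => g (p - q) * H q)) =
      Rintegral mu D (fun q => h^-1 * (g (h *: v + p - q) * H q - g (p - q) * H q)).
    rewrite RintegralZl//; last exact: (integrableB mD i1 i2).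
    by rewrite RintegralB.
  have i4 : mu.-integrable D (EFin \o (fun q : plane R => h^-1 * (g (h *: v + p - q) * H q - g (p - q) * H q))).
    exact: (integrableZl mD h^-1 (integrableB mD i1 i2)).
  rewrite -RintegralB//.
  have P q : D q -> `|g' (p - q) * H q - h^-1 * (g (h *: v + p - q) * H q - g (p - q) * H q)|
      <= B2 * `|K| * `|h|.
    move=> Dq; have [s sh e] := mvt_axis (p - q) h (dg b).
    have -> : h *: v + p - q = p - q + h *: v by apply: planeP; rewrite !coordE; ring.
    have {}e : g (p - q + h *: v) = g (p - q) + h * g' (p - q + s *: v) by move/eqP: e; rewrite subr_eq => /eqP ->; exact: addrC.
    have -> : g' (p - q) * H q - h^-1 * (g (p - q + h *: v) * H q - g (p - q) * H q) =
        (g' (p - q) - g' (p - q + s *: v)) * H q.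
      by rewrite e; field.
    rewrite normrM -mulrA (mulrC `|K|) mulrA ler_pM//.
      rewrite distrC; apply: le_trans (lipschitz_axes _ _ dg' gB2) _.
      by rewrite norm1Z norm1_dir mulr1 ler_wpM2l.
    exact: le_trans (HK Dq) (ler_norm K).
  apply: (@le_trans _ _ (B2 * `|K| * `|h| * fine (mu D))); last by rewrite /C -!mulrA (mulrC `|h|).
  apply: (Rintegral_bound (N := set0)) => //.
  - exact: (integrableB mD i3 i4).
  - by rewrite !mulr_ge0.
  - by move=> q Dq _; rewrite indicE mem_set// mulr1; exact: P.
have L : (fun h : R => h^-1 *: (convolution_on D g H (h *: v + p) - convolution_on D g H p)) @ 0^'
   --> convolution_on D g' H p.
  have C1 : 0 < 1 + C by rewrite ltr_pwDl.
  apply/cvgrPdist_lt => e e0; have eC : 0 < e / (1 + C) by rewrite divr_gt0.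
  near=> h.
  have h0 : h != 0 by near: h; exact: nbhs_dnbhs_neq.
  apply: le_lt_trans (est h h0) _.
  have : `|h| < e / (1 + C).
    by near: h; apply: (@dnbhs0_lt _ _ (e / (1 + C))).
  rewrite ltr_pdivlMr// mulrC; apply: le_lt_trans; rewrite ler_wpM2r//.
  lra.
apply: DeriveDef; first by apply/cvg_ex; exists (convolution_on D g' H p).
by apply: cvg_lim.
Unshelve. all: by end_near.
Qed.

End DerivativeUnderIntegral.

Lemma eq_lerW (R : realType) (a b : R) : a = b -> a <= b.
Proof. by move=> ->. Qed.

Lemma laplacianE (R : realType) (f : R * R -> R) q : laplacian f q =
  'D_(dir R false) ('D_(dir R false) f) q + 'D_(dir R true) ('D_(dir R true) f) q.
Proof. by []. Qed.

(** * The discrete estimate *)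

Section DiscreteEstimate.
Variables (R : realType) (G : bigraph R).
Hypothesis oG : orthodiagonal_map G.
Notation V := (primal G).
Notation W := (dual G).
Notation T4 := ((V * W) * (V * W))%type.
Implicit Types (x y : V) (w v : W) (p q r : R * R) (t : T4).

Lemma sum_opposite (F : T4 -> R) :
  \sum_(t | ccw_quad t) F t = \sum_(t | ccw_quad t) F (opposite t).
Proof.
rewrite (reindex_inj (inv_inj (@oppositeK R G)))/=.
by apply: eq_bigl => t; rewrite ccw_quad_opposite.
Qed.

(** Averaging over [t] and [opposite t] replaces [k] by its difference between two primal vertices,
    which a Lipschitz bound turns into a factor [primal_len]. *)
Lemma sum_antisym (k : V -> R) (F : T4 -> R) : (forall t, ccw_quad t -> F (opposite t) = - F t) ->
  \sum_(t | ccw_quad t) k t.1.1 * F t =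
  2^-1 * \sum_(t | ccw_quad t) (k t.1.1 - k t.2.1) * F t.
Proof.
move=> hF; set A := LHS; have -> : A = 2^-1 * (A + A) by field.
congr (_ * _); rewrite {2}/A sum_opposite /A -big_split/=; apply: eq_bigr => t tq.
by rewrite hF//; ring.
Qed.

Definition primal_len t : R := enorm (ppos t.2.1 - ppos t.1.1).
Definition dual_len t : R := enorm (dpos t.2.2 - dpos t.1.2).
Definition quad_weight t : R := dual_len t / primal_len t.

Lemma quad_crossE t : ccw_quad t -> quad_cross t = primal_len t * dual_len t.
Proof.
move=> tq; have [_ _ D] := ccw_quadP oG tq.
exact: orthogonal_cross (ccw_quad_orthogonal oG tq) (ltW D).
Qed.

Lemma primal_len_gt0 t : ccw_quad t -> 0 < primal_len t.
Proof.
move=> tq; have [_ _ D] := ccw_quadP oG tq; rewrite quad_crossE// in D.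
by rewrite lt_neqAle enorm_ge0 andbT; apply: contraTneq D => <-; rewrite mul0r ltxx.
Qed.

Lemma quad_weight_ge0 t : 0 <= quad_weight t.
Proof. by rewrite divr_ge0// enorm_ge0. Qed.

Lemma quad_weightM t : ccw_quad t -> quad_weight t * primal_len t = dual_len t.
Proof. by move=> /primal_len_gt0 h; rewrite divfK// gt_eqF. Qed.

Lemma quad_rot t : ccw_quad t ->
  dpos t.2.2 - dpos t.1.2 = quad_weight t *: rot90 (ppos t.2.1 - ppos t.1.1).
Proof.
move=> tq; have [_ _ D] := ccw_quadP oG tq.
exact: orthogonal_rot90 (ccw_quad_orthogonal oG tq) D.
Qed.

Lemma primal_len_opposite t : primal_len (opposite t) = primal_len t.
Proof. by rewrite /primal_len -enormN opprB. Qed.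

Lemma dual_len_opposite t : dual_len (opposite t) = dual_len t.
Proof. by rewrite /dual_len -enormN opprB. Qed.

Lemma quad_weight_opposite t : quad_weight (opposite t) = quad_weight t.
Proof. by rewrite /quad_weight primal_len_opposite dual_len_opposite. Qed.

Lemma dlaplacianE (k : V -> R) x : dlaplacian k x =
  \sum_(t | ccw_quad t && (t.1.1 == x)) quad_weight t * (k t.2.1 - k t.1.1).
Proof.
rewrite (eq_bigl (fun t => true && (ccw_quad t && (t.1.1 == x))))//.
rewrite -(pair_big_dep xpredT (fun e1 e2 : V * W => ccw_quad (e1, e2) && (e1.1 == x))
  (fun e1 e2 => quad_weight (e1, e2) * (k e2.1 - k e1.1)))/=.
rewrite -(pair_bigA _ (fun (x' : V) (w : W) => \sum_(j | ccw_quad ((x', w), j) && (x' == x))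
  quad_weight (x', w, j) * (k j.1 - k x')))/=.
rewrite (bigD1 x)//= [X in _ = _ + X]big1 ?addr0; last first.
  by move=> x' /negbTE xx'; apply: big1 => w _; apply: big1 => j; rewrite xx' andbF.
pose D (y : V) (w v : W) : R := if ccw_quad ((x, w), (y, v))
  then quad_weight ((x, w), (y, v)) * (k y - k x) else 0.
have -> : dlaplacian k x = \sum_(y : V) \sum_(w : W) \sum_(v : W) D y w v.
  apply: eq_bigr => y _; rewrite (conductanceE oG) mulr_suml; apply: eq_bigr => w _.
  rewrite mulr_suml; apply: eq_bigr => v _; rewrite /D; case: ifP => _; last by rewrite mul0r.
  by congr (_ * _); rewrite edistC [in X in _ / X]edistC.
rewrite exchange_big/=; apply: eq_bigr => w _.
rewrite (eq_bigl (fun j : V * W => ccw_quad ((x, w), j))); last by move=> j; rewrite eqxx andbT.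
by rewrite [RHS]big_mkcond/= (pair_bigA _ (fun y v => D y w v)); apply: eq_bigr => -[y v] _.
Qed.

(* Summation by parts. *)
Lemma sum_weight_harmonic (h f : V -> R) : harmonic h -> (forall x, bdryV x -> f x = 0) ->
  \sum_(t | ccw_quad t) h t.1.1 * (quad_weight t * (f t.2.1 - f t.1.1)) = 0.
Proof.
move=> hh f0.
have -> : \sum_(t | ccw_quad t) h t.1.1 * (quad_weight t * (f t.2.1 - f t.1.1)) =
    \sum_(t | ccw_quad t) f t.1.1 * (quad_weight t * (h t.2.1 - h t.1.1)).
  have e (a b : V -> R) : \sum_(t | ccw_quad t) a t.1.1 * (quad_weight t * (b t.2.1 - b t.1.1)) =
      \sum_(t | ccw_quad t) a t.1.1 * (quad_weight t * b t.2.1) -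
      \sum_(t | ccw_quad t) quad_weight t * (a t.1.1 * b t.1.1).
    by rewrite -sumrB; apply: eq_bigr => t _; ring.
  rewrite !e; congr (_ - _); last by apply: eq_bigr => t _; ring.
  by rewrite sum_opposite; apply: eq_bigr => t _; rewrite quad_weight_opposite/=; ring.
rewrite (partition_big (fun t : T4 => t.1.1) xpredT)//= big1// => x _.
rewrite (eq_bigr (fun t => f x * (quad_weight t * (h t.2.1 - h t.1.1)))); last first.
  by move=> t /andP[_ /eqP->].
rewrite -mulr_sumr -dlaplacianE.
by have [b|b] := pselect (bdryV x); [rewrite f0// mul0r|rewrite hh// mulr0].
Qed.

Section Estimate.
Variables (f : R * R -> R) (B2 B3 eps delta d : R) (z : R * R).
Hypothesis eps0 : 0 < eps.
Hypothesis ed : 8 * eps <= delta.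
Hypothesis dd : 2 * delta <= d.
Hypothesis le_eps : edges_le G eps.
Hypothesis Gz : forall q, edist z q < d -> Ghat G q.
Hypothesis d1 : axis_derivable f.
Hypothesis d2 : forall b, axis_derivable ('D_(dir R b) f).
Hypothesis d3 : forall b c, axis_derivable ('D_(dir R c) ('D_(dir R b) f)).
Hypothesis hB2 : forall b c q, `|'D_(dir R c) ('D_(dir R b) f) q| <= B2.
Hypothesis hB3 : forall a b c q, `|'D_(dir R c) ('D_(dir R b) ('D_(dir R a) f)) q| <= B3.
Hypothesis f0 : forall q, delta < edist z q -> f q = 0.
Hypothesis df0 : forall b q, delta < edist z q -> 'D_(dir R b) f q = 0.
Hypothesis ddf0 : forall b q, delta < edist z q -> 'D_(dir R b) ('D_(dir R b) f) q = 0.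

(** Since [8 * eps <= delta], points within [2 * eps] of a vertex that is not [near] are outside the
    disc of radius [delta] carrying [f], while a face listed from a [near] vertex stays within
    [7 / 4 * delta] of [z]. *)
Definition near x : bool := edist z (ppos x) <= 3 / 2 * delta.

Let delta0 : 0 < delta. Proof. by apply: lt_le_trans ed; rewrite mulr_gt0. Qed.
Let B20 : 0 <= B2. Proof. by apply: le_trans (@hB2 true true 0); rewrite normr_ge0. Qed.
Let B30 : 0 <= B3. Proof. by apply: le_trans (@hB3 true true true 0); rewrite normr_ge0. Qed.

Lemma quad_edges t : ccw_quad t ->
  [/\ edist (ppos t.1.1) (dpos t.1.2) <= eps, edist (ppos t.2.1) (dpos t.1.2) <= eps,
      edist (ppos t.2.1) (dpos t.2.2) <= eps & edist (ppos t.1.1) (dpos t.2.2) <= eps].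
Proof. by move=> /(ccw_quad_edge oG)[e1 e2 e3 e4]; split; exact: le_eps. Qed.

Lemma primal_len_le t : ccw_quad t -> primal_len t <= 2 * eps.
Proof.
move=> /quad_edges[e1 e2 _ _]; apply: le_trans (edist_triangle (dpos t.1.2) _ _) _.
by rewrite (edistC (dpos _)); have := eps0; lra.
Qed.

Lemma dual_len_le t : ccw_quad t -> dual_len t <= 2 * eps.
Proof.
move=> /quad_edges[e1 _ _ e4]; apply: le_trans (edist_triangle (ppos t.1.1) _ _) _.
by rewrite edistC; have := eps0; lra.
Qed.

Lemma edist_midpoint p q r (k : R) : edist r p <= k -> edist r q <= k -> edist r (midpoint p q) <= k.
Proof.
move=> h1 h2; have -> : edist r (midpoint p q) = enorm (2^-1 *: (r - p) + 2^-1 *: (r - q)).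
  by rewrite /edist; congr enorm; apply: planeP; rewrite /midpoint !coordE; field.
apply: (le_trans (ler_enormD _ _)); rewrite !enormZ !ger0_norm ?invr_ge0//.
by rewrite -/(edist r p) -/(edist r q); lra.
Qed.

Lemma far_point t q : ~~ near t.1.1 -> edist (ppos t.1.1) q <= 2 * eps -> delta < edist z q.
Proof.
rewrite /near -ltNge => h; rewrite edistC => hq.
have tr := edist_triangle q z (ppos t.1.1).
have := delta0; have := ed.
move: (edist _ _) (edist _ _) (edist _ _) h hq tr => e1 e2 e3 h hq tr.
lra.
Qed.

Lemma flux_far p q : delta < edist z (midpoint p q) -> flux f p q = 0.
Proof. by move=> h; rewrite /flux !df0// !mul0r subr0. Qed.

Lemma quad_near t : ccw_quad t ->
  [/\ edist (ppos t.1.1) (ppos t.2.1) <= 2 * eps, edist (ppos t.1.1) (dpos t.1.2) <= 2 * eps &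
      edist (ppos t.1.1) (dpos t.2.2) <= 2 * eps].
Proof.
move=> tq; have [e1 e2 e3 e4] := quad_edges tq; have := primal_len_le tq.
by have := eps0; rewrite /primal_len -/(edist _ _) edistC => e0' h; split => //; lra.
Qed.

Lemma near_midpoint x w : edge x w -> near x -> Ghat G (midpoint (ppos x) (dpos w)).
Proof.
move=> /le_eps e nx; apply: Gz; move: nx; rewrite /near => nx.
have h : edist (ppos x) (midpoint (ppos x) (dpos w)) <= eps.
  by apply: edist_midpoint => //; rewrite edistpp ltW.
have := edist_triangle (ppos x) z (midpoint (ppos x) (dpos w)); have := (eps0, ed, dd) => -[[e0' ed'] dd']; lra.
Qed.

Definition increment t : R := quad_weight t * (f (ppos t.2.1) - f (ppos t.1.1)).
Definition dual_flux t : R := flux f (dpos t.1.2) (dpos t.2.2).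
(** Flux around the triangle formed by the vertex [t.1.1] and the dual diagonal. In
    [corner t + corner (opposite t)] the flux through the diagonal cancels. *)
Definition corner t : R := flux f (ppos t.1.1) (dpos t.1.2) + dual_flux t +
  flux f (dpos t.2.2) (ppos t.1.1).
Definition near_area : R := \sum_(t | ccw_quad t && near t.1.1) quad_cross t.

Lemma increment_far t : ccw_quad t -> ~~ near t.1.1 -> increment t = 0.
Proof.
move=> tq n; have [h1 h2 h3] := quad_near tq; rewrite /increment !f0 ?subrr ?mulr0//.
  by apply: far_point n _; rewrite edistpp mulr_ge0// ltW.
exact: far_point n _.
Qed.

Lemma quad_flux_far t : ccw_quad t -> ~~ near t.1.1 ->
  [/\ dual_flux t = 0, corner t = 0 & corner (opposite t) = 0].
Proof.
move=> tq n; have [h1 h2 h3] := quad_near tq.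
have h0 : edist (ppos t.1.1) (ppos t.1.1) <= 2 * eps by rewrite edistpp mulr_ge0// ltW.
have F p q : edist (ppos t.1.1) p <= 2 * eps -> edist (ppos t.1.1) q <= 2 * eps -> flux f p q = 0.
  by move=> hp hq; apply/flux_far/(far_point n)/edist_midpoint.
by rewrite /corner /dual_flux/= !F// !addr0.
Qed.

Lemma sum_near_bound (F : T4 -> R) (C : R) :
  (forall t, ccw_quad t -> ~~ near t.1.1 -> F t = 0) ->
  (forall t, ccw_quad t -> near t.1.1 -> `|F t| <= C * quad_cross t) ->
  `|\sum_(t | ccw_quad t) F t| <= C * near_area.
Proof.
move=> h1 h2; rewrite (bigID (fun t : T4 => near t.1.1))/= [X in _ + X]big1 ?addr0; last first.
  by move=> t /andP[tq n]; exact: h1.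
apply: le_trans (ler_norm_sum _ _ _) _; rewrite /near_area mulr_sumr.
by apply: ler_sum => t /andP[tq n]; exact: h2.
Qed.

(** Here [m] is only bounded. Linear functions are discrete harmonic, so the linear part of [f] at
    each vertex can be removed; the remainder is of order [primal_len t ^+ 2], which the weight
    turns into the product of the diagonals. *)
Lemma increment_estimate (m : V -> R) (om : R) : 0 <= om ->
  (forall x, near x -> `|m x| <= om) ->
  `|\sum_(t | ccw_quad t) m t.1.1 * increment t| <= 4 * om * B2 * near_area.
Proof.
move=> om0 hm; pose m' x := if near x then m x else 0.
(* By [quad_rot], the difference of [N] along the dual diagonal is [m' x] times the weighted linear
   part of the increment, and [sum_edge_cancel] makes these differences add up to zero. The cutoff
   in [m'] confines [N] to vertices whose edges have midpoints in [Ghat]. *)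
pose N x w := m' x * ('D_(dir R false) f (ppos x) * (dpos w).2 - 'D_(dir R true) f (ppos x) * (dpos w).1).
have -> : \sum_(t | ccw_quad t) m t.1.1 * increment t =
    \sum_(t | ccw_quad t) (m' t.1.1 * increment t - (N t.1.1 t.2.2 - N t.1.1 t.1.2)).
  rewrite sumrB sumrB (sum_edge_cancel oG (N := N)) ?subrr ?subr0; last first.
    move=> x w e; rewrite /N /m'; case: ifP => [nx _|_]; last by rewrite mul0r eqxx.
    exact: near_midpoint.
  apply: eq_bigr => t tq; rewrite /m'; case: ifPn => // n.
  by rewrite increment_far// !mulr0.
apply: sum_near_bound => t tq n; rewrite /N /m'; first by rewrite (negbTE n) !mul0r !subr0.
rewrite n.
have e := quad_rot tq.
have e1 : (dpos t.2.2).1 - (dpos t.1.2).1 = - (quad_weight t * ((ppos t.2.1).2 - (ppos t.1.1).2)).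
  by move: (congr1 fst e); rewrite !coordE /rot90/= ?coordE; lra.
have e2 : (dpos t.2.2).2 - (dpos t.1.2).2 = quad_weight t * ((ppos t.2.1).1 - (ppos t.1.1).1).
  by move: (congr1 snd e); rewrite !coordE /rot90/= ?coordE; lra.
have T := taylor_axes (ppos t.1.1) (ppos t.1.1) (ppos t.2.1 - ppos t.1.1) d1 d2 hB2.
rewrite (addrC (ppos t.1.1)) subrK subrr in T.
have {}T : `|f (ppos t.2.1) - f (ppos t.1.1) -
    grad_dot f (ppos t.1.1) (ppos t.2.1 - ppos t.1.1)| <= 4 * B2 * primal_len t ^+ 2.
  apply: le_trans T _; rewrite (_ : norm1 0 = 0) ?add0r; last by rewrite /norm1/= normr0 addr0.
  have := norm1_enorm (ppos t.2.1 - ppos t.1.1); have := norm1_ge0 (ppos t.2.1 - ppos t.1.1).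
  rewrite -/(primal_len t); move: (norm1 _) => n1 n10 n1l.
  rewrite -mulrA (_ : 4 * B2 * _ = B2 * ((2 * primal_len t) * (2 * primal_len t))); last by ring.
  by rewrite ler_wpM2l// ler_pM.
rewrite (_ : _ - _ = m t.1.1 * (quad_weight t * (f (ppos t.2.1) - f (ppos t.1.1) -
    grad_dot f (ppos t.1.1) (ppos t.2.1 - ppos t.1.1)))); last first.
  rewrite /increment /grad_dot !coordE.
  transitivity (m t.1.1 * (quad_weight t * (f (ppos t.2.1) - f (ppos t.1.1)) -
     ('D_(dir R false) f (ppos t.1.1) * ((dpos t.2.2).2 - (dpos t.1.2).2) -
      'D_(dir R true) f (ppos t.1.1) * ((dpos t.2.2).1 - (dpos t.1.2).1)))); first by ring.
  by rewrite e1 e2; ring.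
rewrite normrM [`|quad_weight t * _|]normrM (ger0_norm (quad_weight_ge0 t)) quad_crossE//.
apply: (@le_trans _ _ (om * (quad_weight t * (4 * B2 * primal_len t ^+ 2)))).
  apply: ler_pM => //; [by rewrite mulr_ge0// quad_weight_ge0|exact: hm|].
  by rewrite ler_wpM2l// quad_weight_ge0.
by rewrite -(quad_weightM tq); apply: eq_lerW; ring.
Qed.

Lemma norm1_le (p : R * R) (k : R) : enorm p <= k -> norm1 p <= 2 * k.
Proof. by have := norm1_enorm p; lra. Qed.

Lemma increment_flux t : ccw_quad t ->
  `|increment t - dual_flux t| <= 12 * eps * B2 * dual_len t.
Proof.
move=> tq; have [h1 h2 h3] := quad_near tq; have [e1 e2 e3 e4] := quad_edges tq.
apply: le_trans (flux_increment d1 d2 hB2 (quad_weight_ge0 t) (quad_rot tq)) _.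
have n1 : norm1 (ppos t.1.1 - midpoint (dpos t.1.2) (dpos t.2.2)) <= 2 * eps.
  by apply: norm1_le; apply: edist_midpoint.
have n2 : norm1 (ppos t.2.1 - ppos t.1.1) <= 2 * primal_len t by exact: norm1_enorm.
have n3 := primal_len_le tq.
have := norm1_ge0 (ppos t.2.1 - ppos t.1.1).
have := norm1_ge0 (ppos t.1.1 - midpoint (dpos t.1.2) (dpos t.2.2)).
move: (norm1 _) (norm1 _) n1 n2 => a b n1 n2 a0 b0.
rewrite -(quad_weightM tq).
have -> : 12 * eps * B2 * (quad_weight t * primal_len t) =
    quad_weight t * (B2 * (6 * eps) * (2 * primal_len t)) by ring.
apply: ler_wpM2l; first exact: quad_weight_ge0.
apply: ler_pM => //; first by rewrite mulr_ge0// addr_ge0.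
apply: ler_wpM2l => //; lra.
Qed.

Lemma corner_estimate t : ccw_quad t -> `|corner t| <= 4 * eps * B2 * dual_len t.
Proof.
move=> tq; have [e1 e2 e3 e4] := quad_edges tq.
apply: le_trans (flux_triangle d2 hB2 (ppos t.1.1) (dpos t.1.2) (dpos t.2.2)) _.
have n1 : norm1 (dpos t.1.2 - ppos t.1.1) <= 2 * eps by apply: norm1_le; rewrite -enormN opprB.
have n2 : norm1 (dpos t.2.2 - dpos t.1.2) <= 2 * dual_len t by exact: norm1_enorm.
have -> : 4 * eps * B2 * dual_len t = B2 * (2 * eps) * (2 * dual_len t) by ring.
by apply: ler_pM => //; rewrite ?mulr_ge0 ?norm1_ge0//; apply: ler_wpM2l.
Qed.

(** Once the two dual fluxes cancel, the flux through the four sides remains, and [flux_quad]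
    compares it with the area [2^-1 * quad_cross t] times the Laplacian. *)
Lemma corner_sum t : ccw_quad t ->
  `|corner t + corner (opposite t) - 2^-1 * quad_cross t * laplacian f (ppos t.1.1)| <=
    64 * eps * B3 * quad_cross t.
Proof.
move=> tq; have [e1 e2 e3 e4] := quad_edges tq.
have n1 : norm1 (dpos t.1.2 - ppos t.1.1) <= 4 * eps.
  by have := eps0; have : norm1 (dpos t.1.2 - ppos t.1.1) <= 2 * eps; [apply: norm1_le; rewrite -enormN opprB|lra].
have n2 : norm1 (dpos t.2.2 - dpos t.1.2) <= 2 * dual_len t by exact: norm1_enorm.
have n3 : norm1 (ppos t.2.1 - ppos t.1.1) <= 2 * primal_len t by exact: norm1_enorm.
have n4 := primal_len_le tq; have n5 := dual_len_le tq.
have n6 : norm1 (dpos t.2.2 - dpos t.1.2) <= 4 * eps by lra.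
have n7 : norm1 (ppos t.2.1 - ppos t.1.1) <= 4 * eps by lra.
have -> : corner t + corner (opposite t) =
    flux f (ppos t.1.1) (dpos t.1.2) - flux f (ppos t.1.1) (dpos t.2.2) -
    flux f (ppos t.2.1) (dpos t.1.2) + flux f (ppos t.2.1) (dpos t.2.2).
  rewrite /corner /dual_flux/= (fluxC f (dpos t.1.2) (dpos t.2.2)).
  by rewrite (fluxC f (ppos t.1.1) (dpos t.2.2)) (fluxC f (ppos t.2.1) (dpos t.1.2)); ring.
apply: le_trans (flux_quad d2 d3 hB3 n1 n7 n6) _.
rewrite quad_crossE//.
have -> : 64 * eps * B3 * (primal_len t * dual_len t) =
   4 * B3 * (4 * eps) * (2 * primal_len t) * (2 * dual_len t) by ring.
have e0' := ltW eps0.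
apply: ler_pM => //; rewrite ?mulr_ge0 ?norm1_ge0//.
by apply: ler_wpM2l; rewrite ?mulr_ge0.
Qed.

Lemma laplacian_far t : ccw_quad t -> ~~ near t.1.1 -> laplacian f (ppos t.1.1) = 0.
Proof.
move=> tq n; rewrite laplacianE !ddf0 ?addr0//.
  by apply: far_point n _; rewrite edistpp mulr_ge0// ltW.
by apply: far_point n _; rewrite edistpp mulr_ge0// ltW.
Qed.

Lemma laplacian_bound q : `|laplacian f q| <= 2 * B2.
Proof.
apply: le_trans (ler_normD _ _) _.
by rewrite mulr_natl mulr2n; apply: lerD; exact: hB2.
Qed.

(* Replacing [h] by a function [k] that is Lipschitz at scale [eps] makes every
   error term proportional to the area of the quadrilateral it comes from. *)
Lemma discrete_estimate (h k : V -> R) (om Hm : R) : 0 <= om -> 0 <= Hm ->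
  harmonic h -> (forall x, bdryV x -> d <= edist z (ppos x)) ->
  (forall x, near x -> `|h x - k x| <= om) -> (forall x, near x -> `|k x| <= Hm) ->
  (forall x y, `|k x - k y| <= om / eps * edist (ppos x) (ppos y)) ->
  `|4^-1 * \sum_(t | ccw_quad t) quad_cross t * laplacian f (ppos t.1.1) * h t.1.1| <=
    (13 * om * B2 + 32 * Hm * eps * B3) * near_area.
Proof.
move=> om0 Hm0 hh bd hk km kl.
pose SA (m : V -> R) := \sum_(t | ccw_quad t) m t.1.1 * increment t.
pose SN := \sum_(t | ccw_quad t) k t.1.1 * dual_flux t.
pose SC := \sum_(t | ccw_quad t) k t.1.1 * corner t.
pose SB := \sum_(t | ccw_quad t) k t.1.1 * (corner t + corner (opposite t)).
pose SL (m : V -> R) := \sum_(t | ccw_quad t) m t.1.1 * (quad_cross t * laplacian f (ppos t.1.1)).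
have dl t : ccw_quad t -> `|k t.1.1 - k t.2.1| <= om / eps * primal_len t.
  by move=> _; rewrite /primal_len -/(edist _ _) edistC; exact: kl.
(* Boundary vertices are at distance at least [d >= 2 * delta] from [z], beyond the support of
   [f]. *)
have h1 : SA h = 0.
  apply: (sum_weight_harmonic (f := fun x => f (ppos x))) => // x bx.
  by apply: f0; have := bd x bx; have := (delta0, dd) => -[? ?]; lra.
have h2 : `|SA (fun x => h x - k x)| <= 4 * om * B2 * near_area by exact: increment_estimate.
have {h1 h2} h2 : `|SA k| <= 4 * om * B2 * near_area.
  have -> : SA k = SA h - SA (fun x => h x - k x).
    by rewrite /SA -sumrB; apply: eq_bigr => t _; ring.
  by rewrite h1 sub0r normrN.
(* Increments and dual fluxes both change sign under [opposite], so their discrepancy is paired with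
   differences of [k], which supply the factor [primal_len] absent from [increment_flux]. *)
have h3 : `|SA k - SN| <= 6 * om * B2 * near_area.
  rewrite /SA /SN !sum_antisym; first last.
  - by move=> t tq; rewrite /increment quad_weight_opposite/=; ring.
  - by move=> t tq; rewrite /dual_flux/= fluxC.
  rewrite -mulrBr -sumrB mulr_sumr; apply: sum_near_bound => t tq n.
    by have [-> _ _] := quad_flux_far tq n; rewrite increment_far// !mulr0 subrr mulr0.
  rewrite -mulrBr normrM normrM ger0_norm ?invr_ge0//.
  apply: (@le_trans _ _ (2^-1 * (om / eps * primal_len t * (12 * eps * B2 * dual_len t)))).
    apply: ler_wpM2l; first by rewrite invr_ge0.
    by apply: ler_pM => //; [exact: dl|exact: increment_flux].
  rewrite quad_crossE//; apply: eq_lerW; field; exact: lt0r_neq0.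
(* The fluxes through sides of faces, added to close up the triangles, cancel in pairs: each edge
   that matters is met once from either side. *)
have h4 : SN = SC.
  pose N x w := k x * flux f (ppos x) (dpos w).
  have : \sum_(t | ccw_quad t) N t.1.1 t.1.2 = \sum_(t | ccw_quad t) N t.1.1 t.2.2.
    apply: (sum_edge_cancel oG) => x w e; rewrite /N => nz; apply: Gz.
    apply: contraNT nz; rewrite -leNgt => hd; rewrite flux_far ?mulr0//.
    by have := (delta0, dd) => -[? ?]; lra.
  move=> hN; rewrite -[SN]addr0 -(subrr (\sum_(t | ccw_quad t) N t.1.1 t.2.2)) -{1}hN.
  rewrite addrA -big_split/= -sumrB; apply: eq_bigr => t _.
  by rewrite /N /corner (fluxC f (ppos t.1.1) (dpos t.2.2)); ring.
(* Weighting both corners of a face by the value of [k] at the same vertex costs one difference of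
   [k]. *)
have h5 : `|SC - 2^-1 * SB| <= 2 * om * B2 * near_area.
  have -> : SC - 2^-1 * SB = \sum_(t | ccw_quad t) 2^-1 * ((k t.2.1 - k t.1.1) * corner (opposite t)).
    have -> : SC = 2^-1 * (SC + SC) by field.
    rewrite -mulrBr {2}/SC sum_opposite /SC -big_split/= /SB -sumrB mulr_sumr.
    by apply: eq_bigr => t _ /=; ring.
  apply: sum_near_bound => t tq n.
    by have [_ _ ->] := quad_flux_far tq n; rewrite !mulr0.
  rewrite normrM ger0_norm ?invr_ge0// normrM distrC.
  apply: (@le_trans _ _ (2^-1 * (om / eps * primal_len t * (4 * eps * B2 * dual_len t)))).
    apply: ler_wpM2l; first by rewrite invr_ge0.
    apply: ler_pM => //; first exact: dl.
    by rewrite -(dual_len_opposite t); apply: corner_estimate; rewrite ccw_quad_opposite.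
  rewrite quad_crossE//; apply: eq_lerW; field; exact: lt0r_neq0.
(* In [4^-1], one half accounts for the double listing of faces and the other for [quad_cross] being
   twice the area. *)
have h6 : `|2^-1 * SB - 4^-1 * SL k| <= 32 * Hm * eps * B3 * near_area.
  have -> : 2^-1 * SB - 4^-1 * SL k = \sum_(t | ccw_quad t) 2^-1 * (k t.1.1 *
      (corner t + corner (opposite t) - 2^-1 * quad_cross t * laplacian f (ppos t.1.1))).
    by rewrite /SB /SL !mulr_sumr -sumrB; apply: eq_bigr => t _; field.
  apply: sum_near_bound => t tq n.
    by have [_ -> ->] := quad_flux_far tq n; rewrite (laplacian_far tq n) addr0 !mulr0 subr0 !mulr0.
  rewrite normrM ger0_norm ?invr_ge0// normrM.
  apply: (@le_trans _ _ (2^-1 * (Hm * (64 * eps * B3 * quad_cross t)))); last by apply: eq_lerW; field.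
  apply: ler_wpM2l; first by rewrite invr_ge0.
  by apply: ler_pM => //; [exact: km|exact: corner_sum].
have h7 : `|4^-1 * SL h - 4^-1 * SL k| <= 2^-1 * om * B2 * near_area.
  rewrite -mulrBr /SL -sumrB mulr_sumr; apply: sum_near_bound => t tq n.
    by rewrite (laplacian_far tq n) !mulr0 subrr mulr0.
  have [_ _ D] := ccw_quadP oG tq.
  rewrite -mulrBl normrM ger0_norm ?invr_ge0// normrM normrM (gtr0_norm D).
  apply: (@le_trans _ _ (4^-1 * (om * (quad_cross t * (2 * B2))))); last by apply: eq_lerW; field.
  apply: ler_wpM2l; first by rewrite invr_ge0.
  apply: ler_pM => //; [by rewrite mulr_ge0// ltW|exact: hk|].
  by apply: ler_wpM2l; [exact: ltW|exact: laplacian_bound].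
have -> : 4^-1 * \sum_(t | ccw_quad t) quad_cross t * laplacian f (ppos t.1.1) * h t.1.1 = 4^-1 * SL h.
  by congr (_ * _); apply: eq_bigr => t _; ring.
move: h3 h5 h6 h7 h2; rewrite h4 !mulrDl.
have S0 : 0 <= near_area.
  by apply: sumr_ge0 => t /andP[tq _]; have [_ _ /ltW] := ccw_quadP oG tq.
have oBS : 0 <= om * B2 * near_area by rewrite !mulr_ge0.
move: (SA k) (2^-1 * SB) (4^-1 * SL k) (4^-1 * SL h) => a b c e.
rewrite -!(mulrA _ om B2) -!(mulrA _ (om * B2)).
move: (om * B2 * near_area) (32 * Hm * eps * B3 * near_area) oBS => X Y X0.
rewrite !ler_norml => /andP[? ?] /andP[? ?] /andP[? ?] /andP[? ?] /andP[? ?].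
(* The coefficients of [om * B2] add up to [4 + 6 + 2 + 1/2], which is below [13]. *)
by apply/andP; split; lra.
Qed.

End Estimate.
End DiscreteEstimate.

(** * Oscillation of harmonic functions *)

Section Domain.
Variables (R : realType) (G : bigraph R).
Hypothesis oG : orthodiagonal_map G.
Notation V := (primal G).
Notation W := (dual G).
Local Notation mu := (@leb2 R).
Implicit Types (x y : V) (w v : W) (p q r z : R * R).

Definition box z (r : R) : set (plane R) :=
  `[z.1 - r, z.1 + r]%classic `*` `[z.2 - r, z.2 + r]%classic.

Lemma measurable_box z (r : R) : measurable (box z r).
Proof. by apply: measurableX; exact: measurable_itv. Qed.

Lemma leb2_box z (r : R) : 0 < r -> mu (box z r) = ((2 * r) ^+ 2)%:E.
Proof.
move=> r0; rewrite [LHS]product_measure1E; [|exact: measurable_itv|exact: measurable_itv].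
rewrite [X in (X * _)%E]lebesgue_measure_itv [X in (_ * X)%E]lebesgue_measure_itv/= !lte_fin.
have -> : z.1 - r < z.1 + r by lra.
have -> : z.2 - r < z.2 + r by lra.
by rewrite -!EFinD -EFinM; congr EFin; ring.
Qed.

Lemma edist_box z q (r : R) : edist z q <= r -> box z r q.
Proof.
move=> zq; have h1 := le_trans (norm_fst_le (z - q)) zq.
have h2 := le_trans (norm_snd_le (z - q)) zq.
move: h1 h2; rewrite !coordE !ler_norml => /andP[? ?] /andP[? ?].
by rewrite /box /= !in_itv/=; split; apply/andP; split; lra.
Qed.

Lemma measurable_drawing : measurable (drawing G : set (plane R)).
Proof.
by rewrite -(setCK (drawing G)); apply: measurableC; apply: open_measurable_plane; exact: open_codrawing.
Qed.

Lemma leb2_bigU (I : Type) (s : seq I) (F : I -> set (plane R)) :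
  (forall i, measurable (F i) /\ mu (F i) = 0%E) ->
  measurable (\big[setU/set0]_(i <- s) F i) /\ mu (\big[setU/set0]_(i <- s) F i) = 0%E.
Proof.
move=> hF; elim: s => [|i s [IH1 IH2]]; first by rewrite big_nil measure0; split.
rewrite big_cons; have [h1 h2] := hF i; split; first exact: measurableU.
have -> : mu (F i `|` \big[setU/set0]_(j <- s) F j) = mu (F i) by exact: measureU0.
exact: h2.
Qed.

(** The drawing is contained in finitely many lines, indexed by pairs of vertices; a pair [(a, a)]
    stands for the horizontal line through [a]. *)
Lemma leb2_drawing : mu (drawing G) = 0%E.
Proof.
pose p1 (p : R * R) : R * R := (p.1 + 1, p.2).
have pp1 p : p <> p1 p by move=> /(congr1 fst) /= e; move: (ltrDl p.1 1); rewrite -{1}e ltxx ltr01.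
pose F (a : (V + W) * (V + W)) : set (plane R) :=
  if pos a.1 == pos a.2 then [set r | orient (pos a.1) (p1 (pos a.1)) r = 0]
  else [set r | orient (pos a.1) (pos a.2) r = 0].
have [|mF F0] := @leb2_bigU _ (index_enum _) F.
  move=> a; rewrite /F; case: eqP => h; split; try exact: measurable_line.
    by apply: leb2_line; exact: pp1.
  exact: leb2_line.
apply: (subset_measure0 _ _ _ F0) => //; first exact: measurable_drawing.
have H a p : F a p -> (\big[setU/set0]_a F a) p by move=> Fa; rewrite (bigD1 a)//=; left.
move=> p [[a _ <-]|[x [w [e h]]]].
  by apply: (H (a, a)); rewrite /F eqxx/= orientxl.
apply: (H (inl x, inr w)); rewrite /F/=; case: eqP => [/(pos_neq oG)//|_].
exact: seg_on_line h.
Qed.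

Lemma open_Ghat : open (Ghat G). Proof. exact: open_interior. Qed.

Lemma measurable_Ghat : measurable (Ghat G : set (plane R)).
Proof. by apply: open_measurable_plane; exact: open_Ghat. Qed.

(** A nonempty open set contains a square of positive measure, and the drawing is null. *)
Lemma Ghat_off_drawing z : Ghat G z -> exists2 p, Ghat G p & ~ drawing G p.
Proof.
move=> Gz; apply: contrapT => h.
have sub : Ghat G `<=` drawing G.
  by move=> p Gp; apply: contrapT => np; apply: h; exists p.
have /open_edistP/(_ _ Gz)[e e0 eG] := open_Ghat.
have e4 : 0 < e / 4 by rewrite divr_gt0.
have : mu (box z (e / 4)) = 0%E.
  apply: (subset_measure0 _ _ _ leb2_drawing); [exact: measurable_box|exact: measurable_drawing|].
  move=> q [/=]; rewrite !in_itv/= => /andP[h1 h2] /andP[h3 h4]; apply/sub/eG.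
  apply: (le_lt_trans (enorm_le_normD _)); rewrite !coordE.
  have n1 : `|z.1 - q.1| <= e / 4 by rewrite ler_norml; apply/andP; split; lra.
  have n2 : `|z.2 - q.2| <= e / 4 by rewrite ler_norml; apply/andP; split; lra.
  lra.
by rewrite leb2_box// => -[] /eqP; rewrite expf_eq0/= gt_eqF// mulr_gt0.
Qed.

(** A point of [Ghat] off the drawing lies in a face, whose sides have positive length at most
    [eps]. *)
Lemma eps_gt0 z (eps : R) : Ghat G z -> edges_le G eps -> 0 < eps.
Proof.
move=> Gz le; have [p Gp np] := Ghat_off_drawing Gz; have iF := Ghat_comp Gp np.
have [_ _ /(_ _ iF)[x [w [y [v [[_ _ /and4P[e _ _ _] _] _]]]]] _] := oG.
apply: lt_le_trans (le _ _ e); rewrite enorm_gt0// subr_eq0.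
by apply/eqP; exact: pos_neq.
Qed.

Lemma Ghat_bounded : exists2 M : R, 0 < M & Ghat G `<=` box 0 M.
Proof.
pose M := \sum_(a : V + W) enorm (pos a) + 1.
have M0 : 0 < M by rewrite ltr_pwDr// sumr_ge0// => a _; exact: enorm_ge0.
have pM (a : V + W) : edist (pos a) 0 <= M.
  rewrite /edist subr0 /M (bigD1 a)//= -addrA lerDl addr_ge0// sumr_ge0// => i _.
  exact: enorm_ge0.
exists M => // p Gp; apply: edist_box; rewrite edistC.
have [|np] := pselect (drawing G p).
  move=> [[a _ <-]//|[x [w [e]]]].
  rewrite /eseg => xwp; apply: le_trans (_ : Num.max (edist (ppos x) 0) (edist (dpos w) 0) <= M).
    rewrite leNgt; apply/negP => h.
    have h1 : edist 0 (ppos x) < edist p 0 by rewrite edistC; apply: le_lt_trans h; rewrite le_max lexx.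
    have h2 : edist 0 (dpos w) < edist p 0 by rewrite edistC; apply: le_lt_trans h; rewrite le_max lexx orbT.
    by have := seg_ball h1 h2 xwp; rewrite edistC ltxx.
  by rewrite ge_max (pM (inl x)) (pM (inr w)).
have iF := Ghat_comp Gp np.
have cp : comp G p p by exact: connected_component_refl.
have [t tq FE] := face_ccw oG iF.
rewrite FE in cp.
apply: (region_edist oG tq cp); [exact: (pM (inl _))|exact: (pM (inr _))|exact: (pM (inl _))|exact: (pM (inr _))].
Qed.

Lemma leb2_Ghat_lty : (mu (Ghat G) < +oo)%E.
Proof.
have [M M0 sub] := Ghat_bounded; apply: (@le_lt_trans _ _ (mu (box 0 M))).
  by apply: le_measure; rewrite ?inE//; [exact: measurable_Ghat|exact: measurable_box].
by rewrite leb2_box// ltry.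
Qed.

Lemma edist_to_le z q (A : set (R * R)) : A q -> edist_to z A <= edist z q.
Proof.
by move=> Aq; apply: ge_inf; [exists 0 => _ [r _ <-]; exact: edist_ge0|exists q].
Qed.

Lemma Ghat_near z q : Ghat G z -> edist z q < edist_to z (frontier (Ghat G)) -> Ghat G q.
Proof.
move=> Gz zq; apply: (connected_avoid_frontier (@connected_seg _ z q) (@seg_left _ _ _) Gz); last exact: seg_right.
rewrite -subset0 => p [/seg_edist zp fp]; have := edist_to_le z fp.
by rewrite leNgt (le_lt_trans zp zq).
Qed.

Lemma bdryV_far z x : Ghat G z -> bdryV x ->
  edist_to z (frontier (Ghat G)) <= edist z (ppos x).
Proof.
move=> Gz bx; rewrite leNgt; apply/negP => /(Ghat_near Gz).
exact: outer_frontier_Ghat.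
Qed.

Lemma dist_bdryV_ge z x : Ghat G z ->
  edist_to z (frontier (Ghat G)) - edist z (ppos x) <= dist_bdryV x.
Proof.
move=> Gz; have [b bb] := bdryV_nonempty oG.
apply: lb_le_inf; first by exists (edist (ppos x) (ppos b)); exists (ppos b) => //; exists b.
move=> _ [_ [y yb <-] <-]; have := bdryV_far Gz yb.
have := edist_triangle (ppos x) z (ppos y); lra.
Qed.

Lemma norm_le_max_norm (h : V -> R) x : `|h x| <= max_norm h.
Proof. exact: (le_bigmax _ (fun x => `|h x|) x). Qed.

Lemma max_norm_ge0 (h : V -> R) : 0 <= max_norm h.
Proof. exact: bigmax_ge_id. Qed.

(* Inf-convolution at scale [eps]. *)
Lemma lipschitz_approximation (h : V -> R) (U : pred V) (om eps : R) : 0 <= om -> 0 < eps ->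
  (forall x y, U x -> U y -> h x - h y <= om * (1 + edist (ppos x) (ppos y) / eps)) ->
  exists k : V -> R, [/\ forall x, U x -> `|h x - k x| <= om,
    forall x, U x -> `|k x| <= max_norm h &
    forall x y, `|k x - k y| <= om / eps * edist (ppos x) (ppos y)].
Proof.
move=> om0 e0 osc; have [/existsP[u Uu]|nU] := boolP [exists x, U x]; last first.
  have nU' x : U x -> False by move=> Ux; move/negP: nU; apply; apply/existsP; exists x.
  exists (fun _ => 0); split=> [x /nU'//|x /nU'//|x y].
  by rewrite subrr normr0 mulr_ge0// ?edist_ge0// divr_ge0// ltW.
pose F x y := h y + om / eps * edist (ppos x) (ppos y).
pose a x := [arg min_(y < u | U y) F x y]%O.
have aP x : U (a x) /\ forall y, U y -> F x (a x) <= F x y.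
  by rewrite /a; case: arg_minP.
have oe : 0 <= om / eps by rewrite divr_ge0// ltW.
exists (fun x => F x (a x)); split=> [x Ux|x Ux|].
(* The competitor [y = x] gives that the approximation is at most [h x]; conversely the penalty in
   [F] offsets the part of the oscillation that grows with distance, and only [om] is left. *)
- have [Ua h1] := aP x; have h2 := h1 _ Ux; have h3 := osc _ _ Ux Ua.
  move: h2 h3; rewrite /F edistpp mulr0 addr0 mulrDr mulr1 (mulrC _ eps^-1) mulrA => h2 h3.
  by rewrite ler_norml; apply/andP; split; lra.
- have [Ua h1] := aP x; have h2 := h1 _ Ux; move: h2; rewrite /F edistpp mulr0 addr0 => h2.
  have := norm_le_max_norm h x; have := norm_le_max_norm h (a x).
  rewrite !ler_norml => /andP[h3 h4] /andP[h5 h6].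
  have h7 : 0 <= om / eps * edist (ppos x) (ppos (a x)) by rewrite mulr_ge0// edist_ge0.
  by apply/andP; split; lra.
- have L x y : F x (a x) - F y (a y) <= om / eps * edist (ppos x) (ppos y).
    have [Ua _] := aP y; have [_ /(_ _ Ua) h1] := aP x.
    have h2 : om / eps * edist (ppos x) (ppos (a y)) <=
        om / eps * (edist (ppos x) (ppos y) + edist (ppos y) (ppos (a y))).
      by apply: ler_wpM2l => //; exact: edist_triangle.
    by move: h1 h2; rewrite mulrDr /F; lra.
  move=> x y; rewrite ler_norml; apply/andP; split; last exact: L.
  by have := L y x; rewrite (edistC (ppos y)); lra.
Qed.

(** The radius [7 / 8 * d] leaves a distance [d / 8] to the boundary. With [r] the distance of the
    vertices, the Hoelder ratio is at most [8 * (K + 1) * (eps / d) * (1 + r / eps)]; as [beta < 1],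
    the last factor raised to [beta] is at most [1 + r / eps]. This linear growth is the form that
    the inf-convolution requires. *)
Lemma oscillation (C' K beta eps : R) (h : V -> R) z :
  0 < C' -> 0 < K -> 0 < beta < 1 -> harmonic_holder C' K beta ->
  edges_le G eps -> harmonic h -> Ghat G z ->
  let d := edist_to z (frontier (Ghat G)) in 0 < d ->
  forall x y, edist z (ppos x) <= 7 / 8 * d -> edist z (ppos y) <= 7 / 8 * d ->
  `|h y - h x| <= C' * max_norm h * (8 * (K + 1) * (eps / d)) `^ beta *
     (1 + edist (ppos x) (ppos y) / eps).
Proof.
move=> C0 K0 /andP[b0 b1] hol le hh Gz d d0 x y hx hy.
have e0 := eps_gt0 Gz le.
have dx := dist_bdryV_ge x Gz; have dy := dist_bdryV_ge y Gz; rewrite -/d in dx dy.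
have d' : d / 8 <= Num.min (dist_bdryV x) (dist_bdryV y) by rewrite le_min; apply/andP; split; lra.
have d'0 : 0 < Num.min (dist_bdryV x) (dist_bdryV y) by apply: lt_le_trans d'; rewrite divr_gt0.
apply: le_trans (hol G eps oG le h hh x y d'0) _.
rewrite -[leRHS]mulrA; apply: ler_wpM2l; first by rewrite mulr_ge0 ?max_norm_ge0// ltW.
set r := edist (ppos x) (ppos y); have r0 : 0 <= r by exact: edist_ge0.
have re0 : 0 <= r / eps by rewrite divr_ge0// ltW.
have m0 : 0 <= Num.max (edist (ppos y) (ppos x)) (K * eps).
  by rewrite le_max edist_ge0.
have K1 : 0 <= 8 * (K + 1) by lra.
have ed0 : 0 <= eps / d by rewrite divr_ge0// ltW.
have A0 : 0 <= 8 * (K + 1) * (eps / d) by exact: mulr_ge0.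
have s1 : 1 <= 1 + r / eps by rewrite lerDl.
have s0 : 0 <= 1 + r / eps by apply: le_trans s1.
have X : Num.max (edist (ppos y) (ppos x)) (K * eps) / Num.min (dist_bdryV x) (dist_bdryV y) <=
    8 * (K + 1) * (eps / d) * (1 + r / eps).
  rewrite ler_pdivrMr//.
  have h1 : Num.max (edist (ppos y) (ppos x)) (K * eps) <= (K + 1) * (eps + r).
    rewrite edistC -/r ge_max; apply/andP; split; nra.
  apply: le_trans h1 _.
  have -> : (K + 1) * (eps + r) = 8 * (K + 1) * (eps / d) * (1 + r / eps) * (d / 8).
    by field; rewrite ?gt_eqF.
  by apply: ler_wpM2l => //; exact: mulr_ge0.
apply: (@le_trans _ _ ((8 * (K + 1) * (eps / d) * (1 + r / eps)) `^ beta)).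
  apply: ge0_ler_powR => //; rewrite ?nnegrE; [exact: ltW|by rewrite divr_ge0// ltW|by rewrite mulr_ge0//; lra].
rewrite powRM//.
apply: ler_wpM2l; first exact: powR_ge0.
by rewrite -[leRHS]powRr1//; apply: ler_powR => //; exact: ltW.
Qed.

End Domain.

Lemma norm_mulB (R : numDomainType) (a b c e A B C D : R) :
  `|a - c| <= A -> `|b| <= B -> `|c| <= C -> `|b - e| <= D ->
  `|a * b - c * e| <= A * B + C * D.
Proof.
move=> h1 h2 h3 h4; rewrite -(subrK (c * b) (a * b)) -addrA -mulrBl -mulrBr.
by apply: le_trans (ler_normD _ _) _; rewrite !normrM lerD// ler_pM.
Qed.

(** * Comparison of the integral with the sum over faces *)

Section Comparison.
Variables (R : realType) (G : bigraph R).
Hypothesis oG : orthodiagonal_map G.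
Notation V := (primal G).
Notation W := (dual G).
Notation T4 := ((V * W) * (V * W))%type.
Local Notation mu := (@leb2 R).
Implicit Types (x y : V) (p q r : R * R) (t : T4).
Variables (eps delta : R) (z : R * R).
Hypothesis eps0 : 0 < eps.
Hypothesis delta0 : 0 < delta.
Hypothesis ed : 8 * eps <= delta.
Hypothesis le_eps : edges_le G eps.

Lemma region_primal_edist t q : ccw_quad t -> region t q -> edist (ppos t.1.1) q <= 2 * eps.
Proof.
move=> tq qt; have [e1 e2 e3] := quad_near oG eps0 le_eps tq; rewrite edistC.
apply: (region_edist oG tq qt); rewrite 1?edistC ?edistpp//.
by rewrite mulr_ge0// ltW.
Qed.

Lemma near_box t q : ccw_quad t -> near delta z t.1.1 -> region t q -> box z (2 * delta) q.
Proof.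
move=> tq nt /(region_primal_edist tq) qt; apply: edist_box.
have := edist_triangle (ppos t.1.1) z q; have := (delta0, ed) => -[d0 ed'].
move: nt; rewrite /near => nt; lra.
Qed.

Lemma region_Ghat t : ccw_quad t -> region t `<=` Ghat G.
Proof. by move=> /(ccw_quadP oG)[iF _ _]; exact: inner_face_Ghat. Qed.

Let mD := measurable_Ghat G.
Let Doo := leb2_Ghat_lty oG.
Let box2 : (mu (box z (2 * delta)) < +oo)%E.
Proof. by rewrite leb2_box ?ltry// mulr_gt0. Qed.
Let fine_box2 : fine (mu (box z (2 * delta))) = 16 * delta ^+ 2.
Proof. by rewrite leb2_box/=; [ring|rewrite mulr_gt0]. Qed.

(** As [quad_cross] is twice an area and a face is listed twice, [near_area] is the integral of a
    function bounded by [4] and carried by a square of side [4 * delta]; hence [4 * 16]. *)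
Lemma near_area_le : near_area G delta z <= 64 * delta ^+ 2.
Proof.
pose P t := @ccw_quad R G t && near delta z t.1.1.
pose S q := \sum_(t | P t) 2 * (\1_(region t) q : R).
have [Si SE] := @Rintegral_sum_indic R (Ghat G) _ (index_enum _) P (fun _ => 2)
  (@region _ G) mD Doo (fun t _ => measurable_region t) (fun t Pt => region_Ghat (andP Pt).1).
have -> : near_area G delta z = Rintegral mu (Ghat G) S.
  rewrite SE; apply: eq_bigr => t /andP[tq _].
  by rewrite leb2_region//= mulrA mulfV ?mul1r.
apply: le_trans (ler_norm _) _.
have -> : 64 * delta ^+ 2 = 4 * fine (mu (box z (2 * delta))) by rewrite fine_box2; ring.
apply: (@Rintegral_bound R (Ghat G) _ _ S 4 mD Doo (measurable_box _ _) box2 (measurable_drawing G) (leb2_drawing oG) Si) => // q Dq nq.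
have [/existsP[t /andP[Pt qt]]|no] := boolP [exists t, P t && (q \in region t)].
  have /andP[tq nt] := Pt.
  rewrite indicE mem_set ?mulr1; last exact: near_box (set_mem qt).
  have := region_cover oG Dq nq; rewrite (bigID (fun t => near delta z t.1.1))/= => e.
  rewrite /S -mulr_sumr ger0_norm; last by rewrite mulr_ge0// sumr_ge0.
  rewrite (_ : 4 = 2 * 2 :> R); last by ring.
  by rewrite ler_wpM2l// -[leRHS]e lerDl sumr_ge0.
rewrite /S big1 ?normr0 ?mulr_ge0// => t Pt.
rewrite indicE; case: (boolP (q \in region t)) => [qt|]; last by rewrite mulr0.
by case/negP: no; apply/existsP; exists t; rewrite Pt.
Qed.

Variables (f H : R * R -> R) (h : V -> R) (B2 B3 C0 om Hm : R).
Hypothesis d2 : forall b, axis_derivable ('D_(dir R b) ('D_(dir R b) f)).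
Hypothesis hB2 : forall b c q, `|'D_(dir R c) ('D_(dir R b) f) q| <= B2.
Hypothesis hB3 : forall a b c q, `|'D_(dir R c) ('D_(dir R b) ('D_(dir R a) f)) q| <= B3.
Hypothesis ddf0 : forall b q, delta < edist z q -> 'D_(dir R b) ('D_(dir R b) f) q = 0.
Hypothesis laplacian_int : mu.-integrable (Ghat G) (EFin \o (fun q => laplacian f q * H q)).
Hypothesis aH : admissible_extension C0 eps h H.
Hypothesis hm : forall x, `|h x| <= Hm.
Hypothesis C0e : 4 * (C0 + 3) * eps <= delta.
Hypothesis C00 : 1 <= C0.
Hypothesis om0 : 0 <= om.
Hypothesis osc : forall x y, edist z (ppos x) <= 7 / 4 * delta -> edist z (ppos y) <= 7 / 4 * delta ->
  `|h y - h x| <= om * (1 + edist (ppos x) (ppos y) / eps).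

Lemma extension_le q : Ghat G q -> `|H q| <= Hm.
Proof.
case: aH => _ _ /[apply] -[[x _ hx] [y _ hy]].
have := hm x; have := hm y; rewrite !ler_norml => /andP[? ?] /andP[? ?].
by apply/andP; split; lra.
Qed.

(** Serves when [eps] is not small compared with [delta]: only the suprema of the Laplacian and of
    [H] enter, with the area of a square containing the support. *)
Lemma coarse_estimate :
  `|Rintegral mu (Ghat G) (fun q => laplacian f q * H q)| <= 2 * B2 * Hm * (16 * delta ^+ 2).
Proof.
have B20 : 0 <= B2 by apply: le_trans (@hB2 true true 0); rewrite normr_ge0.
have Hm0 : 0 <= Hm by have [x _] := bdryV_nonempty oG; exact: le_trans (hm x).
rewrite -fine_box2.
apply: (Rintegral_bound mD Doo (measurable_box _ _) box2 measurable0 (measure0 _) laplacian_int).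
  by rewrite !mulr_ge0.
move=> q Dq _; have [zq|zq] := leP (edist z q) delta; last first.
  rewrite laplacianE (ddf0 _ zq) (ddf0 _ zq) addr0 mul0r normr0.
  by rewrite mulr_ge0 ?mulr_ge0.
rewrite indicE mem_set ?mulr1; last by apply: edist_box; have := delta0; lra.
by rewrite normrM; apply: ler_pM => //; [exact: (@laplacian_bound _ _ _ (@hB2))|exact: extension_le].
Qed.

(** The value [H q] lies between values of [h] at vertices within [C0 * eps] of [q], hence within
    [(C0 + 2) * eps] of [x]; the summand [1] in [osc] makes it [C0 + 3]. By [C0e] these vertices are
    still within [7 / 4 * delta] of [z]. *)
Lemma extension_near q x : Ghat G q -> near delta z x -> edist (ppos x) q <= 2 * eps ->
  `|H q - h x| <= om * (C0 + 3).
Proof.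
move=> Dq nx xq; have := (eps0, delta0, C0e) => -[[e0 de0] ce].
have K y : edist (ppos y) q <= C0 * eps -> `|h y - h x| <= om * (C0 + 3).
  move=> yq; have t1 : edist (ppos x) (ppos y) <= (C0 + 2) * eps.
    by have := edist_triangle q (ppos x) (ppos y); rewrite (edistC q); lra.
  have t2 := edist_triangle (ppos x) z (ppos y).
  move: nx; rewrite /near => nx.
  apply: (@le_trans _ _ _ _ _ (osc _ _)); [lra|lra|].
  apply: ler_wpM2l => //.
  have : edist (ppos x) (ppos y) / eps <= C0 + 2 by rewrite ler_pdivrMr.
  lra.
case: aH => _ _ /(_ _ Dq)[[y /K hy1 hy2] [y' /K hy3 hy4]].
move: hy1 hy3; rewrite !ler_norml => /andP[? ?] /andP[? ?]; apply/andP; split; lra.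
Qed.

Lemma laplacian_near p q (k : R) : edist p q <= k -> `|laplacian f q - laplacian f p| <= 4 * B3 * k.
Proof.
move=> pq; have B30 : 0 <= B3 by apply: le_trans (@hB3 true true true 0); rewrite normr_ge0.
have L b : `|'D_(dir R b) ('D_(dir R b) f) q - 'D_(dir R b) ('D_(dir R b) f) p| <= B3 * (2 * k).
  apply: le_trans (@lipschitz_sub _ _ B3 q p (@d2 b) _) _; first by move=> c r; exact: hB3.
  by apply: ler_wpM2l => //; apply: norm1_le; rewrite -/(edist q p) edistC.
rewrite !laplacianE opprD addrACA; apply: le_trans (ler_normD _ _) _.
by apply: le_trans (lerD (L false) (L true)) _; lra.
Qed.

(** By [region_cover], off the null drawing the constant [1] is half the sum of the indicators of
    the regions. Both quantities become integrals over the listed faces, where each point is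
    compared with the base vertex. *)
Lemma integral_estimate : `|Rintegral mu (Ghat G) (fun q => laplacian f q * H q)
    - 4^-1 * \sum_(t | ccw_quad t) quad_cross t * laplacian f (ppos t.1.1) * h t.1.1| <=
  (8 * B3 * eps * Hm + 2 * B2 * (om * (C0 + 3))) * (16 * delta ^+ 2).
Proof.
have e0 := eps0.
have Hm0 : 0 <= Hm by have [x _] := bdryV_nonempty oG; exact: le_trans (hm x).
have B20 : 0 <= B2 by apply: le_trans (@hB2 true true 0); rewrite normr_ge0.
have B30 : 0 <= B3 by apply: le_trans (@hB3 true true true 0); rewrite normr_ge0.
set E := (X in _ <= X * _); have E0 : 0 <= E.
  by rewrite addr_ge0// !mulr_ge0// ?(ltW e0)//; have := C00; lra.
pose c t := 2^-1 * (laplacian f (ppos t.1.1) * h t.1.1).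
have [Si SE] := @Rintegral_sum_indic R (Ghat G) _ (index_enum _) (@ccw_quad R G) c
  (@region _ G) mD Doo (fun t _ => measurable_region t) (fun t Pt => region_Ghat Pt).
have -> : 4^-1 * \sum_(t | ccw_quad t) quad_cross t * laplacian f (ppos t.1.1) * h t.1.1 =
    Rintegral mu (Ghat G) (fun q => \sum_(t | ccw_quad t) c t * \1_(region t) q).
  rewrite SE mulr_sumr; apply: eq_bigr => t tq; rewrite leb2_region//= /c.
  by move: (laplacian _ _) => l; field.
rewrite -RintegralB// -fine_box2.
apply: (Rintegral_bound mD Doo (measurable_box _ _) box2 (measurable_drawing G) (leb2_drawing oG)) => //.
  exact: (integrableB mD laplacian_int Si).
move=> q Dq nq; have cov := region_cover oG Dq nq.
have -> : laplacian f q * H q = 2^-1 * \sum_(t : T4 | ccw_quad t) laplacian f q * H q * \1_(region t) q.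
  by rewrite -mulr_sumr cov mulrCA mulVf ?mulr1.
rewrite mulr_sumr -sumrB; apply: le_trans (ler_norm_sum _ _ _) _.
have -> : E * \1_(box z (2 * delta)) q = \sum_(t | @ccw_quad R G t) 2^-1 * (E * \1_(box z (2 * delta)) q) * \1_(region t) q.
  by rewrite -mulr_sumr cov mulrAC mulVf ?mul1r.
apply: ler_sum => t tq; rewrite indicE; case: (boolP (q \in region t)) => [/set_mem qt|_]; last first.
  by rewrite !mulr0 subrr normr0.
rewrite !mulr1 /c -mulrBr normrM ger0_norm ?invr_ge0//; apply: ler_wpM2l; first by rewrite invr_ge0.
have xq := region_primal_edist tq qt.
have [nt|nt] := boolP (near delta z t.1.1); last first.
  rewrite (laplacian_far eps0 ed (@ddf0) tq nt) laplacianE !ddf0 ?(far_point eps0 ed nt)// !addr0 !mul0r subr0 normr0.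
  by rewrite mulr_ge0.
rewrite indicE mem_set ?mulr1; last exact: near_box qt.
apply: norm_mulB.
- by have := laplacian_near xq; rewrite (_ : 4 * B3 * (2 * eps) = 8 * B3 * eps); last by ring.
- exact: extension_le.
- exact: (@laplacian_bound _ _ _ (@hB2)).
- exact: extension_near.
Qed.

Lemma fine_estimate (d : R) : harmonic h -> 2 * delta <= d ->
  (forall q, edist z q < d -> Ghat G q) -> (forall x, bdryV x -> d <= edist z (ppos x)) ->
  smooth f -> (forall s q, delta < edist z q -> partial s f q = 0) ->
  `|Rintegral mu (Ghat G) (fun q => laplacian f q * H q)| <=
    (8 * B3 * eps * Hm + 2 * B2 * (om * (C0 + 3))) * (16 * delta ^+ 2) +
    (13 * om * B2 + 32 * Hm * eps * B3) * (64 * delta ^+ 2).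
Proof.
move=> hh dd Gz bd sf far.
have near_le x : near delta z x -> edist z (ppos x) <= 7 / 4 * delta.
  by rewrite /near; have := delta0; lra.
have Hm0 : 0 <= Hm by have [x _] := bdryV_nonempty oG; exact: le_trans (hm x).
have hmm : max_norm h <= Hm by apply: bigmax_le => // x _; exact: hm.
have [|k [k1 k2 k3]] := @lipschitz_approximation R G h
    (fun x => edist z (ppos x) <= 7 / 4 * delta) om eps om0 eps0.
  by move=> x y hx hy; rewrite edistC; apply: le_trans (ler_norm _) (osc hy hx).
have DE : `|4^-1 * \sum_(t | ccw_quad t) quad_cross t * laplacian f (ppos t.1.1) * h t.1.1| <=
    (13 * om * B2 + 32 * Hm * eps * B3) * near_area G delta z.
  apply: (discrete_estimate oG eps0 ed dd le_eps Gz _ _ _ (@hB2) (@hB3) _ _ (@ddf0) om0 Hm0 hh bd _ _ k3).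
  - exact: (smooth_axis_derivable (s := [::]) sf).
  - by move=> b; exact: (smooth_axis_derivable (s := [:: b]) sf).
  - by move=> b b'; exact: (smooth_axis_derivable (s := [:: b'; b]) sf).
  - exact: (far [::]).
  - by move=> b; exact: (far [:: b]).
  - by move=> x nx; exact: k1 (near_le x nx).
  - by move=> x nx; exact: le_trans (k2 x (near_le x nx)) hmm.
rewrite -[Rintegral _ _ _](subrK (4^-1 * \sum_(t | ccw_quad t) quad_cross t * laplacian f (ppos t.1.1) * h t.1.1)).
apply: le_trans (ler_normD _ _) _; apply: lerD integral_estimate _.
apply: le_trans DE _; apply: ler_wpM2l near_area_le.
have B20 : 0 <= B2 by apply: le_trans (@hB2 true true 0); rewrite normr_ge0.
have B30 : 0 <= B3 by apply: le_trans (@hB3 true true true 0); rewrite normr_ge0.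
by rewrite addr_ge0// !mulr_ge0// ltW.
Qed.

End Comparison.

(** * The Laplacian of the convolution *)

Section Convolution.
Variable R : realType.
Local Notation mu := (@leb2 R).
Variables (D : set (plane R)) (H : R * R -> R) (K : R).
Hypothesis mD : measurable D.
Hypothesis Doo : (mu D < +oo)%E.
Hypothesis mH : measurable_fun D (H : plane R -> measurableTypeR R).
Hypothesis HK : forall q, D q -> `|H q| <= K.
Variable g : R * R -> R.
Hypothesis sg : smooth g.
Hypothesis gB : forall s, exists B : R, forall q, `|partial s g q| <= B.

Lemma smooth_partial s : smooth (partial s g).
Proof. by move=> s'; have := sg (s' ++ s); rewrite /partial foldr_cat. Qed.

Lemma partial_convolution s :
  partial s (convolution_on D g H) = convolution_on D (partial s g) H.
Proof.
elim: s => //= b s IH; rewrite IH; apply/funext => p.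
have [B0 h0] := gB s; have [B1 h1] := gB (b :: s).
have [Bf hf] := gB [:: false, b & s]; have [Bt ht] := gB [:: true, b & s].
apply: derive_val; apply: (is_derive_convolution mD Doo mH HK (B2 := Num.max Bf Bt)) h0 h1 _.
  exact: smooth_partial.
move=> [] q.
  by apply: (le_trans (ht q)); rewrite le_max lexx orbT.
by apply: (le_trans (hf q)); rewrite le_max lexx.
Qed.

Lemma integrable_partial_kernel s z :
  mu.-integrable D (EFin \o (fun q : plane R => partial s g (z - q) * H q)).
Proof. by have [B h] := gB s; apply: (integrable_kernel mD Doo mH HK) h; exact: (sg s).1. Qed.

Lemma integrable_laplacian_kernel z :
  mu.-integrable D (EFin \o (fun q : plane R => laplacian g (z - q) * H q)).
Proof.
rewrite (_ : _ \o _ = EFin \o (fun q : plane R =>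
  partial [:: false; false] g (z - q) * H q + partial [:: true; true] g (z - q) * H q)).
  exact: (integrableD mD (integrable_partial_kernel _ z) (integrable_partial_kernel _ z)).
by apply/funext => q /=; rewrite -mulrDl.
Qed.

Lemma laplacian_convolution z :
  laplacian (convolution_on D g H) z = Rintegral mu D (fun q => laplacian g (z - q) * H q).
Proof.
rewrite {1}/laplacian !partial_convolution /convolution_on -RintegralD//; last 2 first.
- exact: integrable_partial_kernel.
- exact: integrable_partial_kernel.
by apply: eq_Rintegral => q _ /=; rewrite -mulrDl.
Qed.

End Convolution.

Section Kernel.
Variables (R : realType) (phi : R * R -> R) (delta : R) (z : R * R).
Hypothesis mphi : mollifier phi.
Hypothesis delta0 : 0 < delta.
Let sphi : smooth phi. Proof. by case: mphi. Qed.
Let deltaV : delta^-1 != 0. Proof. by rewrite invr_eq0 gt_eqF. Qed.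

Lemma rescaleE : rescale phi delta = fun p => delta ^- 2 * phi (delta^-1 *: p + 0).
Proof. by apply/funext => p; rewrite addr0. Qed.

Lemma partial_rescale s p : partial s (rescale phi delta) p =
  delta ^- 2 * delta^-1 ^+ size s * partial s phi (delta^-1 *: p).
Proof. by rewrite rescaleE partial_affine// addr0. Qed.

Lemma smooth_rescale : smooth (rescale phi delta).
Proof. by rewrite rescaleE; exact: smooth_affine. Qed.

Lemma partial_rescale_bounded s : exists B : R, forall q, `|partial s (rescale phi delta) q| <= B.
Proof.
have [B hB] := partial_bounded mphi s; exists (delta ^- 2 * delta^-1 ^+ size s * B) => q.
have c0 : 0 <= delta ^- 2 * delta^-1 ^+ size s.
  by apply: mulr_ge0; [rewrite invr_ge0|]; apply: exprn_ge0; rewrite ?invr_ge0 ltW.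
by rewrite partial_rescale normrM ger0_norm// ler_wpM2l.
Qed.

(* The affine form to which [partial_affine] applies. *)
Definition kernel q : R := 1 * rescale phi delta (-1 *: q + z).

Let N1 : (-1 : R) != 0. Proof. by rewrite oppr_eq0 oner_eq0. Qed.

Lemma smooth_kernel : smooth kernel.
Proof. exact: smooth_affine N1 smooth_rescale. Qed.

Lemma partial_kernel s q : partial s kernel q =
  (-1) ^+ size s * partial s (rescale phi delta) (z - q).
Proof.
by rewrite /kernel (partial_affine _ _ _ N1 smooth_rescale) mul1r scaleN1r addrC.
Qed.

Lemma partial_kernel_far s q : delta < edist z q -> partial s kernel q = 0.
Proof.
move=> zq; rewrite partial_kernel partial_rescale (partial_off_ball _ mphi) ?mulr0//.
rewrite enormZ ger0_norm; last by rewrite invr_ge0 ltW.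
by rewrite mulrC ltr_pdivlMr// mul1r.
Qed.

(** The exponent collects one [delta^-1] per derivative and the normalisation [delta ^- 2]. *)
Lemma partial_kernel_le s q (k : nat) : size s = k ->
  `|partial s kernel q| <= delta ^- (k + 2) * norm_D k phi.
Proof.
move=> sk; rewrite partial_kernel partial_rescale 2!normrM normrX normrN1 expr1n mul1r.
rewrite ger0_norm; last first.
  by apply: mulr_ge0; [rewrite invr_ge0|]; apply: exprn_ge0; rewrite ?invr_ge0 ltW.
rewrite sk exprVn -invfM -exprD addnC; apply: ler_wpM2l.
  by rewrite invr_ge0 exprn_ge0// ltW.
exact: (partial_le_norm_D mphi).
Qed.

Lemma laplacian_kernel q : laplacian kernel q = laplacian (rescale phi delta) (z - q).
Proof.
have E s : size s = 2 -> partial s kernel q = partial s (rescale phi delta) (z - q).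
  by move=> e; rewrite partial_kernel e sqrrN expr1n mul1r.
rewrite /laplacian; apply: f_equal2; exact: E.
Qed.

End Kernel.

(** * The bound before the exponents are lowered *)

Section Estimate.
Variables (R : realType) (C' K beta C0 : R).
Hypothesis C'0 : 0 < C'.
Hypothesis K0 : 0 < K.
Hypothesis b01 : 0 < beta < 1.
Hypothesis hol : harmonic_holder C' K beta.
Hypothesis C00 : 1 <= C0.

Let c : R := (8 * (K + 1)) `^ beta.
Let c0 : 0 <= c. Proof. exact: powR_ge0. Qed.

(** In the terms with [om * B2], [32 * (C0 + 3) + 13 * 64] gives [32 * C0 + 928]; in those with
    [eps * B3], [8 * 16 + 32 * 64] gives [2176]. The summand [128 * (C0 + 3)] serves the case where
    [eps] is not small. *)
Definition main_constant : R :=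
  (32 * C0 + 928) * (C' * c) + 2176 + 128 * (C0 + 3).

Lemma main_coefficient_ge0 : 0 <= (32 * C0 + 928) * (C' * c).
Proof.
have C1 : 0 <= 32 * C0 + 928 by have := C00; lra.
exact: mulr_ge0 C1 (mulr_ge0 (ltW C'0) c0).
Qed.

Lemma main_constant_ge0 : 0 <= main_constant.
Proof.
have := main_coefficient_ge0; rewrite /main_constant; set a := _ * (C' * c); have := C00; lra.
Qed.

(** In this range [4 * (C0 + 3) * (eps / delta)] is at least [1], so the trivial bound may be
    multiplied by it. *)
Lemma coarse_algebra (eps delta Hm N2 N3 P : R) : 0 < eps -> 0 < delta -> 0 <= Hm ->
  0 <= N2 -> 0 <= N3 -> 0 <= P -> delta < 4 * (C0 + 3) * eps ->
  2 * (delta ^- 4 * N2) * Hm * (16 * delta ^+ 2) <=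
    main_constant * (delta ^- 2 * Hm * (N2 + N3) * (P + eps / delta)).
Proof.
move=> eps0 delta0 Hm0 N20 N30 P0 big.
have C03 : 0 <= C0 + 3 by have := C00; lra.
have Q0 : 0 <= eps / delta by rewrite divr_ge0// ltW.
have X : 1 <= 4 * (C0 + 3) * (eps / delta) by rewrite mulrA ler_pdivlMr// mul1r ltW.
have Y0 : 0 <= delta ^- 2 * Hm by rewrite mulr_ge0// invr_ge0 exprn_ge0// ltW.
rewrite (_ : 2 * _ * Hm * _ = 32 * (delta ^- 2 * Hm * N2)); last by field; rewrite gt_eqF.
apply: (@le_trans _ _ (128 * (C0 + 3) * (delta ^- 2 * Hm * (N2 + N3) * (P + eps / delta)))).
  move: (delta ^- 2 * Hm) (eps / delta) Y0 Q0 X => Y Q Y0 Q0 X.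
  apply: (@le_trans _ _ (32 * (Y * (N2 + N3)) * (4 * (C0 + 3) * Q))).
    rewrite -[leLHS]mulr1; apply: ler_pM => //; first by rewrite !mulr_ge0.
    by rewrite ler_wpM2l// ler_wpM2l// lerDl.
  rewrite (_ : 32 * _ * _ = 128 * (C0 + 3) * (Y * (N2 + N3) * Q)); last by ring.
  by apply: ler_wpM2l; [rewrite mulr_ge0|apply: ler_wpM2l; rewrite ?mulr_ge0 ?addr_ge0// lerDr].
apply: ler_wpM2r; first by rewrite !mulr_ge0 ?addr_ge0// invr_ge0 exprn_ge0// ltW.
by rewrite /main_constant; have := main_coefficient_ge0; set a := _ * (C' * c); lra.
Qed.

Lemma fine_algebra (eps delta Hm N2 N3 P B2 B3 om : R) : 0 < eps -> 0 < delta -> 0 <= Hm ->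
  0 <= N2 -> 0 <= N3 -> 0 <= P ->
  B2 = delta ^- 4 * N2 -> B3 = delta ^- 5 * N3 -> om = C' * Hm * (c * P) ->
  (8 * B3 * eps * Hm + 2 * B2 * (om * (C0 + 3))) * (16 * delta ^+ 2) +
  (13 * om * B2 + 32 * Hm * eps * B3) * (64 * delta ^+ 2) <=
    main_constant * (delta ^- 2 * Hm * (N2 + N3) * (P + eps / delta)).
Proof.
move=> eps0 delta0 Hm0 N20 N30 P0 -> -> ->.
have Y0 : 0 <= delta ^- 2 * Hm by rewrite mulr_ge0// invr_ge0 exprn_ge0// ltW.
have Q0 : 0 <= eps / delta by rewrite divr_ge0// ltW.
rewrite (_ : _ + _ = delta ^- 2 * Hm * (2176 * (eps / delta * N3) + (32 * C0 + 928) * (C' * c) * (P * N2))); last first.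
  by field; rewrite gt_eqF.
have m0 := main_constant_ge0.
have m1 : 2176 <= main_constant.
  by rewrite /main_constant; have := main_coefficient_ge0; set a := _ * (C' * c); have := C00; lra.
have m2 : (32 * C0 + 928) * (C' * c) <= main_constant.
  by rewrite /main_constant; set a := _ * (C' * c); have := C00; lra.
rewrite [leRHS](_ : _ = delta ^- 2 * Hm * (main_constant * ((N2 + N3) * (P + eps / delta)))); last by ring.
apply: ler_wpM2l => //; move: (eps / delta) Q0 => Q Q0.
apply: (@le_trans _ _ (main_constant * (Q * N3) + main_constant * (P * N2))).
  by apply: lerD; apply: ler_wpM2r => //; exact: mulr_ge0.
rewrite -mulrDr; apply: ler_wpM2l => //.
rewrite (_ : (N2 + N3) * (P + Q) = Q * N3 + P * N2 + (N2 * Q + N3 * P)); last by ring.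
by rewrite lerDl addr_ge0// mulr_ge0.
Qed.

Lemma main_estimate (G : bigraph R) (eps : R) (h : primal G -> R) (H phi : R * R -> R)
    (z : R * R) (delta : R) :
  orthodiagonal_map G -> edges_le G eps -> harmonic h -> admissible_extension C0 eps h H ->
  mollifier phi -> Ghat G z -> 0 < delta ->
  let d := edist_to z (frontier (Ghat G)) in delta <= d / 2 ->
  `|laplacian (convolution_on (Ghat G) (rescale phi delta) H) z| <=
    main_constant * (delta ^- 2 * max_norm h * (norm_D 2 phi + norm_D 3 phi) *
      ((eps / d) `^ beta + eps / delta)).
Proof.
move=> oG le hh aH mphi Gz delta0 d dd.
have eps0 := eps_gt0 oG Gz le.
have d0 : 0 < d by lra.
have mD := measurable_Ghat G; have Doo := leb2_Ghat_lty oG.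
have hm := norm_le_max_norm h; have Hm0 := max_norm_ge0 h.
have HK q := extension_le aH hm (q := q).
have [mH _ _] := aH.
have sg := smooth_rescale mphi delta0; have gB := partial_rescale_bounded mphi delta0.
pose f := kernel phi delta z; have sf : smooth f := smooth_kernel z mphi delta0.
have N20 := le_trans (normr_ge0 _) (partial_le_norm_D mphi (s := [:: true; true]) 0 erefl).
have N30 := le_trans (normr_ge0 _) (partial_le_norm_D mphi (s := [:: true; true; true]) 0 erefl).
rewrite (laplacian_convolution mD Doo mH HK sg gB).
have li := integrable_laplacian_kernel mD Doo mH HK sg gB z.
have FE : (fun q => laplacian (rescale phi delta) (z - q) * H q) = (fun q => laplacian f q * H q).
  by apply/funext => q; rewrite laplacian_kernel.
rewrite FE in li *.
have hB2 b b' q : `|'D_(dir R b') ('D_(dir R b) f) q| <= delta ^- 4 * norm_D 2 phi.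
  exact: (@partial_kernel_le _ _ _ z mphi delta0 [:: b'; b] q 2).
have hB3 a b b' q : `|'D_(dir R b') ('D_(dir R b) ('D_(dir R a) f)) q| <= delta ^- 5 * norm_D 3 phi.
  exact: (@partial_kernel_le _ _ _ z mphi delta0 [:: b'; b; a] q 3).
have far s q : delta < edist z q -> partial s f q = 0 by exact: partial_kernel_far.
have ddf0 b := far [:: b; b].
have P0 : 0 <= (eps / d) `^ beta by exact: powR_ge0.
(* The discrete comparison needs room for several faces and for the radius [C0 * eps] of the
   extension inside the margins of order [delta]; otherwise the trivial bound has the required
   shape. *)
have [small|big] := leP (4 * (C0 + 3) * eps) delta; last first.
  apply: le_trans (coarse_estimate oG delta0 hB2 ddf0 li aH hm) _.
  exact: coarse_algebra.
have omE : C' * max_norm h * (8 * (K + 1) * (eps / d)) `^ beta = C' * max_norm h * (c * (eps / d) `^ beta).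
  rewrite powRM; [by []|by have := K0; lra|exact: divr_ge0 (ltW eps0) (ltW d0)].
have om0 : 0 <= C' * max_norm h * (c * (eps / d) `^ beta).
  exact: mulr_ge0 (mulr_ge0 (ltW C'0) Hm0) (mulr_ge0 c0 P0).
have osc x y : edist z (ppos x) <= 7 / 4 * delta -> edist z (ppos y) <= 7 / 4 * delta ->
    `|h y - h x| <= C' * max_norm h * (c * (eps / d) `^ beta) * (1 + edist (ppos x) (ppos y) / eps).
  by move=> hx hy; rewrite -omE; apply: (oscillation oG C'0 K0 b01 hol le hh Gz d0); rewrite -/d; lra.
have ed : 8 * eps <= delta.
  apply: le_trans small; apply: ler_wpM2r; [exact: ltW|have := C00; lra].
have dd' : 2 * delta <= d by lra.
apply: le_trans (fine_estimate oG eps0 delta0 ed le _ hB2 hB3 ddf0 li aH hm small C00 om0 osc hh dd' _ _ sf far) _.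
- by move=> b; exact: (smooth_axis_derivable (s := [:: b; b]) sf).
- by move=> q; exact: Ghat_near.
- by move=> x; exact: bdryV_far.
exact: fine_algebra.
Qed.

End Estimate.

(** The surplus power of [v] has exponent [b - a] in [[0, 1]]; it is at most the same power of [B],
    hence at most [B] because [1 <= B]. *)
Lemma powR_absorb (R : realType) (v B a b : R) : 0 < v -> v <= B -> 1 <= B ->
  a <= b <= a + 1 -> v `^ b <= B * v `^ a.
Proof.
move=> v0 vB B1 /andP[ab ba].
have -> : b = (b - a) + a by rewrite subrK.
rewrite powRD; last by apply/implyP => _; rewrite gt_eqF.
apply: ler_wpM2r; first exact: powR_ge0.
apply: (@le_trans _ _ (B `^ (b - a))).
  by apply: ge0_ler_powR; rewrite ?nnegrE ?subr_ge0 ?(ltW v0)// (le_trans ler01 B1).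
rewrite -[leRHS]powRr1; last exact: le_trans B1.
by apply: ler_powR => //; rewrite lerBlDl.
Qed.

Lemma powR_exp (R : realType) (x r : R) : 0 < x -> x `^ r = expR (r * ln x).
Proof. by move=> x0; rewrite /powR gt_eqF. Qed.

(** * The two rates and their threshold *)

Section Exponents.
Variables (R : realType) (beta eps delta d : R).
Hypothesis b01 : 0 < beta < 1.
Hypothesis eps0 : 0 < eps.
Hypothesis delta0 : 0 < delta.
Hypothesis d0 : 0 < d.

Definition rate1 : R := eps `^ (1 / 2) * delta `^ (- (5 / 2)).
Definition rate2 : R :=
  eps `^ (beta / (1 + beta)) * delta `^ (- 2) * d `^ (- (beta / (1 + beta))).

Lemma rate1E : rate1 = delta ^- 2 * (eps / delta) `^ (1 / 2).
Proof.
have ed0 : 0 < eps / delta by rewrite divr_gt0.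
rewrite /rate1 -(lnK (x := delta ^- 2)) ?posrE ?invr_gt0 ?exprn_gt0//.
rewrite !powR_exp// -!expRD lnV ?posrE ?exprn_gt0// lnXn//.
by rewrite ln_div ?posrE//; congr expR; rewrite -mulr_natl; field.
Qed.

Lemma rate2E : rate2 = delta ^- 2 * (eps / d) `^ (beta / (1 + beta)).
Proof.
have ed0 : 0 < eps / d by rewrite divr_gt0.
rewrite /rate2 -(lnK (x := delta ^- 2)) ?posrE ?invr_gt0 ?exprn_gt0//.
rewrite !powR_exp// -!expRD lnV ?posrE ?exprn_gt0// lnXn//.
rewrite ln_div ?posrE//; congr expR; rewrite -mulr_natl; move: (beta / _) => t; ring.
Qed.

(** In logarithms both inequalities are linear; they differ by a factor [2] because the exponents of
    [delta] in the two rates, [-5/2] and [-2], are [1/2] apart. *)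
Lemma le_threshold :
  (delta <= eps `^ ((1 - beta) / (1 + beta)) * d `^ (2 * beta / (1 + beta))) =
  (rate2 <= rate1).
Proof.
have b1 : 1 + beta != 0 by have /andP[? ?] := b01; rewrite gt_eqF; lra.
rewrite /rate1 /rate2 !powR_exp// -!expRD !ler_expR -{1}(lnK (x := delta)) ?posrE// ler_expR.
have -> : (1 - beta) / (1 + beta) = 1 - 2 * (beta / (1 + beta)) by field.
have -> : 2 * beta / (1 + beta) = 2 * (beta / (1 + beta)) by field.
move: (beta / _) (ln eps) (ln delta) (ln d) => t a b e.
by apply/idP/idP => h; nra.
Qed.

End Exponents.

Theorem proposition4p2 (R : realType) (C C' K beta : R)
    (hbeta : beurling_constants C C' K beta)
    (A C0 : R) (hA : 0 < A) (hC0 : 1 <= C0) :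
  exists M : R,
  forall (G : bigraph R) (eps : R), orthodiagonal_map G -> edges_le G eps ->
  forall h : primal G -> R, harmonic h ->
  forall H : R * R -> R, admissible_extension C0 eps h H ->
  forall phi : R * R -> R, mollifier phi ->
  forall (z : R * R) (delta : R), Ghat G z -> 0 < delta ->
  let d := edist_to z (frontier (Ghat G)) in
  eps <= A * delta -> delta <= d / 2 ->
  let L := laplacian (convolution_on (Ghat G) (rescale phi delta) H) z in
  let N := norm_D 2 phi + norm_D 3 phi in
  let E1 := eps `^ (1 / 2) * delta `^ (- (5 / 2)) * N * max_norm h in
  let E2 := eps `^ (beta / (1 + beta)) * delta `^ (- 2)
            * d `^ (- (beta / (1 + beta))) * N * max_norm h in
  let threshold := eps `^ ((1 - beta) / (1 + beta))
                   * d `^ (2 * beta / (1 + beta)) in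
  [/\ `|L| <= M * E1 + M * E2,
      delta <= threshold -> `|L| <= M * E1 &
      ~ (delta <= threshold) -> `|L| <= M * E2].
Proof.
have [[_ C'0 K0] b01 _ hol] := hbeta.
(* The factor [1 + A] dominates [1], [eps / delta] and [eps / d], and pays for lowering the
   exponents; the factor [2] absorbs the smaller rate into the larger one. *)
pose M1 := main_constant C' K beta C0; exists (2 * (M1 * (1 + A))).
move=> G eps oG le h hh H aH phi mphi z delta Gz delta0 d eA dd L N E1 E2 threshold.
have eps0 := eps_gt0 oG Gz le.
have d0 : 0 < d by lra.
have LM : `|L| <= M1 * (delta ^- 2 * max_norm h * N * ((eps / d) `^ beta + eps / delta)).
  exact: main_estimate.
have Hm0 : 0 <= max_norm h := max_norm_ge0 h.
have N0 : 0 <= N.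
  by apply: addr_ge0; apply: le_trans (normr_ge0 _) _;
    [exact: (partial_le_norm_D mphi (s := [:: true; true]) 0 erefl)
    |exact: (partial_le_norm_D mphi (s := [:: true; true; true]) 0 erefl)].
have M10 : 0 <= M1 by exact: main_constant_ge0.
have r1 : 0 <= rate1 eps delta by rewrite mulr_ge0 ?powR_ge0.
have r2 : 0 <= rate2 beta eps delta d by rewrite !mulr_ge0 ?powR_ge0.
have E1E : E1 = rate1 eps delta * (N * max_norm h) by rewrite mulrA.
have E2E : E2 = rate2 beta eps delta d * (N * max_norm h) by rewrite mulrA.
have tE : (delta <= threshold) = (rate2 beta eps delta d <= rate1 eps delta).
  exact: le_threshold.
have dV : 0 <= delta ^- 2 by rewrite invr_ge0 exprn_ge0// ltW.
have e1 : delta ^- 2 * (eps / delta) <= (1 + A) * rate1 eps delta.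
  rewrite rate1E// [leRHS]mulrCA; apply: ler_wpM2l => //.
  rewrite -[leLHS]powRr1; last by rewrite divr_ge0// ltW.
  apply: powR_absorb; [exact: divr_gt0|rewrite ler_pdivrMr//; lra|lra|lra].
(* The exponent drops by [beta - beta / (1 + beta)], which lies in [[0, 1]], and [eps / d <= A / 2]
   because [delta <= d / 2]. *)
have e2 : delta ^- 2 * (eps / d) `^ beta <= (1 + A) * rate2 beta eps delta d.
  rewrite rate2E// [leRHS]mulrCA; apply: ler_wpM2l => //.
  have /andP[b0 b1] := b01; have b1' : 0 < 1 + beta by lra.
  apply: powR_absorb; [exact: divr_gt0|rewrite ler_pdivrMr//; nra|lra|].
  have bb : beta / (1 + beta) <= beta by rewrite ler_pdivrMr//; nra.
  by rewrite bb/= -lerBlDr (le_trans _ (divr_ge0 (ltW b0) (ltW b1')))//; lra.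
have {LM} LM : `|L| <= M1 * (1 + A) * (N * max_norm h) * (rate1 eps delta + rate2 beta eps delta d).
  apply: le_trans LM _; rewrite -!mulrA; apply: ler_wpM2l => //.
  rewrite (_ : delta ^- 2 * _ = N * max_norm h * (delta ^- 2 * (eps / delta) + delta ^- 2 * (eps / d) `^ beta)); last by ring.
  rewrite (_ : (1 + A) * _ = N * max_norm h * ((1 + A) * rate1 eps delta + (1 + A) * rate2 beta eps delta d)); last by ring.
  by apply: ler_wpM2l; [exact: mulr_ge0|exact: lerD].
rewrite {}E1E {}E2E tE {tE e1 e2}.
have Z0 : 0 <= M1 * (1 + A) * (N * max_norm h).
  by apply: mulr_ge0; [apply: mulr_ge0 => //; lra|exact: mulr_ge0].
have ZE X : 2 * (M1 * (1 + A)) * (X * (N * max_norm h)) = 2 * (M1 * (1 + A) * (N * max_norm h) * X) by ring.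
rewrite !ZE; move: (_ * (N * _)) (rate1 _ _) (rate2 _ _ _ _) r1 r2 LM Z0 => {}Z X1 X2 X10 X20 LM Z0.
have Z1 : 0 <= Z * X1 by exact: mulr_ge0.
have Z2 : 0 <= Z * X2 by exact: mulr_ge0.
rewrite mulrDr in LM; split=> [|h21|/negP]; [lra| |].
  by have := ler_wpM2l Z0 h21; lra.
by rewrite -ltNge => /ltW/(ler_wpM2l Z0); lra.
Qed.
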